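(* Let $d\geq 3$ and let $E\subset[1,2]$ with upper Minkowski dimension $\dim_{\mathrm{M}}E=\beta$. Let $M_E$ be the spherical maximal operator $M_Ef(x)=\sup_{t\in E}\left|\int_{\mathbb{S}^{d-1}}f(x-ty)\,d\sigma(y)\right|$. (i) Suppose that $\beta<1$ and $\sup_{0<\delta<1}\delta^{\beta}N(E,\delta)<\infty$. Then $\mathcal{T}^{rad}_E=\Delta(\beta)$. (ii) Suppose that $\sup_{0<\delta<1}\delta^{\beta}N(E,\delta)=\infty$. Then $\mathcal{T}^{rad}_E=\Delta(\beta)\setminus[Q_1(\beta),Q_2(\beta)]$. (iii) Suppose that $\frac{d}{d-1}\le q\le \frac{d^2}{d-1}$. Then $M_E$ is bounded from $L^{d/(d-1)}_{rad}(\mathbb{R}^d)$ to $L^q(\mathbb{R}^d)$ if and only if $\sup_{0<\delta<1}(\log(1/\delta))^{q/d}\,\delta N(E,\delta)<\infty$.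
   Context: $\sigma$ is the normalized surface measure on $\mathbb{S}^{d-1}$. For bounded $F\subset\mathbb{R}$, $N(F,a)$ is the minimal number of intervals of length $a$ needed to cover $F$. The upper Minkowski dimension is $\dim_{\mathrm{M}}E=\inf\{a>0:\exists c>0 \text{ with } N(E,\delta)\le c\delta^{-a}\ \forall \delta\in(0,1)\}$. The radial type set is $\mathcal{T}^{rad}_E=\{(1/p,1/q)\in[0,1]^2: M_E \text{ is bounded from } L^p_{rad}(\mathbb{R}^d)\text{ to } L^q(\mathbb{R}^d)\}$, where $L^p_{rad}$ denotes the radial functions in $L^p$ (with $1/\infty=0$). For $0\le\beta\le1$, $\Delta(\beta)$ is the closed triangle with vertices $O=(0,0)$, $Q_1(\beta)=(\frac{d-1}{d-1+\beta},\frac{d-1}{d-1+\beta})$, $Q_2(\beta)=(\frac{d(d-1)}{d^2-1+\beta},\frac{d-1}{d^2-1+\beta})$; $[P,Q]$ is the closed segment with endpoints $P,Q$. *)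

(* Defs.v *)
From HB Require Import structures.
From mathcomp Require Import all_boot all_order all_algebra.
From mathcomp Require Import all_classical all_reals all_analysis.
Set Implicit Arguments. Unset Strict Implicit. Unset Printing Implicit Defensive.
Import Order.TTheory GRing.Theory Num.Theory.
Import numFieldNormedType.Exports.
Local Open Scope classical_set_scope.
Local Open Scope ring_scope.

Section Defs.
Variable R : realType.

Definition enorm (d : nat) (x : 'rV[R]_d) : R := Num.sqrt (\sum_(i < d) x 0 i ^+ 2).

(* Lebesgue integral on R^d of a nonnegative function, as the iterated
   one-dimensional Lebesgue integral (Tonelli). *)
Fixpoint iint (n : nat) : ('rV[R]_n -> \bar R) -> \bar R :=
  match n as m return ('rV[R]_m -> \bar R) -> \bar R with
  | 0 => fun f => f 0
  | n'.+1 => fun f =>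
      (\int[@lebesgue_measure R]_x
          iint (fun v : 'rV[R]_n' => f (row_mx (const_mx x : 'rV[R]_1) v)))%E
  end.

Definition rint (d : nat) (f : 'rV[R]_d -> R) : \bar R :=
  (iint (fun x => (Num.max (f x) 0)%:E) - iint (fun x => (Num.max (- f x) 0)%:E))%E.

Definition volB (d : nat) : \bar R := iint (fun z : 'rV[R]_d => ((enorm z <= 1)%R%:R)%:E).

(* Integral against the normalized surface measure sigma on S^{d-1}, through
   the cone representation sigma(A) = |{r y : 0 < r <= 1, y in A}| / |B(0,1)|,
   i.e.  int_S g dsigma = |B|^{-1} int_{B\{0}} g(z/|z|) dz. *)
Definition sphere_int (d : nat) (g : 'rV[R]_d -> R) : \bar R :=
  let h := fun z : 'rV[R]_d =>
      (((0 < enorm z) && (enorm z <= 1))%R%:R * g ((enorm z)^-1 *: z))%R in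
  (rint h * ((fine (volB d))^-1)%:E)%E.

Definition sph_avg (d : nat) (f : 'rV[R]_d -> R) (t : R) (x : 'rV[R]_d) : \bar R :=
  sphere_int (fun y => f (x - t *: y)).

Definition ME (d : nat) (E : set R) (f : 'rV[R]_d -> R) (x : 'rV[R]_d) : \bar R :=
  ereal_sup [set `|sph_avg f t x|%E | t in E].

Definition esssupd (d : nat) (f : 'rV[R]_d -> \bar R) : \bar R :=
  ereal_inf [set M : \bar R | iint (fun x => ((M < `|f x|)%E%:R)%:E) = 0%E].

(* L^p norm on R^d, parametrized by a = 1/p in [0,1] (a = 0 means p = oo). *)
Definition Lnormd (d : nat) (a : R) (f : 'rV[R]_d -> \bar R) : \bar R :=
  if a == 0 then esssupd f
  else poweR (iint (fun x => poweR `|f x|%E a^-1)) a.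

(* M_E is bounded from L^p_rad(R^d) to L^q(R^d), with a = 1/p, b = 1/q.
   Radial functions: f(x) = f0(|x|) with f0 measurable. *)
Definition bounded_rad (d : nat) (E : set R) (a b : R) : Prop :=
  exists C : R, forall f0 : R -> R, measurable_fun setT f0 ->
    let f := fun x : 'rV[R]_d => f0 (enorm x) in
    (Lnormd a (fun x => (f x)%:E) < +oo)%E ->
    (Lnormd b (ME E f) <= C%:E * Lnormd a (fun x => (f x)%:E))%E.

Definition Trad (d : nat) (E : set R) : set (R * R) :=
  [set ab | 0 <= ab.1 <= 1 /\ 0 <= ab.2 <= 1 /\ bounded_rad d E ab.1 ab.2].

Definition covers (F : set R) (a : R) (n : nat) : Prop :=
  exists c : 'I_n -> R, F `<=` \bigcup_(i in setT) `[c i, c i + a]%classic.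

Definition Ncov (F : set R) (a : R) : R :=
  inf [set (n%:R : R) | n in covers F a].

Definition dimM (E : set R) : R :=
  inf [set a : R | 0 < a /\ exists c : R, 0 < c /\
        forall delta : R, 0 < delta < 1 -> Ncov E delta <= c * powR delta (- a)].

Definition Q1 (d : nat) (beta : R) : R * R :=
  ((d.-1)%:R / ((d.-1)%:R + beta), (d.-1)%:R / ((d.-1)%:R + beta)).
Definition Q2 (d : nat) (beta : R) : R * R :=
  ((d * d.-1)%:R / ((d ^ 2).-1%:R + beta), (d.-1)%:R / ((d ^ 2).-1%:R + beta)).

Definition Delta (d : nat) (beta : R) : set (R * R) :=
  [set p | exists l1 l2 : R, 0 <= l1 /\ 0 <= l2 /\ l1 + l2 <= 1 /\
      p = (l1 * (Q1 d beta).1 + l2 * (Q2 d beta).1,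
           l1 * (Q1 d beta).2 + l2 * (Q2 d beta).2)].

Definition segment (P Q : R * R) : set (R * R) :=
  [set p | exists s : R, 0 <= s <= 1 /\
      p = (s * P.1 + (1 - s) * Q.1, s * P.2 + (1 - s) * Q.2)].

End Defs.

(* Main.v *)
(* If f(x) = f0(|x|), the average of f over the sphere of radius t about x, with
   |x| = r, is the integral of f0 over |r - t| < s < r + t against an explicit
   kernel, which is at most s / (r t) up to a constant, at most (2 s)^(d-2) when
   r >= 1/2, and at least (s/6)^(d-2) when r is comparable to t and
   2 |r - t| <= s <= 1/2.

   Upper bounds. Let F be normalized in L^p(s^(d-1) ds). Splitting F at a height
   eta that depends on r only bounds the averages for all t in E at once by a
   function of r that is integrated by Tonelli.  For r >= 3 this uses a window of
   bounded length, for r <= 1/2 a truncated power of F.  For 1/2 < r < 3 the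
   averages are at most a multiple of the integral of F s^(d-2) over
   s >= delta(r) := dist(r, E).  With a decreasing weight Y, equal to
   s^(-(1-beta)/q) or, for p = d/(d-1), to (log 1/s)^(1/d), the splitting reduces
   the L^q bound to |{delta <= s}| <= 5 s N(E,s), which says that Y o delta is in
   weak L^q.

   Lower bounds. Test M_E on the indicators of a large ball (q >= p), of a thin
   shell (q <= d p) and of a small ball of radius s, whose averages are at least
   c s^(d-1) on {delta <= c s}, a set of measure at least c s N(E,s); at
   p = d/(d-1) replace the last one by |x|^(-(d-1)) on 4 s <= |x| <= 1/2. *)

Require Import Defs.
From HB Require Import structures.
From mathcomp Require Import all_boot all_order all_algebra.
From mathcomp Require Import all_classical all_reals all_analysis.
From mathcomp Require Import finmap measurable_realfun.
From mathcomp Require Import ring lra.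
Set Implicit Arguments. Unset Strict Implicit. Unset Printing Implicit Defensive.
Import Order.TTheory GRing.Theory Num.Theory.
Import numFieldNormedType.Exports.
Import HBNNSimple.
Local Open Scope classical_set_scope.
Local Open Scope ring_scope.

Local Notation mu := (@lebesgue_measure _).

(** As [iint] is an iterated one-dimensional integral, rotation invariance and polar coordinates are
    derived from Tonelli and shears. As [E] is arbitrary, the supremum in [ME] may run over
    uncountably many t; every region therefore supplies a measurable function of the radius alone
    that dominates the q-th powers of all averages with t in [E].

    Why weak L^q of Y o delta gives a strong bound: let X = Y o delta, and let B(r) be the integral
    of F^p s^(d-1) Y over s >= delta(r). As Y decreases and F is normalized, B <= X. The weight
    comes with the density psi = -Y', whose integral over s >= delta(r) is at most X(r). Splitting F
    s^(d-2) / psi at height ((B+1)/X)^(1/p) bounds the average by a multiple of ((B+1)/X)^(1/p) X.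
    As (B+1)/X <= 2 and p <= q, the q-th power is at most a multiple of X^(q-1) (B+1). After Tonelli
    a given s meets only radii with X(r) >= Y(s), on which the weak bound makes the integral of
    X^(q-1) at most a multiple of 1/Y(s). This cancels the factor Y(s) in B, so nothing is lost at
    the endpoint. *)

Lemma ge0_le_integral_nomeas {R : realType} d (T : measurableType d) (m : {measure set T -> \bar R})
  (D : set T) (f g : T -> \bar R) :
  (forall x, D x -> 0 <= f x)%E -> (forall x, D x -> f x <= g x)%E ->
  (\int[m]_(x in D) f x <= \int[m]_(x in D) g x)%E.
Proof.
move=> f0 fg.
(* The integral of a nonnegative function is the supremum over its simple minorants, hence monotone
   whatever the measurability of either side. *)
rewrite !ge0_integralE//; last by move=> x Dx; exact: le_trans (f0 x Dx) (fg x Dx).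
apply: le_ereal_sup => _ [h hf <-]; exists h => // x.
apply: (le_trans (hf x)); rewrite /patch; case: ifPn => // /set_mem; exact: fg.
Qed.

Lemma ge0_le_integral_sub {R : realType} d (T : measurableType d) (m : {measure set T -> \bar R})
  (A B : set T) (f g : T -> \bar R) :
  (forall x, A x -> 0 <= f x)%E -> (forall x, B x -> 0 <= g x)%E ->
  (forall x, A x -> B x /\ (f x <= g x)%E) ->
  (\int[m]_(x in A) f x <= \int[m]_(x in B) g x)%E.
Proof.
move=> f0 g0 h; rewrite integral_mkcond [leRHS]integral_mkcond.
apply: ge0_le_integral_nomeas => x _; first exact: erestrict_ge0.
rewrite !patchE; case: ifPn => [/set_mem/h[Bx fg]|_]; first by rewrite mem_set.
by case: ifPn => // /set_mem; exact: g0.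
Qed.

(** * Iterated integrals and their rotation invariance *)

Section iint_theory.
Context {R : realType}.
Local Open Scope ereal_scope.

(** Measurability on row vectors is tested along all families with measurable coordinates, without
    choosing a sigma-algebra on them; the property then passes to slices and compositions at
    once. *)
Definition bmeas n (f : 'rV[R]_n -> \bar R) : Prop :=
  forall d (T : measurableType d) (a : T -> 'rV[R]_n),
  (forall i, measurable_fun setT (fun t => a t 0%R i)) ->
  measurable_fun setT (fun t => f (a t)).

Lemma iint_ge0 n (f : 'rV[R]_n -> \bar R) : (forall v, 0 <= f v) -> 0 <= iint f.
Proof.
elim: n f => [|n IH] f f0 /=; first exact: f0.
by apply: integral_ge0 => x _; apply: IH.
Qed.

Lemma eq_iint n (f g : 'rV[R]_n -> \bar R) : f =1 g -> iint f = iint g.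
Proof. by move=> fg; congr iint; apply/funext. Qed.

Lemma le_iint n (f g : 'rV[R]_n -> \bar R) :
  (forall v, 0 <= f v) -> (forall v, f v <= g v) -> iint f <= iint g.
Proof.
elim: n f g => [|n IH] f g f0 fg /=; first exact: fg.
apply: ge0_le_integral_nomeas => x _; last exact: IH.
by apply: iint_ge0.
Qed.

Lemma measurable_row_mx n d (T : measurableType d) (a : T -> R) (b : T -> 'rV[R]_n) :
  measurable_fun setT a -> (forall i, measurable_fun setT (fun t => b t 0%R i)) ->
  forall i, measurable_fun setT (fun t => (row_mx (const_mx (a t) : 'rV[R]_1) (b t)) 0%R i).
Proof.
move=> ma mb i; case: (@split_ordP 1 n i) => j ->.
  by under eq_fun do rewrite row_mxEl mxE.
by under eq_fun do rewrite row_mxEr; exact: mb.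
Qed.

Lemma bmeas_row_mx n (f : 'rV[R]_n.+1 -> \bar R) : bmeas f ->
  forall d (T : measurableType d) (a : T -> R) (b : T -> 'rV[R]_n),
  measurable_fun setT a -> (forall i, measurable_fun setT (fun t => b t 0%R i)) ->
  measurable_fun setT (fun t => f (row_mx (const_mx (a t) : 'rV[R]_1) (b t))).
Proof. by move=> mf d T a b ma mb; apply: mf; exact: measurable_row_mx. Qed.

Lemma bmeas_slice n (f : 'rV[R]_n.+1 -> \bar R) (x : R) : bmeas f ->
  bmeas (fun v : 'rV[R]_n => f (row_mx (const_mx x : 'rV[R]_1) v)).
Proof. by move=> mf d T a ma; apply: bmeas_row_mx. Qed.

(** Countably many rectangles of finite measure, indexed through a pairing of naturals, exhaust the
    product. This is what lets Tonelli be iterated over the dimension. *)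
Lemma prod_sigma_finite d1 d2 (T1 : measurableType d1) (T2 : measurableType d2) 
 (m1 : {sigma_finite_measure set T1 -> \bar R})
 (m2 : {sigma_finite_measure set T2 -> \bar R}) : 
  exists m : {sigma_finite_measure set (T1 * T2)%type -> \bar R}, m = (m1 \x m2) :> (set _ -> _).
Proof.
have [F FT Ff] := sigma_finiteT m1; have [G GT Gf] := sigma_finiteT m2.
have sf : sigma_finite setT (m1 \x m2).
  exists (fun n => if choice.unpickle n is Some (i, j) then F i `*` G j else set0).
    apply/seteqP; split => // -[x y] _.
    have [i _ Fi] : (\bigcup_i F i) x by rewrite -FT.
    have [j _ Gj] : (\bigcup_j G j) y by rewrite -GT.
    by exists (choice.pickle (i, j)) => //; rewrite choice.pickleK.
  move=> k; case: (choice.unpickle k) => [[i j]|]; last by rewrite measure0; split.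
  have [mF Fy] := Ff i; have [mG Gy] := Gf j.
  split; first exact: measurableX.
  by rewrite [ltLHS](product_measure1E m1 m2)// lte_mul_pinfty// ge0_fin_numE.
pose mix := @Measure_isSigmaFinite.Build _ _ _ (m1 \x m2) sf.
by exists (HB.pack_for {sigma_finite_measure set (T1 * T2)%type -> \bar R} (m1 \x m2) mix).
Qed.

(** Once the iterated integral is a single integral over one sigma-finite space, it depends
    measurably on a parameter by Tonelli; see [measurable_iint]. *)
Lemma iint_rep n : exists (d : measure_display) (T : measurableType d)
    (m : {sigma_finite_measure set T -> \bar R}) (c : T -> 'rV[R]_n),
  (forall i, measurable_fun setT (fun t => c t 0%R i)) /\
  forall f, bmeas f -> (forall v, 0 <= f v) -> iint f = \int[m]_t f (c t).
Proof.
elim: n => [|n [d [T [m [c [mc IH]]]]]].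
  exists _, R, (\d_(0%R : R)), (fun=> 0%R); split => [[]//|f mf f0] /=.
  by rewrite integral_dirac ?diracT ?mul1e.
have [m' m'E] := prod_sigma_finite (@lebesgue_measure R) m.
exists _, (measurableTypeR R * T)%type, m', (fun p => row_mx (const_mx p.1 : 'rV[R]_1) (c p.2)).
have mcp : forall i, measurable_fun setT (fun p : measurableTypeR R * T => c p.2 0%R i).
  by move=> i; apply: (measurableT_comp (mc i)).
split; first by apply: measurable_row_mx => //; exact: measurable_fst.
move=> f mf f0 /=; rewrite m'E fubini_tonelli1//; last first.
  by apply: bmeas_row_mx => //; exact: measurable_fst.
by apply: eq_integral => x _; rewrite IH//; exact: bmeas_slice.
Qed.

End iint_theory.

(** * Image measures, affine substitutions and planar rotations *)

Section change_var.
Context {R : realType}.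
Local Open Scope ereal_scope.

Lemma ge0_measurable_ind d (T : measurableType d) (P : (T -> \bar R) -> Prop) :
  (forall A, measurable A -> P (fun x => (\1_A x)%:E)) ->
  (forall f g : T -> \bar R, measurable_fun setT f -> measurable_fun setT g ->
    (forall x, 0 <= f x) -> (forall x, 0 <= g x) -> P f -> P g -> P (f \+ g)) ->
  (forall (c : R) (f : T -> \bar R), (0 <= c)%R -> measurable_fun setT f ->
    (forall x, 0 <= f x) -> P f -> P (fun x => c%:E * f x)) ->
  (forall f_ : nat -> T -> \bar R, (forall n, measurable_fun setT (f_ n)) ->
    (forall n x, 0 <= f_ n x) -> (forall x, nondecreasing_seq (f_^~ x)) ->
    (forall n, P (f_ n)) -> P (fun x => limn (f_^~ x))) ->
  forall f : T -> \bar R, measurable_fun setT f -> (forall x, 0 <= f x) -> P f.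
Proof.
move=> P1 PD PZ Plim f mf f0.
pose g := nnsfun_approx measurableT mf.
have -> : f = fun x => limn (fun n => (g n x)%:E).
  by apply/funext => x; apply/esym/cvg_lim => //; exact: cvg_nnsfun_approx.
apply: Plim => [n|n x|x a b ab|n].
- exact/measurable_EFinP.
- by rewrite lee_fin.
- by rewrite lee_fin; exact/lefP/nd_nnsfun_approx.
have -> : (fun x => (g n x)%:E) = (fun x => \sum_(r <- enum_fset (fset_set (range (g n))))
    (r%:E * (\1_(g n @^-1` [set r]) x)%:E)).
  by apply/funext => x; rewrite fimfunE fsbig_finite//= sumEFin.
have : forall r, r \in enum_fset (fset_set (range (g n))) -> (0 <= r)%R.
  move=> r; rewrite -[_ \in _]/(r \in fset_set _) in_fset_set// => /set_mem[x _ <-]; exact: fun_ge0.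
move: (enum_fset _) => s s0.
have mi r : measurable_fun setT (fun x => (\1_(g n @^-1` [set r]) x)%:E : \bar R).
  exact/measurable_EFinP.
elim: s s0 => [|r s IH] s0.
  under eq_fun do rewrite big_nil.
  have -> : (fun=> 0) = (fun x => (0:R)%:E * (\1_(@set0 T) x)%:E).
    by apply/funext => x; rewrite mul0e.
  by apply: PZ => //; [exact/measurable_EFinP|exact: P1].
under eq_fun do rewrite big_cons.
have s0' u : u \in s -> (0 <= u)%R by move=> us; apply: s0; rewrite inE us orbT.
apply: (PD (fun x => r%:E * _) (fun x => \sum_(j <- s) _)).
- by apply: emeasurable_funM.
- by apply: emeasurable_sum => i; apply: emeasurable_funM.
- by move=> x; rewrite mule_ge0 ?lee_fin// s0// mem_head.
- by move=> x; rewrite big_seq sume_ge0// => i si; rewrite mule_ge0 ?lee_fin// s0'.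
- apply: PZ => //; first by rewrite s0// mem_head.
  by apply: P1; rewrite -[X in measurable X]setTI; exact: measurable_funP.
- exact: IH.
Qed.

(** [m'] is the image under [phi] of the measure with density [g]. A substitution formula is thereby
    reduced to computing [m'] on half-open intervals, since these determine Lebesgue measure. *)
Lemma density_pushforward d1 d2 (T1 : measurableType d1) (T2 : measurableType d2)
    (m : {measure set T1 -> \bar R}) (phi : T1 -> T2) (g : T1 -> R) :
  measurable_fun setT phi -> measurable_fun setT g -> (forall x, (0 <= g x)%R) ->
  exists m' : {measure set T2 -> \bar R},
    (forall A, m' A = \int[m]_(x in phi @^-1` A) (g x)%:E) /\
    (forall G, measurable_fun setT G -> (forall y, 0 <= G y) ->
      \int[m']_y G y = \int[m]_x (G (phi x) * (g x)%:E)).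
Proof.
move=> mphi mg g0.
pose nu A := \int[m]_(x in phi @^-1` A) (g x)%:E.
have mpre A : measurable A -> measurable (phi @^-1` A).
  by move=> mA; rewrite -[X in measurable X]setTI; exact: mphi.
have nu0 : nu set0 = 0 by rewrite /nu preimage_set0 integral_set0.
have nu_ge0 A : 0 <= nu A by apply: integral_ge0 => x _; rewrite lee_fin.
have nu_sigma : semi_sigma_additive nu.
  move=> F mF tF mUF; rewrite /nu preimage_bigcup ge0_integral_bigcup//.
  - by apply: is_cvg_ereal_nneg_natsum_cond => n _ _; apply: integral_ge0 => x _; rewrite lee_fin.
  - by move=> k; exact: mpre.
  - exact/measurable_EFinP/measurable_funTS.
  - by move=> x _; rewrite lee_fin.
  - apply/trivIsetP => i j _ _ ij; rewrite -preimage_setI.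
    by move/trivIsetP : tF => /(_ _ _ _ _ ij) ->//; rewrite preimage_set0.
pose mix := isMeasure.Build _ _ _ nu nu0 nu_ge0 nu_sigma.
pose m' : {measure set T2 -> \bar R} := HB.pack_for {measure set T2 -> \bar R} nu mix.
exists m'; split => // G mG G0.
apply: (@ge0_measurable_ind _ _ (fun G => \int[m']_y G y = \int[m]_x (G (phi x) * (g x)%:E))) mG G0 => //.
- move=> A mA; rewrite integral_indic// setIT [LHS]/(nu A) /nu integral_mkcond.
  apply: eq_integral => x _; rewrite patchE indicE [in RHS]/=.
  have -> : (x \in phi @^-1` A) = (phi x \in A) by apply/idP/idP => /set_mem ?; exact/mem_set.
  by case: ifPn; rewrite ?mul1e ?mul0e.
- move=> f h mf mh f0 h0 Pf Ph; rewrite ge0_integralD// Pf Ph -ge0_integralD//.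
  + by apply: eq_integral => x _; rewrite ge0_muleDl.
  + by move=> x _; rewrite mule_ge0// lee_fin.
  + by apply: emeasurable_funM; [exact: measurableT_comp|exact/measurable_EFinP].
  + by move=> x _; rewrite mule_ge0// lee_fin.
  + by apply: emeasurable_funM; [exact: measurableT_comp|exact/measurable_EFinP].
- move=> c f c0 mf f0 Pf; rewrite ge0_integralZl_EFin// Pf -ge0_integralZl_EFin//.
  + by apply: eq_integral => x _; rewrite muleA.
  + by move=> x _; rewrite mule_ge0// lee_fin.
  + by apply: emeasurable_funM; [exact: measurableT_comp|exact/measurable_EFinP].
- move=> f_ mf f0 ndf Pf.
  rewrite monotone_convergence//.
  rewrite (_ : (fun n => _) = fun n => \int[m]_x (f_ n (phi x) * (g x)%:E)); last exact/funext.
  rewrite -monotone_convergence//.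
  + apply: eq_integral => x _; apply/cvg_lim => //.
    rewrite muleC; under eq_fun do rewrite muleC.
    apply: cvgeZl => //; exact: ereal_nondecreasing_is_cvgn.
  + by move=> n; apply: emeasurable_funM; [exact: measurableT_comp|exact/measurable_EFinP].
  + by move=> n x _; rewrite mule_ge0// lee_fin.
  + by move=> x _ a b ab; rewrite lee_wpmul2r ?lee_fin//; exact: ndf.
Qed.

End change_var.

Section affine.
Context {R : realType}.
Local Open Scope ereal_scope.

Lemma integral_affine (a b : R) (f : R -> \bar R) : (0 < a)%R ->
  measurable_fun setT f -> (forall x, 0 <= f x) ->
  \int[mu]_x f x = a%:E * \int[mu]_x f (a * x + b)%R.
Proof.
move=> a0 mf f0.
have mphi : measurable_fun [set: measurableTypeR R]
    (fun x => (a * x + b)%R : measurableTypeR R).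
  by apply: measurable_funD => //; apply: measurable_funM.
have [m [mE intm]] := density_pushforward (@lebesgue_measure R) mphi
  (@measurable_cst _ _ _ _ setT a) (fun=> ltW a0).
have muE : forall A, measurable A -> mu A = m A.
  apply: lebesgue_measure_unique => _ [[c d] _ <-]; rewrite mE.
  have -> : (fun x => (a * x + b)%R) @^-1` [set` `]c, d]] = [set` `](c - b) / a, (d - b) / a]%R].
    apply/seteqP; split => x /=; rewrite !in_itv /= ltr_pdivrMr// ler_pdivlMr// => /andP[? ?].
      by apply/andP; split; lra.
    by apply/andP; split; lra.
  rewrite (_ : (fun x => (cst a x)%:E) = cst a%:E)// integral_cst// lebesgue_measure_itv /= [X in _ * X]lebesgue_measure_itv /= !lte_fin ltr_pM2r ?invr_gt0// ltrD2r.
  case: ifPn => _; last by rewrite mule0.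
  rewrite -!EFinB -EFinM; congr (_%:E); field.
  by rewrite gt_eqF.
rewrite (@eq_measure_integral _ _ _ _ m); last by move=> A mA _; exact: muE.
rewrite intm// muleC -ge0_integralZr//.
- by apply: (measurableT_comp mf).
- by rewrite lee_fin ltW.
Qed.

Lemma integral_shift (b : R) (f : R -> \bar R) :
  measurable_fun setT f -> (forall x, 0 <= f x) ->
  \int[mu]_x f (x + b)%R = \int[mu]_x f x.
Proof.
move=> mf f0; rewrite (@integral_affine 1 b f)// mul1e.
by under [RHS]eq_integral do rewrite mul1r.
Qed.

Lemma integral_scale (a : R) (f : R -> \bar R) : (0 < a)%R ->
  measurable_fun setT f -> (forall x, 0 <= f x) ->
  \int[mu]_x f x = a%:E * \int[mu]_x f (a * x)%R.
Proof.
move=> a0 mf f0; rewrite (@integral_affine a 0 f)//.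
by congr (_ * _); apply: eq_integral => x _; rewrite addr0.
Qed.

Let mu2 (G : R * R -> \bar R) := \int[mu]_x \int[mu]_y G (x, y).

Lemma tonelli_swap (G : R * R -> \bar R) : measurable_fun setT G -> (forall p, 0 <= G p) ->
  mu2 G = \int[mu]_y \int[mu]_x G (x, y).
Proof. by move=> mG G0; exact: (@fubini_tonelli _ _ _ _ _ mu mu). Qed.

Lemma measurable_lin2 (a b : R) : measurable_fun setT (fun p : R * R => (a * p.1 + b * p.2)%R).
Proof. by apply: measurable_funD; apply: measurable_funM. Qed.

Lemma measurable_lin22 (G : R * R -> \bar R) (a b c d : R) : measurable_fun setT G ->
  measurable_fun setT (fun p : R * R => G (a * p.1 + b * p.2, c * p.1 + d * p.2)%R).
Proof.
move=> mG; apply: (measurableT_comp mG).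
by apply: measurable_fun_pair; exact: measurable_lin2.
Qed.

Lemma shear2 (G : R * R -> \bar R) (a : R) : measurable_fun setT G -> (forall p, 0 <= G p) ->
  mu2 (fun p => G (p.1, p.2 + a * p.1)%R) = mu2 G.
Proof.
move=> mG G0; apply: eq_integral => x _ /=.
by rewrite (integral_shift (a * x) (f := fun y => G (x, y)))//; exact: measurableT_comp.
Qed.

Lemma shear1 (G : R * R -> \bar R) (a : R) : measurable_fun setT G -> (forall p, 0 <= G p) ->
  mu2 (fun p => G (p.1 + a * p.2, p.2)%R) = mu2 G.
Proof.
move=> mG G0; have mG' : measurable_fun setT (fun p : R * R => G (p.1 + a * p.2, p.2)%R).
  apply: (measurableT_comp mG); apply: measurable_fun_pair => //.
  by apply: measurable_funD => //; apply: measurable_funM.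
rewrite (tonelli_swap mG' (fun p => G0 _)) (tonelli_swap mG G0).
apply: eq_integral => y _ /=.
by rewrite (integral_shift (a * y) (f := fun x => G (x, y)))//; exact: measurableT_comp.
Qed.

(* A rotation other than the half-turn and the identity is a product of three shears. *)
Lemma rotation2 (G : R * R -> \bar R) (c s : R) : (c ^+ 2 + s ^+ 2 = 1)%R ->
  measurable_fun setT G -> (forall p, 0 <= G p) ->
  mu2 (fun p => G (c * p.1 - s * p.2, s * p.1 + c * p.2)%R) = mu2 G.
Proof.
have key (H : R * R -> \bar R) (e t : R) : t != 0%R -> (e ^+ 2 + t ^+ 2 = 1)%R ->
    measurable_fun setT H -> (forall p, 0 <= H p) ->
    mu2 (fun p => H (e * p.1 - t * p.2, t * p.1 + e * p.2)%R) = mu2 H.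
  (* With [e] the cosine and [t] the sine of an angle, [a] is minus the tangent of half the angle;
     the three shears have coefficients [a], [t], [a]. *)
  move=> t0 et mH H0; pose a := ((e - 1) / t)%R.
  pose H1 p := H (p.1 + a * p.2, p.2)%R.
  have mH1 : measurable_fun setT H1.
    apply: (measurableT_comp mH); apply: measurable_fun_pair => //.
    by apply: measurable_funD => //; apply: measurable_funM.
  pose H2 p := H1 (p.1, p.2 + t * p.1)%R.
  have mH2 : measurable_fun setT H2.
    apply: (measurableT_comp mH1); apply: measurable_fun_pair => //.
    by apply: measurable_funD => //; apply: measurable_funM.
  transitivity (mu2 (fun p => H2 (p.1 + a * p.2, p.2)%R)); last first.
    rewrite (shear1 a mH2); last by move=> p; exact: H0.
    by rewrite (shear2 t mH1); [exact: shear1|move=> p; exact: H0].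
  rewrite /mu2; apply: eq_integral => x _; apply: eq_integral => y _ /=.
  have at_ : (a * t = e - 1)%R by rewrite /a -mulrA mulVf ?mulr1.
  have aa : (a * (1 + e) = - t)%R.
    apply: (mulIf t0); rewrite mulrAC at_ (_ : - t * t = - (1 - e ^+ 2))%R; first by ring.
    by rewrite -et; ring.
  congr (H (_, _)).
    have -> : (x + a * y + a * (y + t * (x + a * y)) = x * (1 + a * t) + (a + a * (1 + a * t)) * y)%R by ring.
    rewrite at_ (_ : a + a * (1 + (e - 1)) = a * (1 + e))%R; last by ring.
    by rewrite aa; ring.
  have -> : (y + t * (x + a * y) = t * x + (1 + a * t) * y)%R by ring.
  by rewrite at_ /=; ring.
have [->|s0] := eqVneq s 0%R; last exact: key.
rewrite expr0n /= addr0 => c1 mG G0.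
have [->|c_neq1] := eqVneq c 1%R.
  by apply: eq_integral => x _; apply: eq_integral => y _ /=; rewrite !mul1r !mul0r subr0 add0r.
have -> : c = (-1)%R.
  by move/eqP: c1; rewrite sqrf_eq1 (negbTE c_neq1) => /eqP.
(* The half-turn has sine 0, so it is written as two quarter-turns. *)
have e1 : (0 ^+ 2 + 1 ^+ 2 = 1 :> R)%R by ring.
rewrite -(key G _ _ (oner_neq0 _) e1 mG G0).
pose G1 p := G (0 * p.1 - 1 * p.2, 1 * p.1 + 0 * p.2)%R.
have mG1 : measurable_fun setT G1.
  by have := measurable_lin22 0 (-1) 1 0 mG; under eq_fun do rewrite mulNr.
rewrite -(key G1 _ _ (oner_neq0 _) e1 mG1) => [|p]; last exact: G0.
by apply: eq_integral => x _; apply: eq_integral => y _ /=; congr (G (_, _)); rewrite /=; ring.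
Qed.

End affine.

Section rotation.
Context {R : realType}.
Local Open Scope ereal_scope.

Lemma measurable_iint n d (T : measurableType d) (g : T -> 'rV[R]_n -> \bar R) :
  (forall d' (T' : measurableType d') (tau : T' -> T) (a : T' -> 'rV[R]_n),
    measurable_fun setT tau -> (forall i, measurable_fun setT (fun t => a t 0%R i)) ->
    measurable_fun setT (fun t => g (tau t) (a t))) ->
  (forall t v, 0 <= g t v) -> measurable_fun setT (fun t => iint (g t)).
Proof.
move=> mg g0; have [d' [T' [m [c [mc iintE]]]]] := @iint_rep R n.
have -> : (fun t => iint (g t)) = (fun t => \int[m]_s g t (c s)).
  apply/funext => t; rewrite iintE// => d2 T2 a ma.
  exact: (mg _ _ (cst t)).
apply: (@measurable_fun_fubini_tonelli_F _ _ _ _ _ m (fun p => g p.1 (c p.2))) => //.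
by apply: mg => // i; exact: (measurableT_comp (mc i)).
Qed.

Definition sq n (z : 'rV[R]_n) : R := (\sum_(i < n) z 0%R i ^+ 2)%R.
Definition dotv n (x z : 'rV[R]_n) : R := (\sum_(i < n) x 0%R i * z 0%R i)%R.

Lemma measurable_sq n d (T : measurableType d) (a : T -> 'rV[R]_n) :
  (forall i, measurable_fun setT (fun t => a t 0%R i)) ->
  measurable_fun setT (fun t => sq (a t)).
Proof. by move=> ma; apply: measurable_sum => i; apply: measurable_funX. Qed.

Lemma sq_row_mx n (a : R) (v : 'rV[R]_n) : sq (row_mx (const_mx a : 'rV_1) v) = (a ^+ 2 + sq v)%R.
Proof.
rewrite /sq (@big_split_ord _ _ _ 1 n)/= big_ord1 row_mxEl mxE.
by congr (_ + _)%R; apply: eq_bigr => i _; rewrite row_mxEr.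
Qed.

Lemma dotv_row_mx n (x : 'rV[R]_(1 + n)) (a : R) (v : 'rV[R]_n) :
  dotv x (row_mx (const_mx a : 'rV_1) v : 'rV_(1 + n)) =
  (x 0%R (lshift n 0%R) * a + dotv (rsubmx x) v)%R.
Proof.
rewrite /dotv (@big_split_ord _ _ _ 1 n)/= big_ord1 row_mxEl mxE.
by congr (_ + _)%R; apply: eq_bigr => i _; rewrite row_mxEr mxE.
Qed.

Lemma row_mx0E n (a : R) (v : 'rV[R]_n) : (row_mx (const_mx a : 'rV_1) v : 'rV_n.+1) 0%R ord0 = a.
Proof.
transitivity ((row_mx (const_mx a : 'rV_1) v) 0%R (lshift n (ord0 : 'I_1))).
  by apply: f_equal; apply/val_inj.
by rewrite row_mxEl mxE.
Qed.

Lemma sq_ge0 n (z : 'rV[R]_n) : (0 <= sq z)%R.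
Proof. by apply: sumr_ge0 => i _; exact: sqr_ge0. Qed.

(** Induction on the dimension: the induction hypothesis turns all coordinates of [x] but the first
    into a single one, and a planar rotation merges the remaining pair. In dimension one no rotation
    is available, so [r] may be negative there; from dimension two on it is the norm of [x]. *)
Lemma iint_rotation n (x : 'rV[R]_n.+1) : exists r : R, (r ^+ 2 = sq x)%R /\ ((0 < n)%N -> (0 <= r)%R) /\
  forall Phi : R * R -> \bar R, measurable_fun setT Phi -> (forall p, 0 <= Phi p) ->
  iint (fun z : 'rV[R]_n.+1 => Phi (sq z, dotv x z)) =
  iint (fun z : 'rV[R]_n.+1 => Phi (sq z, (r * z 0%R ord0)%R)).
Proof.
elim: n x => [|n IH] x.
  exists (x 0%R ord0); split; first by rewrite /sq big_ord1.
  split => //.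
  by move=> Phi _ _; apply: eq_iint => z; rewrite /dotv big_ord1.
have [r' [r'E [_ IHr]]] := IH (rsubmx (x : 'rV_(1 + n.+1))).
pose x0 := (x : 'rV_(1 + n.+1)) 0%R (lshift _ 0%R).
have sqx : sq x = (x0 ^+ 2 + r' ^+ 2)%R.
  rewrite r'E /sq (@big_split_ord _ _ _ 1 n.+1)/= big_ord1.
  by congr (_ + _)%R; apply: eq_bigr => i _; rewrite mxE.
pose r := Num.sqrt (x0 ^+ 2 + r' ^+ 2).
have r2 : (r ^+ 2 = x0 ^+ 2 + r' ^+ 2)%R by rewrite sqr_sqrtr// addr_ge0// sqr_ge0.
exists r; split; first by rewrite sqx.
split=> [_|]; first exact: sqrtr_ge0.
move=> Phi mPhi Phi0.
(* [K] integrates out all coordinates beyond the first two, on which the planar rotation acts. *)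
pose K (p : R * R) := iint (fun w : 'rV[R]_n => Phi (p.1 ^+ 2 + p.2 ^+ 2 + sq w, r * p.1)%R).
have mK : measurable_fun setT K.
  apply: measurable_iint => // d T tau a mtau ma.
  apply: (measurableT_comp mPhi); apply: measurable_fun_pair => /=.
    apply: measurable_funD; last exact: measurable_sq.
    by apply: measurable_funD; apply: measurable_funX; apply: measurableT_comp.
  by apply: measurable_funM => //; apply: measurableT_comp.
have K0 p : 0 <= K p by apply: iint_ge0.
have -> : iint (fun z : 'rV[R]_n.+2 => Phi (sq z, (r * z 0%R ord0)%R)) = \int[mu]_a \int[mu]_b K (a, b).
  apply: eq_integral => a _ /=; apply: eq_integral => b _ /=; apply: eq_iint => w.
  by rewrite row_mx0E !sq_row_mx addrA.
have -> : iint (fun z : 'rV[R]_n.+2 => Phi (sq z, dotv x z)) =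
    \int[mu]_a \int[mu]_b iint (fun w : 'rV[R]_n => Phi (a ^+ 2 + b ^+ 2 + sq w, x0 * a + r' * b)%R).
  apply: eq_integral => a _.
  pose Psi p := Phi (a ^+ 2 + p.1, x0 * a + p.2)%R.
  have mPsi : measurable_fun setT Psi.
    by apply: (measurableT_comp mPhi); apply: measurable_fun_pair => /=; exact: measurable_funD.
  transitivity (iint (fun v => Psi (sq v, dotv (rsubmx (x : 'rV_(1 + n.+1))) v))).
    rewrite -[LHS]/(iint (fun v : 'rV[R]_n.+1 => Phi (sq (row_mx (const_mx a : 'rV_1) v),
      dotv x (row_mx (const_mx a : 'rV_1) v)))).
    by apply: eq_iint => v; rewrite sq_row_mx dotv_row_mx.
  rewrite IHr//; last by move=> p; exact: Phi0.
  apply: eq_integral => b _ /=; apply: eq_iint => w.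
  by rewrite row_mx0E !sq_row_mx /Psi /= addrA.
(* For [r = 0] the angle is undefined, but then [x0] and [r'] vanish and both sides agree. *)
have [r0|r0] := eqVneq r 0%R.
  have e0 : (x0 ^+ 2 + r' ^+ 2 = 0)%R by rewrite -r2 r0 expr0n.
  have /andP[/eqP x00 /eqP r'0] : (x0 == 0)%R && (r' == 0)%R.
    by rewrite -(sqrf_eq0 x0) -(sqrf_eq0 r') -paddr_eq0 ?sqr_ge0// e0.
  apply: eq_integral => a _; apply: eq_integral => b _; rewrite x00 r'0 /K r0.
  by rewrite !mul0r addr0.
have r2n : (r ^+ 2 != 0)%R by rewrite sqrf_eq0.
have cs : ((x0 / r) ^+ 2 + (- r' / r) ^+ 2 = 1)%R.
  by rewrite !expr_div_n sqrrN -mulrDl -r2 divff.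
rewrite -(rotation2 cs mK K0); apply: eq_integral => a _; apply: eq_integral => b _ /=.
rewrite /K /=; apply: eq_iint => w; congr (Phi (_ + _, _))%R.
  have -> : ((x0 / r * a - - r' / r * b) ^+ 2 + (- r' / r * a + x0 / r * b) ^+ 2 =
     ((x0 / r) ^+ 2 + (- r' / r) ^+ 2) * (a ^+ 2 + b ^+ 2))%R by ring.
  by rewrite cs mul1r.
by field.
Qed.

End rotation.

(** * Tonelli's theorem on products of measurable sets *)

Section tonelli_on.
Context {R : realType} d1 d2 (T1 : measurableType d1) (T2 : measurableType d2)
  (m1 : {sigma_finite_measure set T1 -> \bar R}) (m2 : {sigma_finite_measure set T2 -> \bar R})
  (A : set T1) (B : set T2) (G : T1 * T2 -> \bar R).
Hypotheses (mA : measurable A) (mB : measurable B) (mG : measurable_fun setT G)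
  (G0 : forall p, (0 <= G p)%E).
Local Open Scope ereal_scope.

Let H := G \_ (A `*` B).

Let mH : measurable_fun setT H.
Proof.
apply/(measurable_restrictT _ _).1; first exact: measurableX.
exact: measurable_funTS.
Qed.

Let H0 p : 0 <= H p.
Proof. by apply: erestrict_ge0. Qed.

Let H1 x : \int[m2]_y H (x, y) = ((fun x => \int[m2]_(y in B) G (x, y)) \_ A) x.
Proof.
rewrite patchE; case: ifPn => xA.
  rewrite [RHS]integral_mkcond; apply: eq_integral => y _; rewrite /H !patchE.
  by rewrite in_setX /= xA.
by apply: integral0_eq => y _; rewrite /H patchE in_setX /= (negbTE xA).
Qed.

Let H2 y : \int[m1]_x H (x, y) = ((fun y => \int[m1]_(x in A) G (x, y)) \_ B) y.
Proof.
rewrite patchE; case: ifPn => yB.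
  rewrite [RHS]integral_mkcond; apply: eq_integral => x _; rewrite /H !patchE.
  by rewrite in_setX /= yB andbT.
by apply: integral0_eq => x _; rewrite /H patchE in_setX /= (negbTE yB) andbF.
Qed.

Lemma tonelli_on : \int[m1]_(x in A) \int[m2]_(y in B) G (x, y) =
  \int[m2]_(y in B) \int[m1]_(x in A) G (x, y).
Proof.
rewrite integral_mkcond [RHS]integral_mkcond.
under eq_integral do rewrite -H1; under [RHS]eq_integral do rewrite -H2.
exact: fubini_tonelli.
Qed.

Lemma measurable_integral_on : measurable_fun setT (fun x => \int[m2]_(y in B) G (x, y)).
Proof.
have -> : (fun x => \int[m2]_(y in B) G (x, y)) = fun x => \int[m2]_y (G \_ (setT `*` B)) (x, y).
  apply/funext => x; rewrite integral_mkcond; apply: eq_integral => y _.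
  by rewrite !patchE in_setX /= in_setT.
apply: (@measurable_fun_fubini_tonelli_F _ _ _ _ _ m2).
  apply/(measurable_restrictT _ _).1; first exact: measurableX.
  exact: measurable_funTS.
by move=> p; apply: erestrict_ge0.
Qed.

End tonelli_on.

Section tonelli_real.
Context {R : realType} (A B : set R) (G : R * R -> \bar R).
Hypotheses (mA : measurable A) (mB : measurable B) (mG : measurable_fun setT G)
  (G0 : forall p, (0 <= G p)%E).
Local Open Scope ereal_scope.

Lemma tonelliR : \int[mu]_(x in A) \int[mu]_(y in B) G (x, y) =
  \int[mu]_(y in B) \int[mu]_(x in A) G (x, y).
Proof. exact: (tonelli_on mu mu mA mB mG G0). Qed.

Lemma measurable_integralR : measurable_fun setT (fun x : R => \int[mu]_(y in B) G (x, y)).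
Proof. exact: (measurable_integral_on mu mB mG G0). Qed.

End tonelli_real.

(** * Polar coordinates and spherical averages of radial functions *)

Section polar.
Context {R : realType}.
Local Open Scope ereal_scope.
Local Notation pos := (`]0%R, +oo[%classic : set R).

Lemma integral_scale_pos (a : R) (f : R -> \bar R) : (0 < a)%R ->
  measurable_fun setT f -> (forall x, 0 <= f x) ->
  \int[mu]_(x in pos) f x = a%:E * \int[mu]_(x in pos) f (a * x)%R.
Proof.
move=> a0 mf f0; rewrite integral_mkcond [in RHS]integral_mkcond (@integral_scale _ a)//.
- congr (_ * _); apply: eq_integral => x _; rewrite !patchE.
  have -> : ((a * x)%R \in pos) = (x \in pos) => //.
  by apply/idP/idP => /set_mem /=; rewrite ?in_itv/= ?andbT => h; apply/mem_set;
    rewrite /= in_itv /= andbT; move: h; rewrite pmulr_rgt0.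
- by apply/(measurable_restrictT _ _).1 => //; exact: measurable_funTS.
- by move=> x; exact: erestrict_ge0.
Qed.

(* [w] is the cotangent of an angle whose sine is [hw w] and whose cosine is
   [w * hw w]. *)
Definition kw (w : R) : R := Num.sqrt (1 + w ^+ 2).

Lemma kw_ge1 w : (1 <= kw w)%R.
Proof. by rewrite -[leLHS]sqrtr1 ler_sqrt ?lerDl ?sqr_ge0// addr_ge0// sqr_ge0. Qed.

Lemma kw_gt0 w : (0 < kw w)%R.
Proof. by rewrite (lt_le_trans ltr01)// kw_ge1. Qed.

Lemma kw2 w : (kw w ^+ 2 = 1 + w ^+ 2)%R.
Proof. by rewrite sqr_sqrtr// addr_ge0// sqr_ge0. Qed.

Definition hw (w : R) : R := (kw w)^-1.

Lemma hw_gt0 w : (0 < hw w)%R.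
Proof. by rewrite invr_gt0 kw_gt0. Qed.

Lemma hw_le1 w : (hw w <= 1)%R.
Proof. by rewrite invf_le1 ?kw_gt0// kw_ge1. Qed.

Lemma hw2 w : (hw w ^+ 2 = (1 + w ^+ 2)^-1)%R.
Proof. by rewrite exprVn kw2. Qed.

Lemma continuous_kw : continuous kw.
Proof.
move=> w; apply: (@continuous_comp _ _ _ (fun w : R => 1 + w ^+ 2)%R (@Num.sqrt R)); last exact: sqrt_continuous.
by apply: cvgD; [exact: cvg_cst|exact: exprn_continuous].
Qed.

Lemma continuous_hw : continuous hw.
Proof. by move=> w; apply: cvgV; [rewrite gt_eqF ?kw_gt0|exact: continuous_kw]. Qed.

Lemma measurable_kw : measurable_fun setT kw.
Proof. by apply: continuous_measurable_fun; exact: continuous_kw. Qed.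

Lemma measurable_hw : measurable_fun setT hw.
Proof. by apply: continuous_measurable_fun; exact: continuous_hw. Qed.

(** With w the cotangent of theta one has dw = - d theta / sin^2 theta, so this is the integral of
    sin^(n-2) over (0, pi): up to normalization, the spherical average of the constant 1. *)
Definition Jw n : \bar R := \int[mu]_w (hw w ^+ n)%:E.

Lemma measurable_hwX n : measurable_fun setT (fun w => (hw w ^+ n)%:E).
Proof. by apply/measurable_EFinP; apply: measurable_funX; exact: measurable_hw. Qed.

Lemma integralT_pos (f : R -> \bar R) : measurable_fun setT f -> (forall x, 0 <= f x) ->
  \int[mu]_x f x = \int[mu]_(x in pos) f x + \int[mu]_(x in pos) f (- x)%R.
Proof.
move=> mf f0.
have -> : setT = `]-oo, 0%R]%classic `|` pos :> set R.
  by apply/seteqP; split => x //= _; rewrite !in_itv /= andbT; case: (leP x 0%R) => ?; [left|right].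
rewrite ge0_integral_setU//=; last 2 first.
- by rewrite -[X in measurable_fun X _]setTI; exact: measurable_funTS.
- apply/disj_set2P/seteqP; split => x //= []; rewrite !in_itv /= andbT => h1 h2.
  by move: (le_lt_trans h1 h2); rewrite ltxx.
rewrite addeC; congr (_ + _).
have mfN : measurable_fun setT (fun x : R => f (- x)%R).
  by apply: (measurableT_comp mf); exact: oppr_measurable.
rewrite integral_itv_obnd_cbnd; last exact: measurable_funTS.
rewrite (@ge0_integration_by_substitution0 R (fun x => f (- x)%R) mfN (fun x => f0 _)).
by apply: eq_integral => x _; rewrite opprK.
Qed.

Lemma Jw_gt0 n : 0 < Jw n.
Proof.
apply: (@lt_le_trans _ _ (\int[mu]_(w in `[0%R, 1%R]) ((2^-1 : R) ^+ n)%:E)).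
  rewrite (_ : (fun=> _) = cst ((2^-1 : R) ^+ n)%:E)// integral_cst//= lebesgue_measure_itv /=.
  by rewrite lte_fin ltr01 -EFinB subr0 mule1 lte_fin exprn_gt0.
rewrite integral_mkcond; apply: ge0_le_integral_nomeas => w _.
  by apply: erestrict_ge0 => x _; rewrite lee_fin exprn_ge0.
rewrite patchE; case: ifPn => [/set_mem /=|_]; last by rewrite lee_fin exprn_ge0// ltW// hw_gt0.
rewrite in_itv /= => /andP[w0 w1]; rewrite lee_fin lerXn2r ?nnegrE ?invr_ge0 ?sqrtr_ge0//.
rewrite lef_pV2 ?posrE ?kw_gt0// -(@ler_pXn2r _ 2%N)// ?nnegrE ?sqrtr_ge0// kw2.
by have := expr_le1 (isT : (0 < 2)%N) w0; rewrite w1 => e; nra.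
Qed.

(** Two powers of the sine give 1 / (1 + w^2), which has a finite integral; the remaining ones are
    at most 1. *)
Lemma Jw_fin n : Jw n.+2 \is a fin_num.
Proof.
rewrite ge0_fin_numE; last by rewrite ltW// Jw_gt0.
apply: (@le_lt_trans _ _ (\int[mu]_w ((oneDsqr w)^-1)%:E)).
  apply: ge0_le_integral_nomeas => w _; first by rewrite lee_fin exprn_ge0// ltW// hw_gt0.
  rewrite lee_fin -addn2 exprD hw2 /oneDsqr ler_piMl//.
    by rewrite invr_ge0 addr_ge0// sqr_ge0.
  by rewrite exprn_ile1// ?hw_le1// ltW// hw_gt0.
have m1 : measurable_fun setT (fun w : R => ((oneDsqr w)^-1)%:E).
  by apply/measurable_EFinP; apply: continuous_measurable_fun; exact: continuous_oneDsqrV.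
have p1 (w : R) : 0 <= ((oneDsqr w)^-1)%:E.
  by rewrite lee_fin invr_ge0 /oneDsqr addr_ge0// sqr_ge0.
rewrite integralT_pos//.
have -> : \int[mu]_(x in pos) ((oneDsqr (- x)%R)^-1)%:E = \int[mu]_(x in pos) ((oneDsqr x)^-1)%:E.
  by apply: eq_integral => x _; rewrite /oneDsqr sqrrN.
rewrite integral_itv_obnd_cbnd; last exact: measurable_funTS.
by rewrite integral0y_oneDsqr -EFinD ltry.
Qed.

End polar.

Section spheres.
Context {R : realType}.
Local Open Scope ereal_scope.
Local Notation pos := (`]0%R, +oo[%classic : set R).

(** [c] is the area of the unit sphere in dimension n + 1. The profile [h] takes the squared norm
    because that is additive when one coordinate is split off. *)
Definition radial_cst n (c : R) : Prop := (0 < c)%R /\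
  forall h : R -> \bar R, measurable_fun setT h -> (forall x, 0 <= h x) ->
  iint (fun z : 'rV[R]_n.+1 => h (sq z)) =
  c%:E * \int[mu]_(rho in pos) (h (rho ^+ 2)%R * (rho ^+ n)%:E).

(* The substitution [z_0 = rho * w], where [rho] is the norm of the remaining
   coordinates. *)
Lemma iint_cone n c : radial_cst n c ->
  forall Psi : R * R -> \bar R, measurable_fun setT Psi -> (forall p, 0 <= Psi p) ->
  iint (fun z : 'rV[R]_n.+2 => Psi (sq z, z 0%R ord0)) =
  c%:E * \int[mu]_w \int[mu]_(rho in pos)
    (Psi (rho ^+ 2 * kw w ^+ 2, rho * w)%R * (rho ^+ n.+1)%:E).
Proof.
move=> [c0 Hrad] Psi mPsi Psi0.
have pos0 (rho : R) : rho \in pos -> (0 < rho)%R by move=> /set_mem; rewrite /= in_itv /= andbT.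
(* The absolute value makes the weight nonnegative on the whole line, as Tonelli needs; on [pos] it
   changes nothing. The same device is used below. *)
have mX k : measurable_fun setT (fun p : R * R => (`|p.2| ^+ k)%:E).
  by apply/measurable_EFinP; apply: measurable_funX; apply: measurableT_comp.
pose G (p : R * R) := Psi (p.1 ^+ 2 + p.2 ^+ 2, p.1)%R * (`|p.2| ^+ n)%:E.
have mG : measurable_fun setT G.
  apply: emeasurable_funM => //; apply: (measurableT_comp mPsi).
  by apply: measurable_fun_pair => //; apply: measurable_funD; apply: measurable_funX.
have G0 p : 0 <= G p by rewrite mule_ge0// lee_fin.
transitivity (\int[mu]_a (c%:E * \int[mu]_(rho in pos) G (a, rho))).
  apply: eq_integral => a _.
  rewrite -[LHS]/(iint (fun v : 'rV[R]_n.+1 => Psi (sq (row_mx (const_mx a : 'rV_1) v),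
      (row_mx (const_mx a : 'rV_1) v : 'rV_n.+2) 0%R ord0))).
  pose h q := Psi (a ^+ 2 + q, a)%R.
  have mh : measurable_fun setT h.
    by apply: (measurableT_comp mPsi); apply: measurable_fun_pair => //; exact: measurable_funD.
  transitivity (iint (fun v : 'rV[R]_n.+1 => h (sq v))).
    by apply: eq_iint => v; rewrite row_mx0E sq_row_mx.
  rewrite Hrad//; last by move=> q; exact: Psi0.
  congr (_ * _); apply: eq_integral => rho /pos0 rho0.
  by rewrite /G /= gtr0_norm.
have mpos : measurable pos by [].
rewrite (ge0_integralZl_EFin mu measurableT _ (measurable_integralR mpos mG G0) (ltW c0)); last first.
  by move=> x _; exact: integral_ge0.
rewrite (tonelliR measurableT mpos mG G0); apply: (congr1 (fun u => c%:E * u)).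
pose K (p : R * R) := Psi (p.2 ^+ 2 * kw p.1 ^+ 2, p.2 * p.1)%R * (`|p.2| ^+ n.+1)%:E.
have mK : measurable_fun setT K.
  apply: emeasurable_funM => //; apply: (measurableT_comp mPsi).
  apply: measurable_fun_pair => /=; last exact: measurable_funM.
  apply: measurable_funM; first exact: measurable_funX.
  by apply: measurable_funX; apply: measurableT_comp => //; exact: measurable_kw.
have K0 p : 0 <= K p by rewrite mule_ge0// lee_fin.
transitivity (\int[mu]_w \int[mu]_(rho in pos) K (w, rho)); last first.
  apply: eq_integral => w _; apply: eq_integral => rho /pos0 rho0.
  by rewrite /K /= gtr0_norm.
rewrite (tonelliR measurableT mpos mK K0).
apply: eq_integral => rho /pos0 rho0.
have mGr : measurable_fun setT (fun a : R => G (a, rho)).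
  by apply: (measurableT_comp mG); exact: measurable_fun_pair.
rewrite (integral_scale rho0 mGr (fun a => G0 _)).
have mGr' : measurable_fun setT (fun w : R => G (rho * w, rho)%R).
  by apply: (measurableT_comp mGr); exact: measurable_funM.
rewrite -(ge0_integralZl_EFin mu measurableT (fun w _ => G0 _) mGr' (ltW rho0)).
apply: eq_integral => w _; rewrite /G /K /= gtr0_norm// (exprS rho n) EFinM [LHS]muleCA.
by congr (Psi (_, _) * _); rewrite kw2; ring.
Qed.

Lemma integral_pos_pow n (k : R) (h : R -> \bar R) : (0 < k)%R ->
  measurable_fun setT h -> (forall x, 0 <= h x) ->
  \int[mu]_(rho in pos) (h (rho ^+ 2 * k ^+ 2)%R * (rho ^+ n)%:E) =
  ((k^-1) ^+ n.+1)%:E * \int[mu]_(rho in pos) (h (rho ^+ 2)%R * (rho ^+ n)%:E).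
Proof.
move=> k0 mh h0.
have pos0 (rho : R) : rho \in pos -> (0 < rho)%R by move=> /set_mem; rewrite /= in_itv /= andbT.
have mX : measurable_fun setT (fun rho : R => (`|rho| ^+ n)%:E).
  by apply/measurable_EFinP; apply: measurable_funX.
have mf (b : R) : measurable_fun setT (fun rho : R => h (rho ^+ 2 * b)%R * (`|rho| ^+ n)%:E).
  apply: emeasurable_funM => //; apply: (measurableT_comp mh).
  by apply: measurable_funM => //; exact: measurable_funX.
have f0 (b : R) rho : 0 <= h (rho ^+ 2 * b)%R * (`|rho| ^+ n)%:E by rewrite mule_ge0// lee_fin.
transitivity (\int[mu]_(rho in pos) (h (rho ^+ 2 * k ^+ 2)%R * (`|rho| ^+ n)%:E)).
  by apply: eq_integral => rho /pos0 rho0; rewrite gtr0_norm.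
rewrite (@integral_scale_pos _ k^-1)//; last by rewrite invr_gt0.
rewrite (exprS k^-1 n) EFinM -muleA; congr (_ * _).
rewrite -ge0_integralZl_EFin//; last 3 first.
- by move=> rho /=; rewrite in_itv /= andbT => rho0; rewrite mule_ge0// lee_fin exprn_ge0// ltW.
- apply: measurable_funTS; apply: emeasurable_funM; last exact/measurable_EFinP/measurable_funX.
  by apply: (measurableT_comp mh); exact: measurable_funX.
- by rewrite exprn_ge0// invr_ge0 ltW.
apply: eq_integral => rho /pos0 rho0.
rewrite normrM !gtr0_norm ?invr_gt0// (exprMn n) EFinM muleCA; congr (_ * (h _ * _)).
by rewrite exprMn mulrAC -exprMn mulVf ?expr1n ?mul1r// ?gt_eqF//.
Qed.

End spheres.

Section averages.
Context {R : realType}.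
Local Open Scope ereal_scope.
Local Notation pos := (`]0%R, +oo[%classic : set R).

Lemma measurable_fun_inv d (T : measurableType d) (f : T -> R) :
  (forall x, (0 <= f x)%R) -> measurable_fun setT f -> measurable_fun setT (fun x => (f x)^-1%R).
Proof.
move=> f0 mf; under eq_fun do rewrite -powR_inv1//.
exact: (measurableT_comp (@measurable_powR R (-1)%R) mf).
Qed.

(** In the cone formula a radial integrand depends on [w] through the factor [kw w] only. Rescaling
    rho by it splits off a power of [hw w], so that the sphere areas satisfy the recursion c_(n+1) =
    c_n [Jw n.+2], starting from the two points of the zero-dimensional sphere. *)
Lemma radial_cst_exists n : exists c : R, radial_cst n c.
Proof.
elim: n => [|n [c hc]].
  exists 2%R; split => // h mh h0.
  transitivity (\int[mu]_x h (x ^+ 2)%R).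
    apply: eq_integral => x _.
    rewrite -[LHS]/(h (sq (row_mx (const_mx x : 'rV_1) (0%R : 'rV[R]_0)))) sq_row_mx.
    by rewrite /sq big_ord0 addr0.
  rewrite integralT_pos//; last by apply: (measurableT_comp mh); exact: measurable_funX.
  under [X in _ + X]eq_integral do rewrite sqrrN.
  under [in RHS]eq_integral do rewrite expr0 mule1.
  by rewrite -[2%R]/(1 + 1)%R EFinD ge0_muleDl ?lee_fin// mul1e.
exists (c * fine (@Jw R n.+2))%R; split.
  by rewrite mulr_gt0//; [case: hc|rewrite fine_gt0// Jw_gt0 ltey_eq Jw_fin].
move=> h mh h0; rewrite (iint_cone hc (Psi := fun p => h p.1))//; last exact: measurableT_comp.
rewrite EFinM fineK ?Jw_fin// -muleA; congr (_ * _).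
under eq_integral do rewrite integral_pos_pow ?kw_gt0//.
rewrite ge0_integralZr//.
- exact: measurable_hwX.
- by move=> w _; rewrite lee_fin exprn_ge0// ltW// hw_gt0.
- by apply: integral_ge0 => rho; rewrite /= in_itv /= andbT => r0; rewrite mule_ge0// lee_fin exprn_ge0// ltW.
Qed.

Definition ballw n : \bar R := \int[mu]_(rho in pos) (((rho ^+ 2 <= 1)%R%:R : R)%:E * (rho ^+ n)%:E).

Lemma measurable_le1 : measurable_fun setT (fun q : R => ((q <= 1)%R%:R : R)).
Proof.
apply: (@measurableT_comp _ _ _ _ _ _ (fun b : bool => b%:R : R)) => //.
exact: measurable_fun_ler.
Qed.

Lemma ballw_gt0 n : 0 < ballw n.
Proof.
apply: (@lt_le_trans _ _ (\int[mu]_(w in `[2^-1%R, 1%R]) ((2^-1 : R) ^+ n)%:E)).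
  rewrite (_ : (fun=> _) = cst ((2^-1 : R) ^+ n)%:E)// integral_cst//= lebesgue_measure_itv /=.
  rewrite lte_fin invf_lt1// ltr1n -EFinB -EFinM lte_fin mulr_gt0 ?exprn_gt0//.
  by rewrite subr_gt0 invf_lt1// ltr1n.
rewrite /ballw integral_mkcond [leRHS]integral_mkcond; apply: ge0_le_integral_nomeas => w _.
  by apply: erestrict_ge0 => x _; rewrite lee_fin exprn_ge0.
rewrite !patchE; case: ifPn => [/set_mem /=|_]; last first.
  case: ifPn => // /set_mem /=; rewrite in_itv /= andbT => w0.
  by apply: mule_ge0; rewrite lee_fin// exprn_ge0// ltW.
rewrite in_itv /= => /andP[w0 w1].
have w00 : (0 < w)%R by rewrite (lt_le_trans _ w0).
rewrite mem_set /=; last by rewrite in_itv /= andbT.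
by rewrite expr_le1 ?(ltW w00)// w1 mul1e lee_fin lerXn2r ?nnegrE ?invr_ge0// ltW.
Qed.

Lemma ballw_fin n : ballw n \is a fin_num.
Proof.
rewrite ge0_fin_numE; last by rewrite ltW// ballw_gt0.
apply: (@le_lt_trans _ _ (\int[mu]_(w in `[0%R, 1%R]) 1)).
  rewrite /ballw integral_mkcond [leRHS]integral_mkcond; apply: ge0_le_integral_nomeas => w _.
    apply: erestrict_ge0 => x /=; rewrite in_itv /= andbT => x0.
    by apply: mule_ge0; rewrite lee_fin// exprn_ge0// ltW.
  rewrite !patchE; case: ifPn => [/set_mem /=|_]; last by case: ifP.
  rewrite in_itv /= andbT => w0.
  have [w1|w1] := boolP (w ^+ 2 <= 1)%R; last by rewrite mul0e; case: ifP.
  move: w1; rewrite expr_le1 ?(ltW w0)// => w1.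
  rewrite mem_set /=; last by rewrite in_itv /= w1 (ltW w0).
  by rewrite mul1e lee_fin exprn_ile1// (ltW w0).
by rewrite integral_cst//= mul1e lebesgue_measure_itv /= lte_fin ltr01 -EFinB subr0 ltry.
Qed.

(** Law of cosines: the length of x - t y for |x| = r and |y| = 1, where [w] is the cotangent of the
    angle between x and y. *)
Definition Sf (r t w : R) : R := Num.sqrt (r ^+ 2 + t ^+ 2 - 2 * r * t * (w * hw w)).

(** Unnormalized spherical average in dimension n of the radial function with profile [F]:
    [hw w ^+ n] against dw is sin^(n-2) of the angle against the angle. *)
Definition Av n (r t : R) (F : R -> R) : \bar R := \int[mu]_w (F (Sf r t w) * hw w ^+ n)%:E.

Lemma enorm_sub n (x z : 'rV[R]_n) (t : R) : (0 < enorm z)%R ->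
  enorm (x - t *: ((enorm z)^-1 *: z)) =
  Num.sqrt (sq x + t ^+ 2 - 2 * t * (dotv x z / Num.sqrt (sq z))).
Proof.
move=> z0; rewrite {1}/enorm; congr Num.sqrt; set k := (t * (enorm z)^-1)%R.
have -> : (sq x + t ^+ 2 - 2 * t * (dotv x z / Num.sqrt (sq z)) = sq x + k ^+ 2 * sq z - 2 * k * dotv x z)%R.
  have -> : (k ^+ 2 * sq z = t ^+ 2)%R.
    have <- : (enorm z ^+ 2 = sq z)%R by rewrite sqr_sqrtr ?sq_ge0.
    by rewrite -exprMn /k divfK// gt_eqF.
  by rewrite /k -[Num.sqrt (sq z)]/(enorm z); ring.
rewrite /sq /dotv !mulr_sumr -big_split /= -sumrB; apply: eq_bigr => i _.
by rewrite !mxE /k; ring.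
Qed.

Lemma measurable_Sf r t : measurable_fun setT (Sf r t).
Proof.
apply: measurableT_comp; first by apply: continuous_measurable_fun; exact: sqrt_continuous.
apply: measurable_funB => //; apply: measurable_funM => //; apply: measurable_funM => //.
exact: measurable_hw.
Qed.

(** After the rotation the inner product is r z_0, and z_0 / |z| is the cosine [w * hw w],
    independent of rho. The integral over the ball therefore factors into a radial part [ballw] and
    an angular part [Av]. *)
Lemma iint_sphere n c (x : 'rV[R]_n.+2) (t : R) (F : R -> R) : radial_cst n c ->
  measurable_fun setT F -> (forall s, (0 <= F s)%R) ->
  iint (fun z : 'rV[R]_n.+2 => (((0 < enorm z) && (enorm z <= 1))%R%:R *
     F (enorm (x - t *: ((enorm z)^-1 *: z))))%:E) =
  (c%:E * ballw n.+1) * Av n.+2 (enorm x) t F.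
Proof.
move=> hc mF F0.
have [r [r2 [/(_ isT) r0 rot]]] := iint_rotation x.
have rE : r = enorm x by rewrite /enorm -[X in Num.sqrt X]r2 sqrtr_sqr ger0_norm.
pose Phi (p : R * R) := (((0 < p.1) && (p.1 <= 1))%R%:R *
   F (Num.sqrt (sq x + t ^+ 2 - 2 * t * (p.2 / Num.sqrt p.1))))%:E.
have Phi0 p : 0 <= Phi p by rewrite lee_fin mulr_ge0.
have msqrt : measurable_fun setT (@Num.sqrt R) by apply: continuous_measurable_fun; exact: sqrt_continuous.
have mPhi : measurable_fun setT Phi.
  apply/measurable_EFinP; apply: measurable_funM.
    apply: (@measurableT_comp _ _ _ _ _ _ (fun b : bool => b%:R : R)) => //.
    by apply: measurable_and; [exact: measurable_fun_ltr|exact: measurable_fun_ler].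
  apply: (measurableT_comp mF); apply: (measurableT_comp msqrt).
  apply: measurable_funB => //; apply: measurable_funM => //; apply: measurable_funM => //.
  apply: measurable_fun_inv => [p|]; first exact: sqrtr_ge0.
  exact: (measurableT_comp msqrt).
transitivity (iint (fun z : 'rV[R]_n.+2 => Phi (sq z, dotv x z))).
  apply: eq_iint => z; rewrite /Phi /=.
  have e1 : (0 < enorm z)%R = (0 < sq z)%R by rewrite /enorm sqrtr_gt0.
  have e2 : (enorm z <= 1)%R = (sq z <= 1)%R.
    by rewrite -[X in (_ <= X)%R = _]sqrtr1 ler_sqrt.
  have [z0|z0] := boolP (0 < enorm z)%R; last by rewrite -e1 (negbTE z0) !mul0r.
  by rewrite enorm_sub// -e1 z0 e2.
rewrite rot//.
rewrite (iint_cone hc (Psi := fun p => Phi (p.1, r * p.2)%R))//; last first.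
  by apply: (measurableT_comp mPhi); apply: measurable_fun_pair => //; exact: measurable_funM.
rewrite -muleA; congr (_ * _).
have pos0 (rho : R) : rho \in pos -> (0 < rho)%R by move=> /set_mem; rewrite /= in_itv /= andbT.
transitivity (\int[mu]_w ((F (Sf (enorm x) t w) * hw w ^+ n.+2)%:E * ballw n.+1)).
  apply: eq_integral => w _.
  transitivity (\int[mu]_(rho in pos) ((F (Sf (enorm x) t w))%:E *
     (((rho ^+ 2 * kw w ^+ 2 <= 1)%R%:R : R)%:E * (rho ^+ n.+1)%:E))).
    apply: eq_integral => rho /pos0 rho0.
    rewrite /Phi /= [in RHS]muleA -[in RHS]EFinM [in RHS](mulrC (F _)).
    have -> : (0 < rho ^+ 2 * kw w ^+ 2)%R by rewrite mulr_gt0 ?exprn_gt0// kw_gt0.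
    rewrite /= -[LHS]EFinM; congr (_%:E); congr (_ * F (Num.sqrt _) * _)%R.
    rewrite -exprMn sqrtr_sqr gtr0_norm; last by rewrite mulr_gt0// kw_gt0.
    rewrite -r2 -rE /hw; field.
    by rewrite !gt_eqF ?kw_gt0.
  rewrite ge0_integralZl_EFin//; last 2 first.
  - by move=> rho /=; rewrite in_itv /= andbT => rho0; apply: mule_ge0; rewrite lee_fin// exprn_ge0// ltW.
  - apply: measurable_funTS; apply: emeasurable_funM; last exact/measurable_EFinP/measurable_funX.
    apply/measurable_EFinP; apply: (measurableT_comp measurable_le1).
    by apply: measurable_funM => //; exact: measurable_funX.
  rewrite (@integral_pos_pow _ n.+1 (kw w) (fun q => ((q <= 1)%R%:R : R)%:E)) ?kw_gt0//.
  - by rewrite muleA -EFinM.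
  - by apply/measurable_EFinP; exact: measurable_le1.
rewrite ge0_integralZr//; first by rewrite muleC.
- apply/measurable_EFinP; apply: measurable_funM.
    by apply: (measurableT_comp mF); exact: measurable_Sf.
  by apply: measurable_funX; exact: measurable_hw.
- by move=> w _; rewrite lee_fin mulr_ge0// exprn_ge0// ltW// hw_gt0.
- by rewrite ltW// ballw_gt0.
Qed.

End averages.

Section sph_avg_formula.
Context {R : realType}.
Local Open Scope ereal_scope.

Lemma volB_gt0 n : 0 < @volB R n.+2.
Proof.
have [c [c0 hc]] := @radial_cst_exists R n.+1.
rewrite /volB (_ : iint _ = iint (fun z : 'rV[R]_n.+2 => ((sq z <= 1)%R%:R)%:E)); last first.
  by apply: eq_iint => z; rewrite /enorm -[X in (_ <= X)%R]sqrtr1 ler_sqrt.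
rewrite (hc (fun q => ((q <= 1)%R%:R)%:E)) => [|//|q]; last by rewrite lee_fin.
  by rewrite mule_gt0 ?lte_fin// ballw_gt0.
by apply/measurable_EFinP; exact: measurable_le1.
Qed.

Lemma volB_fin n : @volB R n.+2 \is a fin_num.
Proof.
have [c [c0 hc]] := @radial_cst_exists R n.+1.
rewrite /volB (_ : iint _ = iint (fun z : 'rV[R]_n.+2 => ((sq z <= 1)%R%:R)%:E)); last first.
  by apply: eq_iint => z; rewrite /enorm -[X in (_ <= X)%R]sqrtr1 ler_sqrt.
rewrite (hc (fun q => ((q <= 1)%R%:R)%:E)) => [|//|q]; last by rewrite lee_fin.
  by rewrite fin_numM// ballw_fin.
by apply/measurable_EFinP; exact: measurable_le1.
Qed.

Lemma Av_ge0 n (r t : R) (F : R -> R) : (forall s, (0 <= F s)%R) -> 0 <= Av n r t F.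
Proof.
by move=> F0; apply: integral_ge0 => w _; rewrite lee_fin mulr_ge0// exprn_ge0// ltW// hw_gt0.
Qed.

Lemma measurable_Av_integrand n (r t : R) (F : R -> R) : measurable_fun setT F ->
  measurable_fun setT (fun w => (F (Sf r t w) * hw w ^+ n)%:E).
Proof.
move=> mF; apply/measurable_EFinP; apply: measurable_funM.
  by apply: (measurableT_comp mF); exact: measurable_Sf.
by apply: measurable_funX; exact: measurable_hw.
Qed.

(** The inequality serves the upper bounds and the equality the nonnegative test functions. For
    signed profiles positive and negative parts are treated separately; if both integrals are
    infinite, so is the right-hand side. *)
Lemma sph_avgE n : exists K : R, (0 < K)%R /\
  forall (f0 : R -> R) (t : R) (x : 'rV[R]_n.+2), measurable_fun setT f0 ->
  let f := fun x : 'rV[R]_n.+2 => f0 (enorm x) in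
  `|sph_avg f t x| <= K%:E * Av n.+2 (enorm x) t (fun s => `|f0 s|%R) /\
  ((forall s, (0 <= f0 s)%R) -> sph_avg f t x = K%:E * Av n.+2 (enorm x) t f0).
Proof.
have [c hc] := @radial_cst_exists R n.
have c0 := hc.1.
pose K := (c * fine (@ballw R n.+1) / fine (@volB R n.+2))%R.
have b0 : (0 < fine (@ballw R n.+1))%R by rewrite fine_gt0// ballw_gt0 ltey_eq ballw_fin.
have v0 : (0 < fine (@volB R n.+2))%R by rewrite fine_gt0// volB_gt0 ltey_eq volB_fin.
have K0 : (0 < K)%R by rewrite !mulr_gt0// invr_gt0.
exists K; split => // f0 t x mf0 f.
pose b (z : 'rV[R]_n.+2) := (((0 < enorm z) && (enorm z <= 1))%R%:R : R).
have bE z (u : R) : (Num.max (b z * u) 0 = b z * Num.max u 0)%R.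
  by rewrite /b; case: (_ && _); rewrite ?mul1r// !mul0r maxxx.
pose fp := fun s => Num.max (f0 s) 0%R.
pose fm := fun s => Num.max (- f0 s)%R 0%R.
have mfp : measurable_fun setT fp by exact: measurable_maxr.
have mfm : measurable_fun setT fm by apply: measurable_maxr => //; exact: measurable_funN.
have fp0 s : (0 <= fp s)%R by rewrite /fp le_max lexx orbT.
have fm0 s : (0 <= fm s)%R by rewrite /fm le_max lexx orbT.
have cb : c%:E * ballw n.+1 * ((fine (@volB R n.+2))^-1)%:E = K%:E.
  by rewrite -[ballw _]fineK ?ballw_fin// -!EFinM.
have E : sph_avg f t x = (c%:E * ballw n.+1 * Av n.+2 (enorm x) t fp -
    c%:E * ballw n.+1 * Av n.+2 (enorm x) t fm) * ((fine (@volB R n.+2))^-1)%:E.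
  pose u z := f0 (enorm (x - t *: ((enorm z)^-1 *: z))).
  have ep : iint (fun z => (Num.max (b z * u z)%R 0)%:E) = c%:E * ballw n.+1 * Av n.+2 (enorm x) t fp.
    rewrite -(iint_sphere x t hc mfp fp0); apply: eq_iint => z.
    by apply: (congr1 EFin); exact: bE.
  have em : iint (fun z => (Num.max (- (b z * u z))%R 0)%:E) = c%:E * ballw n.+1 * Av n.+2 (enorm x) t fm.
    rewrite -(iint_sphere x t hc mfm fm0); apply: eq_iint => z.
    by apply: (congr1 EFin); rewrite -mulrN; exact: bE.
  by rewrite -ep -em.
split.
  rewrite E abseM [X in _ * X]gee0_abs; last by rewrite lee_fin invr_ge0 ltW.
  apply: (@le_trans _ _ ((c%:E * ballw n.+1 * Av n.+2 (enorm x) t (fun s => `|f0 s|%R)) *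
      ((fine (@volB R n.+2))^-1)%:E)); last by rewrite muleAC cb.
  apply: lee_wpmul2r; first by rewrite lee_fin invr_ge0 ltW.
  apply: (le_trans (lee_abs_sub _ _)).
  have cb0 : 0 <= c%:E * @ballw R n.+1 by rewrite mule_ge0 ?lee_fin ?ltW// ballw_gt0.
  rewrite !gee0_abs; [|exact: mule_ge0 cb0 (Av_ge0 _ _ _ fm0)|exact: mule_ge0 cb0 (Av_ge0 _ _ _ fp0)].
  rewrite -ge0_muleDr ?Av_ge0//; apply: lee_wpmul2l => //.
  rewrite /Av -ge0_integralD//; first last.
  - exact: measurable_Av_integrand.
  - by move=> w _; rewrite lee_fin mulr_ge0// exprn_ge0// ltW// hw_gt0.
  - exact: measurable_Av_integrand.
  - by move=> w _; rewrite lee_fin mulr_ge0// exprn_ge0// ltW// hw_gt0.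
  apply: ge0_le_integral_nomeas => w _.
    by rewrite -EFinD -mulrDl lee_fin mulr_ge0 ?addr_ge0// exprn_ge0// ltW// hw_gt0.
  rewrite -EFinD -mulrDl lee_fin ler_wpM2r ?exprn_ge0 ?(ltW (hw_gt0 _))//.
  rewrite /fp /fm; have [h|h] := boolP (0 <= f0 (Sf (enorm x) t w))%R.
    by rewrite max_l// max_r ?addr0 ?ler_norm// oppr_le0.
  move: h; rewrite -ltNge => h.
  by rewrite max_r ?(ltW h)// max_l ?add0r ?ltr0_norm// oppr_ge0 ltW.
move=> f00.
rewrite E (_ : fp = f0); last by apply/funext => s; rewrite /fp max_l.
rewrite (_ : fm = cst 0%R); last by apply/funext => s; rewrite /fm max_r// oppr_le0.
rewrite (_ : Av n.+2 (enorm x) t (cst 0%R) = 0); last first.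
  by rewrite /Av; apply: integral0_eq => w _; rewrite mul0r.
by rewrite mule0 sube0 muleAC cb.
Qed.

End sph_avg_formula.

(** * Substitution along a decreasing function *)

Section change_variable.
Context {R : realType}.
Local Open Scope ereal_scope.
Variables (S g : R -> R).
Hypotheses (dS : forall w : R, is_derive w (1%R : R) S (- g w)%R) (cg : continuous g)
  (g0 : forall w, (0 <= g w)%R) (decS : {homo S : x y /~ (x < y)%R}).

Let cS : continuous S.
Proof. by move=> w; apply/differentiable_continuous/derivable1_diffP; exact: ex_derive. Qed.

Let mS : measurable_fun setT S.
Proof. by apply: continuous_measurable_fun; exact: cS. Qed.

Let mg : measurable_fun setT g.
Proof. by apply: continuous_measurable_fun; exact: cg. Qed.

Let lt_S x y : ((S x < S y) = (y < x))%R.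
Proof.
apply/idP/idP => [|/decS//]; apply: contraTT; rewrite -!leNgt le_eqVlt => /predU1P[->//|/decS/ltW//].
Qed.

Let le_S x y : ((S x <= S y) = (y <= x))%R.
Proof. by rewrite !leNgt lt_S. Qed.

Let FTC_S (x y : R) : (x < y)%R -> \int[mu]_(w in `[x, y]) (g w)%:E = (S x - S y)%:E.
Proof.
move=> xy; rewrite (@continuous_FTC2 _ g (fun w => - S w)%R x y)//.
- by rewrite -EFinB; congr (_%:E); ring.
- by apply: continuous_subspaceT.
- split=> [z _||].
  + by apply: derivableN; exact: ex_derive.
  + by apply: cvgN; apply: cvg_at_right_filter; exact: cS.
  + by apply: cvgN; apply: cvg_at_left_filter; exact: cS.
- move=> z _; rewrite derive1E deriveN; last exact: ex_derive.
  by rewrite derive_val opprK.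
Qed.

Let integral_itv_g (b1 b2 : bool) (x y : R) : (x < y)%R ->
  \int[mu]_(w in [set` Interval (BSide b1 x) (BSide b2 y)]) (g w)%:E = (S x - S y)%:E.
Proof.
move=> xy; rewrite -FTC_S//.
have mgE A : measurable_fun A (fun w => (g w)%:E) by apply/measurable_EFinP/measurable_funTS.
by case: b1; case: b2 => //; rewrite ?integral_itv_obnd_cbnd ?integral_itv_bndo_bndc//.
Qed.

(** The image under [S] of the measure with density [g] on the interval ]a,
    b[ is Lebesgue measure on the interval ]S b, S a[, which is verified on half-open intervals by
    the fundamental theorem of calculus. *)
Lemma substitution_decreasing (a b : R) (G : R -> \bar R) : (a < b)%R ->
  measurable_fun setT G -> (forall s, 0 <= G s) ->
  \int[mu]_(w in `]a, b[) (G (S w) * (g w)%:E) = \int[mu]_(s in `]S b, S a[) G s.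
Proof.
move=> ab mG G0.
pose g' w := (g w * \1_(`]a, b[%classic) w)%R.
have mg' : measurable_fun setT g'.
  by apply: measurable_funM => //; exact: measurable_indic.
have g'0 w : (0 <= g' w)%R by rewrite mulr_ge0.
have [m [mE intm]] := @density_pushforward _ _ _ (measurableTypeR R) (measurableTypeR R)
  (@lebesgue_measure R) S g' mS mg' g'0.
have mI : measurable (`]S b, S a[%classic : set R) by [].
(* Uniqueness of Lebesgue measure is a statement on the whole line, so the image measure is
   completed by Lebesgue measure outside its interval. *)
pose m2 := measure_add m (mrestr (@lebesgue_measure R) (measurableC mI)).
have mitv (c e : R) : m `]c, e]%classic = mu (`]c, e]%classic `&` `]S b, S a[%classic).
  rewrite mE.
  have -> : \int[mu]_(w in S @^-1` `]c, e]%classic) (g' w)%:E =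
      \int[mu]_(w in S @^-1` `]c, e]%classic `&` `]a, b[%classic) (g w)%:E.
    rewrite [in RHS]integral_mkcondr; apply: eq_integral => w _.
    by rewrite /g' patchE indicE; case: ifP; rewrite ?mulr1 ?mulr0.
  (* The test interval is clipped to the range of [S]; its ends are then pulled back by the
     intermediate value theorem. *)
  set c' := Num.max c (S b); set e' := Num.min e (S a).
  have [ec|ce] := leP e' c'.
    rewrite (_ : _ `&` `]S b, _[%classic = set0) ?measure0; last first.
      apply/seteqP; split => // s [] /=; rewrite !in_itv /= => /andP[h1 h2] /andP[h3 h4].
      have : (c' < s)%R by rewrite gt_max h1 h3.
      have : (s <= e')%R by rewrite le_min h2 ltW.
      by move=> h5 h6; move: (le_lt_trans (le_trans h5 ec) h6); rewrite ltxx.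
    rewrite (_ : _ `&` _ = set0) ?integral_set0//.
    apply/seteqP; split => // w [] /=; rewrite !in_itv /= => /andP[h1 h2] /andP[h3 h4].
    have : (c' < S w)%R by rewrite gt_max h1 lt_S h4.
    have : (S w <= e')%R by rewrite le_min h2 le_S ltW.
    by move=> h5 h6; move: (le_lt_trans (le_trans h5 ec) h6); rewrite ltxx.
  have Sba : (S b < S a)%R by rewrite lt_S.
  have ivt v : (S b <= v <= S a)%R -> exists2 w, (a <= w <= b)%R & S w = v.
    move=> /andP[h1 h2].
    have vm : (Num.min (S a) (S b) <= v <= Num.max (S a) (S b))%R.
      by rewrite min_r ?(ltW Sba)// max_l ?(ltW Sba)// h1.
    have [w] := IVT (ltW ab) (continuous_subspaceT cS) vm.
    by rewrite in_itv /= => h3 h4; exists w.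
  have cb : (S b <= c')%R by rewrite le_max lexx orbT.
  have ea : (e' <= S a)%R by rewrite ge_min lexx orbT.
  have [wc /andP[wc1 wc2] Swc] : exists2 w, (a <= w <= b)%R & S w = c'.
    by apply: ivt; rewrite cb (le_trans (ltW ce)).
  have [we /andP[we1 we2] Swe] : exists2 w, (a <= w <= b)%R & S w = e'.
    by apply: ivt; rewrite ea (le_trans cb)// ltW.
  have wec : (we < wc)%R by rewrite -(lt_S wc we) Swc Swe.
  have cE w : (w < b)%R -> (c < S w)%R = (w < wc)%R.
    by move=> wb; rewrite -(lt_S wc w) Swc gt_max lt_S wb andbT.
  have cE' s : (S b < s)%R -> (c < s)%R = (c' < s)%R.
    by move=> sb; rewrite gt_max sb andbT.
  (* If [e] lies inside the range, the preimage is closed at its left end [we]; otherwise it is cut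
     off at [a] and open there. *)
  have [eSa|eSa] := ltP e (S a).
    have ee : e' = e by rewrite /e' min_l// ltW.
    have awe : (a < we)%R by rewrite -(lt_S we a) Swe ee.
    have -> : S @^-1` `]c, e]%classic `&` `]a, b[%classic = `[we, wc[%classic.
      apply/seteqP; split => w /=; rewrite !in_itv /=.
        move=> [/andP[h1 h2] /andP[h3 h4]].
        by rewrite -cE// h1 andbT -(le_S w we) Swe ee h2.
      move=> /andP[h1 h2]; have wb : (w < b)%R by rewrite (lt_le_trans h2).
      rewrite cE// h2 wb (lt_le_trans awe h1); split => //=.
      by rewrite -ee -Swe le_S h1.
    rewrite integral_itv_g// Swe Swc.
    have -> : `]c, e]%classic `&` `]S b, S a[%classic = `]c', e']%classic :> set R.
      apply/seteqP; split => s /=; rewrite !in_itv /= ee.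
        by move=> [/andP[h1 h2] /andP[h3 h4]]; rewrite -cE'// h1.
      move=> /andP[h1 h2]; have sb : (S b < s)%R by rewrite (le_lt_trans cb).
      by rewrite cE'// h1 h2 sb (le_lt_trans h2).
    by rewrite lebesgue_measure_itv /= lte_fin ce.
  have ee : e' = S a by rewrite /e' min_r.
  have awe : we = a by apply/eqP; rewrite eq_le -(le_S a we) -(le_S we a) Swe ee lexx.
  have -> : S @^-1` `]c, e]%classic `&` `]a, b[%classic = `]we, wc[%classic.
    apply/seteqP; split => w /=; rewrite !in_itv /= awe.
      by move=> [/andP[h1 h2] /andP[h3 h4]]; rewrite -cE// h1 h3.
    move=> /andP[h1 h2]; have wb : (w < b)%R by rewrite (lt_le_trans h2).
    by rewrite cE// h2 h1 wb (le_trans _ eSa)// le_S ltW.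
  rewrite integral_itv_g// Swe Swc.
  have -> : `]c, e]%classic `&` `]S b, S a[%classic = `]c', e'[%classic :> set R.
    apply/seteqP; split => s /=; rewrite !in_itv /= ee.
      by move=> [/andP[h1 h2] /andP[h3 h4]]; rewrite -cE'// h1.
    move=> /andP[h1 h2]; have sb : (S b < s)%R by rewrite (le_lt_trans cb).
    by rewrite cE'// h1 h2 sb (le_trans (ltW h2)).
  by rewrite lebesgue_measure_itv /= lte_fin ce.
have muE A : measurable A -> mu A = m2 A.
  move: A; apply: lebesgue_measure_unique => _ [[c e] _ <-].
  rewrite [RHS](measure_addE m _) mitv -[X in _ + X]/(mu (`]c, e]%classic `&` ~` `]S b, S a[%classic)) -setDE addeC.
  exact: measureDI.
rewrite [RHS](@eq_measure_integral _ _ _ _ m); last first.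
  move=> A mA AI; rewrite [LHS](muE _ mA) [LHS](measure_addE m _) -[X in _ + X]/(mu (A `&` ~` `]S b, S a[%classic)) -setDE.
  have -> : A `\` `]S b, S a[%classic = set0 by rewrite setD_eq0.
  by rewrite measure0 adde0.
rewrite [RHS]integral_mkcond intm; last 2 first.
- by apply/(measurable_restrictT _ _).1 => //; exact: measurable_funTS.
- by move=> s; exact: erestrict_ge0.
rewrite [LHS]integral_mkcond; apply: eq_integral => w _; rewrite !patchE /g' indicE.
case: ifPn => [/set_mem /=|]; last by rewrite mulr0 mule0.
rewrite in_itv /= => /andP[h1 h2]; rewrite mulr1 mem_set//=.
by rewrite in_itv /= !lt_S h1 h2.
Qed.

(** Exhaustion of the line by symmetric intervals, whose images exhaust the range, and monotone
    convergence on both sides. *)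
Lemma substitution_decreasingT (l L : R) (G : R -> \bar R) :
  (forall w, (l < S w < L)%R) -> (forall s, (l < s < L)%R -> exists w, S w = s) ->
  measurable_fun setT G -> (forall s, 0 <= G s) ->
  \int[mu]_w (G (S w) * (g w)%:E) = \int[mu]_(s in `]l, L[) G s.
Proof.
move=> S1 S2 mG G0.
pose A n := (`](- (n.+1%:R))%R, n.+1%:R[%classic : set R).
pose B n := (`]S n.+1%:R, S (- (n.+1%:R))%R[%classic : set R).
have nat_lt (w : R) : exists n : nat, (`|w| < n.+1%:R)%R.
  exists (Num.truncn `|w|); exact: truncnS_gt.
have AT : \bigcup_n A n = setT.
  apply/seteqP; split => // w _; have [n] := nat_lt w.
  by rewrite ltr_norml => h; exists n => //; rewrite /A /= in_itv /=.
have BT : \bigcup_n B n = `]l, L[%classic.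
  apply/seteqP; split => s /=.
    move=> [n _] /=; rewrite !in_itv /= => /andP[h1 h2].
    have /andP[h3 _] := S1 n.+1%:R; have /andP[_ h4] := S1 (- n.+1%:R)%R.
    by rewrite (lt_trans h3)// (lt_trans h2).
  rewrite in_itv /= => /S2[w ws]; have [n] := nat_lt w.
  by rewrite ltr_norml => /andP[h1 h2]; exists n => //; rewrite /B /= in_itv /= -ws !lt_S h1 h2.
have ndA : nondecreasing_seq A.
  move=> i j ij; rewrite subsetEset => w; rewrite /A /B /= !in_itv /= => /andP[h1 h2].
  have ij' : (i.+1%:R <= j.+1%:R :> R)%R by rewrite ler_nat.
  by rewrite (le_lt_trans _ h1) ?lerN2// (lt_le_trans h2).
have ndB : nondecreasing_seq B.
  move=> i j ij; rewrite subsetEset => w; rewrite /A /B /= !in_itv /= => /andP[h1 h2].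
  have ij' : (i.+1%:R <= j.+1%:R :> R)%R by rewrite ler_nat.
  by rewrite (le_lt_trans _ h1) ?le_S// (lt_le_trans h2)// le_S lerN2.
have mGS : measurable_fun setT (fun w => G (S w) * (g w)%:E).
  by apply: emeasurable_funM; [exact: (measurableT_comp mG)|exact/measurable_EFinP].
have E n : \int[mu]_(w in A n) (G (S w) * (g w)%:E) = \int[mu]_(s in B n) G s.
  by apply: substitution_decreasing => //; rewrite (@lt_trans _ _ 0%R)// ltrNl oppr0.
have cA := @ge0_nondecreasing_set_cvg_integral _ (measurableTypeR R) R A (fun w => G (S w) * (g w)%:E) (@lebesgue_measure R) ndA.
have cB := @ge0_nondecreasing_set_cvg_integral _ (measurableTypeR R) R B G (@lebesgue_measure R) ndB.
rewrite AT in cA; rewrite BT in cB.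
have {}cA : \int[mu]_(w in A i) (G (S w) * (g w)%:E) @[i --> \oo] --> \int[mu]_w (G (S w) * (g w)%:E).
  apply: cA => [i|i|i x _]; [exact: measurable_itv|exact: measurable_funTS|].
  by rewrite mule_ge0// lee_fin.
have {}cB : \int[mu]_(s in B i) G s @[i --> \oo] --> \int[mu]_(s in `]l, L[) G s.
  by apply: cB => [i|i|i x _]; [exact: measurable_itv|exact: measurable_funTS|].
rewrite -(funext E) in cB.
exact: (cvg_unique _ cA cB).
Qed.

End change_variable.

(** * The kernel of the radial averages *)

Section kernel.
Context {R : realType}.
Implicit Types (r t w s : R).

Let uw w : R := w * hw w.

Let lt2 (x y : R) : 0 <= x -> 0 <= y -> (x ^+ 2 < y ^+ 2) = (x < y).
Proof. by move=> x0 y0; rewrite ltr_pXn2r. Qed.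

Let uw2 w : uw w ^+ 2 = 1 - hw w ^+ 2.
Proof.
rewrite /uw exprMn hw2; field.
by rewrite gt_eqF// ltr_wpDr ?sqr_ge0.
Qed.

Let uw_lt1 w : -1 < uw w < 1.
Proof.
rewrite -ltr_norml -(@ltr_pXn2r _ 2%N)// ?nnegrE// expr1n real_normK ?num_real// uw2.
by rewrite ltrBlDr ltrDl exprn_gt0// hw_gt0.
Qed.

Let SfE r t w : 0 < r -> 0 < t -> Sf r t w ^+ 2 = r ^+ 2 + t ^+ 2 - 2 * r * t * uw w.
Proof.
move=> r0 t0; rewrite sqr_sqrtr//.
have /andP[h1 h2] := uw_lt1 w; rewrite -/(uw w).
have : 0 < r * t * (1 - uw w) by rewrite !mulr_gt0// subr_gt0.
have := sqr_ge0 (r - t); nra.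
Qed.

Lemma Sf_gt0 r t w : 0 < r -> 0 < t -> 0 < Sf r t w.
Proof.
move=> r0 t0; rewrite sqrtr_gt0.
have /andP[h1 h2] := uw_lt1 w; rewrite -/(uw w).
have : 0 < r * t * (1 - uw w) by rewrite !mulr_gt0// subr_gt0.
have := sqr_ge0 (r - t); nra.
Qed.

Lemma Sf_itv r t w : 0 < r -> 0 < t -> `|r - t| < Sf r t w < r + t.
Proof.
move=> r0 t0; have /andP[h1 h2] := uw_lt1 w; have S0 := Sf_gt0 w r0 t0.
rewrite -(lt2 (normr_ge0 _) (ltW S0)) -(lt2 (ltW S0) (addr_ge0 (ltW r0) (ltW t0))).
rewrite real_normK ?num_real// SfE//.
have : 0 < r * t * (1 - uw w) by rewrite !mulr_gt0// subr_gt0.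
have : 0 < r * t * (1 + uw w) by rewrite !mulr_gt0// -ltrBlDl sub0r.
by move=> ? ?; apply/andP; split; nra.
Qed.

Lemma Sf_surj r t s : 0 < r -> 0 < t -> `|r - t| < s < r + t -> exists w, Sf r t w = s.
Proof.
move=> r0 t0 /andP[s1 s2].
have s0 : 0 < s by rewrite (le_lt_trans _ s1).
have s1' : (r - t) ^+ 2 < s ^+ 2.
  by rewrite -[(r - t) ^+ 2]real_normK ?num_real// ltr_pXn2r// ?nnegrE// ltW.
have s2' : s ^+ 2 < (r + t) ^+ 2.
  by rewrite ltr_pXn2r// ?nnegrE ?addr_ge0// ltW.
have rt0 : 0 < 2 * r * t by rewrite !mulr_gt0.
(* The law of cosines solved for the cosine [u]; the witness below is the cotangent of the same
   angle. *)
pose u := (r ^+ 2 + t ^+ 2 - s ^+ 2) / (2 * r * t).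
have u1 : -1 < u by rewrite /u ltr_pdivlMr//; nra.
have u2 : u < 1 by rewrite /u ltr_pdivrMr//; nra.
have v0 : 0 < 1 - u ^+ 2 by nra.
exists (u / Num.sqrt (1 - u ^+ 2)).
have hwE : hw (u / Num.sqrt (1 - u ^+ 2)) = Num.sqrt (1 - u ^+ 2).
  rewrite /hw /kw expr_div_n sqr_sqrtr ?(ltW v0)//.
  have -> : 1 + u ^+ 2 / (1 - u ^+ 2) = (1 - u ^+ 2)^-1 by field; rewrite gt_eqF.
  by rewrite sqrtrV ?(ltW v0)// invrK.
rewrite /Sf hwE divfK; last by rewrite gt_eqF// sqrtr_gt0.
rewrite /u mulrCA divff ?gt_eqF// mulr1 opprB addrCA subrr addr0.
by rewrite sqrtr_sqr gtr0_norm.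
Qed.

Definition Sf' r t w : R := r * t * hw w ^+ 3 / Sf r t w.

Lemma is_derive_Sf r t w : 0 < r -> 0 < t -> is_derive w (1 : R) (Sf r t) (- Sf' r t w).
Proof.
move=> r0 t0.
have k0 := kw_gt0 w; have kn0 : kw w != 0 by rewrite gt_eqF.
have dk : is_derive w (1 : R) (@kw R) (w / kw w).
  have d1 : is_derive w (1 : R) (fun w : R => 1 + w ^+ 2) (2 * w).
    have := @is_deriveD _ _ _ (cst (1 : R)) (@id R ^+ 2) w 1 0 _ _ _.
    by move=> /(_ _ _ _)/is_derive_eq; apply; rewrite add0r expr1 scaler1.
  have p0 : 0 < 1 + w ^+ 2 by rewrite ltr_wpDr ?sqr_ge0.
  have := @is_derive1_comp _ (@Num.sqrt R) (fun w : R => 1 + w ^+ 2) w _ _ (is_derive1_sqrt p0) d1.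
  by move=> /is_derive_eq; apply; rewrite -/(kw w); field.
(* As a function of the cotangent the cosine has derivative sin^3, which is the cube in [Sf']. *)
have du : is_derive w (1 : R) uw (hw w ^+ 3).
  have dV := is_deriveV kn0 dk.
  have := @is_deriveM _ _ (@id R) (@hw R) w 1 1 _ (is_derive_id w 1) dV.
  move=> /is_derive_eq; apply.
  have -> : (hw w)%:A = hw w :> R by rewrite -[LHS]/(_ * _) mulr1.
  rewrite -[LHS]/(w * (- kw w ^- 2 * (w / kw w)) + hw w) /hw.
  transitivity ((kw w ^+ 2 - w ^+ 2) / kw w ^+ 3); first by field.
  by rewrite kw2 addrK div1r exprVn.
pose q w := r ^+ 2 + t ^+ 2 - 2 * r * t * uw w.
have q0 : 0 < q w by have := Sf_gt0 w r0 t0; rewrite sqrtr_gt0.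
have dq : is_derive w (1 : R) q (- (2 * r * t * hw w ^+ 3)).
  have dZ := @is_deriveZ _ _ _ uw (2 * r * t) w 1 _ du.
  have := @is_deriveB _ _ _ (cst (r ^+ 2 + t ^+ 2)) _ w 1 _ _ (is_derive_cst _ _ _) dZ.
  by move=> /is_derive_eq; apply; rewrite sub0r.
have := @is_derive1_comp _ (@Num.sqrt R) q w _ _ (is_derive1_sqrt q0) dq.
move=> /is_derive_eq; apply; rewrite /Sf' /Sf -/(uw w) -/(q w); field.
by rewrite gt_eqF// sqrtr_gt0.
Qed.

Lemma Sf'_gt0 r t w : 0 < r -> 0 < t -> 0 < Sf' r t w.
Proof. by move=> r0 t0; rewrite divr_gt0 ?Sf_gt0// mulr_gt0 ?exprn_gt0 ?hw_gt0// mulr_gt0. Qed.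

Lemma Sf_decr r t : 0 < r -> 0 < t -> {homo Sf r t : x y /~ x < y}.
Proof.
move=> r0 t0 x y xy.
have dS w := is_derive_Sf w r0 t0.
have cS : continuous (Sf r t).
  by move=> w; apply/differentiable_continuous/derivable1_diffP; exact: ex_derive.
apply: (@ltr0_derive1_decr _ (Sf r t) y x) => //.
- by move=> w _; rewrite derive1E derive_val oppr_lt0 Sf'_gt0.
- exact: continuous_subspaceT.
Qed.

Lemma continuous_Sf' r t : 0 < r -> 0 < t -> continuous (Sf' r t).
Proof.
move=> r0 t0 w; apply: cvgM.
  apply: cvgM; first exact: cvg_cst.
  by apply: (@continuous_comp _ _ _ (@hw R) (fun x => x ^+ 3)); [exact: continuous_hw|exact: exprn_continuous].
apply: cvgV; first by rewrite gt_eqF// Sf_gt0.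
have dS := is_derive_Sf w r0 t0.
by apply/differentiable_continuous/derivable1_diffP; exact: ex_derive.
Qed.

(* [u] is the cosine of the angle between [x] and [y] when [|x| = r], [|y| = 1]
   and [|x - t y| = s]. *)
Definition ker n r t s : R :=
  `|s| / (r * t) * Num.sqrt (1 - ((r ^+ 2 + t ^+ 2 - s ^+ 2) / (2 * r * t)) ^+ 2) ^+ n.

Lemma ker_ge0 n r t s : 0 < r -> 0 < t -> 0 <= ker n r t s.
Proof.
by move=> r0 t0; rewrite mulr_ge0 ?exprn_ge0 ?sqrtr_ge0// divr_ge0// mulr_ge0// ltW.
Qed.

Lemma measurable_ker n r t : measurable_fun setT (ker n r t).
Proof.
apply: measurable_funM; first by apply: measurable_funM.
apply: measurable_funX.
apply: (@measurableT_comp _ _ _ _ _ _ (@Num.sqrt R)).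
  by apply: continuous_measurable_fun; exact: sqrt_continuous.
apply: measurable_funB => //; apply: measurable_funX; apply: measurable_funM => //.
by apply: measurable_funB => //; exact: measurable_funX.
Qed.

(** Three of the n + 3 powers of the sine are consumed by the Jacobian, r t sin^3 dw = s ds up to
    orientation. What remains is s / (r t) times sin^n. *)
Lemma Av_ker n r t (F : R -> R) : 0 < r -> 0 < t -> measurable_fun setT F ->
  (forall s, 0 <= F s) ->
  Av n.+3 r t F = (\int[mu]_(s in `](`|r - t|)%R, (r + t)%R[) (F s * ker n r t s)%:E)%E.
Proof.
move=> r0 t0 mF F0.
rewrite -(@substitution_decreasingT _ (Sf r t) (Sf' r t) _ _ _ _ `|r - t| (r + t)
  (fun s => (F s * ker n r t s)%:E)).
- apply: eq_integral => w _; rewrite -EFinM; congr (_%:E).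
  rewrite -mulrA; congr (_ * _).
  have S0 := Sf_gt0 w r0 t0.
  rewrite /ker SfE// gtr0_norm//.
  have -> : (r ^+ 2 + t ^+ 2 - (r ^+ 2 + t ^+ 2 - 2 * r * t * uw w)) / (2 * r * t) = uw w.
    by field; rewrite !gt_eqF.
  rewrite uw2 opprB addrCA subrr addr0 sqrtr_sqr gtr0_norm ?hw_gt0// /Sf'.
  rewrite -[n.+3]addn3 exprD; field.
  by rewrite !gt_eqF.
- by move=> w; exact: is_derive_Sf.
- exact: continuous_Sf'.
- by move=> w; rewrite ltW// Sf'_gt0.
- exact: Sf_decr.
- by move=> w; exact: Sf_itv.
- by move=> s; exact: Sf_surj.
- by apply/measurable_EFinP; apply: measurable_funM => //; exact: measurable_ker.
- by move=> s; rewrite lee_fin mulr_ge0// ker_ge0.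
Qed.

Lemma ker_le1 n r t s : 0 < r -> 0 < t -> ker n r t s <= `|s| / (r * t).
Proof.
move=> r0 t0; rewrite /ker ler_piMr//; first by rewrite divr_ge0// mulr_ge0// ltW.
rewrite exprn_ile1 ?sqrtr_ge0//.
by rewrite -[leRHS]sqrtr1 ler_wsqrtr// gerBl sqr_ge0.
Qed.

(** Heron's formula for the sine of the angle between the sides [r] and [t] of a triangle with third
    side [s]. *)
Let ker_sin r t s : 0 < r -> 0 < t ->
  1 - ((r ^+ 2 + t ^+ 2 - s ^+ 2) / (2 * r * t)) ^+ 2 =
  ((r + t) ^+ 2 - s ^+ 2) * (s ^+ 2 - (r - t) ^+ 2) / (4 * r ^+ 2 * t ^+ 2).
Proof. by move=> r0 t0; field; rewrite !gt_eqF. Qed.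

(** The two factors of Heron's formula are at most 4 r t and s^2, so sin^2 <= s^2 / (r t), and r t
    >= 1/2. The extra power of 2 s is the factor s / (r t). *)
Lemma ker_le2 n r t s : 2^-1 <= r -> 1 <= t -> `|r - t| < s < r + t ->
  ker n r t s <= (2 * s) ^+ n.+1.
Proof.
move=> r2 t1 /andP[s1 s2].
have r0 : 0 < r by lra.
have t0 : 0 < t by lra.
have s0 : 0 < s by rewrite (le_lt_trans _ s1).
have rt : 2^-1 <= r * t by nra.
rewrite /ker gtr0_norm// (exprS (2 * s) n); apply: ler_pM.
- by rewrite divr_ge0 ?ltW// mulr_gt0.
- by rewrite exprn_ge0// sqrtr_ge0.
- by rewrite ler_pdivrMr ?mulr_gt0//; nra.
rewrite lerXn2r ?nnegrE ?sqrtr_ge0 ?mulr_ge0 ?(ltW s0)//.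
have -> : 2 * s = Num.sqrt ((2 * s) ^+ 2) by rewrite sqrtr_sqr gtr0_norm// mulr_gt0.
rewrite ler_wsqrtr// ker_sin// ler_pdivrMr ?mulr_gt0 ?exprn_gt0//.
have h1 : 0 <= s ^+ 2 - (r - t) ^+ 2.
  by rewrite subr_ge0 -[(r - t) ^+ 2]real_normK ?num_real// lerXn2r ?nnegrE// ltW.
have h2 : s ^+ 2 - (r - t) ^+ 2 <= s ^+ 2 by rewrite gerBl sqr_ge0.
have h3 : (r + t) ^+ 2 - s ^+ 2 <= 4 * r * t.
  by have := h1; nra.
have h4 : 0 <= 4 * r * t by rewrite !mulr_ge0// ltW.
apply: (@le_trans _ _ (4 * r * t * s ^+ 2)).
  by apply: (le_trans (ler_wpM2r h1 h3)); exact: ler_wpM2l.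
have : 0 <= s ^+ 2 * (r * t) by rewrite mulr_ge0 ?sqr_ge0// mulr_ge0// ltW.
by nra.
Qed.

(** Away from both degenerate triangles Heron's factors are comparable to their bounds: 2 |r - t| <=
    s keeps three quarters of s^2, and s <= 1/2 keeps 3 r t of the other factor. Finally r t <=
    6. *)
Lemma ker_ge n r t s : 2^-1 <= r -> r <= 3 -> 1 <= t -> t <= 2 -> 0 < s -> s <= 2^-1 ->
  2 * `|r - t| <= s -> (s / 6) ^+ n.+1 <= ker n r t s.
Proof.
move=> r2 r3 t1 t2 s0 s2 rts.
have r0 : 0 < r by lra.
have t0 : 0 < t by lra.
have rt : r * t <= 6 by nra.
have rt0 : 0 < r * t by rewrite mulr_gt0.
rewrite /ker gtr0_norm// (exprS (s / 6) n); apply: ler_pM.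
- by rewrite divr_ge0 ?ltW.
- by rewrite exprn_ge0// divr_ge0// ltW.
- by rewrite ler_pM2l// lef_pV2 ?posrE.
rewrite lerXn2r ?nnegrE ?sqrtr_ge0 ?divr_ge0 ?(ltW s0)//.
have -> : s / 6 = Num.sqrt ((s / 6) ^+ 2) by rewrite sqrtr_sqr gtr0_norm// divr_gt0.
rewrite ler_wsqrtr// ker_sin// ler_pdivlMr ?mulr_gt0 ?exprn_gt0//.
have h1 : 4 * (r - t) ^+ 2 <= s ^+ 2.
  rewrite -[(r - t) ^+ 2]real_normK ?num_real//.
  have -> : 4 * `|r - t| ^+ 2 = (2 * `|r - t|) ^+ 2 by ring.
  by rewrite lerXn2r ?nnegrE ?mulr_ge0// ltW.
have h2 : 3 / 4 * s ^+ 2 <= s ^+ 2 - (r - t) ^+ 2 by lra.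
have h3 : s ^+ 2 <= 1 / 4 by nra.
have h4 : 3 * (r * t) <= (r + t) ^+ 2 - s ^+ 2 by have := sqr_ge0 (r - t); nra.
apply: (@le_trans _ _ (3 * (r * t) * (3 / 4 * s ^+ 2))); last first.
  by apply: ler_pM => //; rewrite mulr_ge0// ?sqr_ge0// ltW.
have : 0 <= s ^+ 2 * (r * t) by rewrite mulr_ge0 ?sqr_ge0// ltW.
rewrite expr_div_n; nra.
Qed.

End kernel.

(** * Estimates for large and small radii *)

Section power_tools.
Context {R : realType}.

Lemma powR_expR (x a : R) : 0 < x -> x `^ a = expR (a * ln x).
Proof. by move=> x0; rewrite /powR gt_eqF. Qed.

Lemma ler_powR2 (x y a : R) : 0 <= a -> 0 <= x -> x <= y -> x `^ a <= y `^ a.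
Proof. by move=> a0 x0 xy; apply: ge0_ler_powR => //; rewrite nnegrE// (le_trans x0). Qed.

Lemma powR_VK (x a : R) : 0 <= x -> a != 0 -> (x `^ a^-1) `^ a = x.
Proof. by move=> x0 a0; rewrite -powRrM mulVf// powRr1. Qed.

Lemma powR_KV (x a : R) : 0 <= x -> a != 0 -> (x `^ a) `^ a^-1 = x.
Proof. by move=> x0 a0; rewrite -powRrM divff// powRr1. Qed.

(* Splitting at height [eta] replaces Hoelder's inequality throughout. *)
Lemma split_height (p x eta : R) : 1 <= p -> 0 <= x -> 0 < eta ->
  x <= eta + x `^ p * eta `^ (1 - p).
Proof.
move=> p1 x0 eta0; have [xe|ex] := leP x eta.
  by rewrite (le_trans xe)// lerDl mulr_ge0 ?powR_ge0.
have {}x0 : 0 < x by exact: lt_trans ex.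
apply: (@le_trans _ _ (x `^ p * eta `^ (1 - p))); last by rewrite lerDr ltW.
apply: (@le_trans _ _ (x `^ p * x `^ (1 - p))).
  have e : p + (1 - p) = 1 by ring.
  by rewrite -powRD; [rewrite e powRr1// ltW|rewrite (gt_eqF x0) implybT].
rewrite ler_wpM2l ?powR_ge0// !powR_expR// ler_expR ler_wnM2l ?subr_le0//.
by rewrite ler_ln ?posrE// ltW.
Qed.

Lemma powR_addn_le (x y q : R) : 1 <= q -> 0 <= x -> x <= y ->
  x `^ q <= y `^ (q - 1) * x.
Proof.
move=> q1 x0 xy; rewrite -mulr_powRB1 ?(lt_le_trans ltr01)// mulrC.
by rewrite ler_wpM2r// ler_powR2// subr_ge0.
Qed.

Lemma integral_powR_tail (e : R) : 0 < e ->
  (\int[mu]_(x in `[1%R, +oo[) (x `^ (- 1 - e))%:E)%E = (e^-1)%:E.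
Proof.
move=> e0.
have cpow (a x : R) : 0 < x -> {for x, continuous (fun y : R => y `^ a)}.
  by move=> x0; apply/differentiable_continuous/derivable1_diffP; have := is_derive1_powR a x0; case.
rewrite (@ge0_continuous_FTC2y R _ (fun x => - e^-1 * x `^ (- e)) _ 0).
- by rewrite powR1 mulr1 -EFinB sub0r opprK.
- by move=> x x1; exact: powR_ge0.
- apply/continuous_within_itvcyP; split.
    by move=> x; rewrite in_itv /= andbT => x1; apply: cpow; rewrite (lt_trans _ x1).
  by apply: cvg_at_right_filter; exact: cpow.
- rewrite -[X in _ --> X](mulr0 (- e^-1)); apply: cvgM; first exact: cvg_cst.
  apply/cvgr0Pnorm_lt => eps eps0.
  near=> x.
  have xM : expR (e^-1 * - ln eps) < x by near: x; exact: nbhs_pinfty_gt.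
  have x0 : 0 < x by rewrite (lt_trans _ xM)// expR_gt0.
  rewrite ger0_norm ?powR_ge0// powR_expR// -[ltRHS]lnK ?posrE// ltr_expR.
  by rewrite mulNr ltrNl -ltr_pdivrMl// -[ltLHS]expRK ltr_ln ?posrE ?expR_gt0.
- move=> x x1; apply: derivableM; first exact: derivable_cst.
  by have := is_derive1_powR (- e) (lt_trans ltr01 x1); case.
- apply: cvgM; first exact: cvg_cst.
  by apply: cvg_at_right_filter; exact: cpow.
- move=> x; rewrite in_itv /= andbT => x1.
  have x0 : 0 < x by exact: lt_trans x1.
  have dp := is_derive1_powR (- e) x0.
  have [_ dE] := @is_deriveZ _ _ _ (fun y : R => y `^ (- e)) (- e^-1) x 1 _ dp.
  rewrite derive1E [LHS]dE.
  rewrite -[LHS]/(_ * _) mulrA mulrNN mulVf ?gt_eqF// mul1r.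
  by congr powR; ring.
Unshelve. all: by end_near. Qed.

End power_tools.

Section tails.
Context {R : realType}.

Lemma measurable_bool_fun d (T : measurableType d) (b : T -> bool) :
  measurable_fun setT b -> measurable_fun setT (fun x => (b x)%:R : R).
Proof. by move=> mb; apply: (@measurableT_comp _ _ _ _ _ _ (fun b : bool => b%:R : R)). Qed.

Lemma integral_inv_sq_tail (a : R) : 0 < a ->
  (\int[mu]_(x in `[a, +oo[) (`|x| `^ (- 2))%:E)%E = (a^-1)%:E.
Proof.
move=> a0; rewrite integral_mkcond.
have mf : measurable_fun setT ((fun x : R => (`|x| `^ (- 2))%:E) \_ `[a, +oo[).
  apply/(measurable_restrictT _ _).1 => //; apply: measurable_funTS; apply/measurable_EFinP.
  by apply: (measurableT_comp (@measurable_powR R (- 2))).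
have f0 x : (0 <= ((fun x : R => (`|x| `^ (- 2))%:E) \_ `[a, +oo[) x)%E.
  by apply: erestrict_ge0 => y _; rewrite lee_fin powR_ge0.
rewrite (integral_scale a0 mf f0).
transitivity (a%:E * ((a `^ (- 2))%:E * \int[mu]_(x in `[1%R, +oo[) (x `^ (- 1 - 1))%:E))%E.
  congr (_ * _)%E; rewrite [in RHS]integral_mkcond -ge0_integralZl_EFin ?powR_ge0//.
  - apply: eq_integral => x _; rewrite !patchE.
    have -> : (a * x \in `[a, +oo[%classic) = (x \in `[1, +oo[%classic).
      by apply/idP/idP => /set_mem /=; rewrite in_itv /= andbT => h; apply/mem_set;
        rewrite /= in_itv /= andbT; move: h; rewrite ler_pMr.
    case: ifPn => [/set_mem /=|]; last by rewrite mule0.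
    rewrite in_itv /= andbT => x1; have x0 : 0 < x by exact: lt_le_trans x1.
    rewrite -EFinM gtr0_norm ?mulr_gt0// powRM ?(ltW a0) ?(ltW x0)//.
    by rewrite (_ : - 1 - 1 = - 2)//; ring.
  - by move=> x _; apply: erestrict_ge0 => y _; rewrite lee_fin powR_ge0.
  - apply/(measurable_restrictT _ _).1 => //; apply: measurable_funTS; apply/measurable_EFinP.
    exact: measurable_powR.
rewrite integral_powR_tail// invr1 mule1 -EFinM; congr (_%:E).
rewrite -{1}(powRr1 (ltW a0)) -powRD; last by rewrite (gt_eqF a0) implybT.
by rewrite -powR_inv1 ?(ltW a0)//; congr powR; ring.
Qed.

(** A layer-cake argument in which X^(q-1) is dominated by the integral of a multiple of u^(q-2)
    over X/2 <= u <= X. Tonelli and the tail u^(-q) leave the integral of u^(-2) over u >= lam/2.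
    Using the window up to X instead of all u <= X gives a constant that does not degenerate at q =
    1. *)
Lemma tail_moment (D : set R) (X : R -> R) (q A : R) : measurable D ->
  measurable_fun setT X -> 1 <= q -> 0 <= A ->
  (forall u : R, 0 < u -> (mu (D `&` [set r | (u <= X r)%R]) <= (A * u `^ (- q))%:E)%E) ->
  forall lam : R, 0 < lam ->
  (\int[mu]_(r in D `&` [set r | (lam <= X r)%R]) (X r `^ (q - 1))%:E <= (2 `^ q * A * (2 / lam))%:E)%E.
Proof.
move=> mD mX q1 A0 tail lam lam0.
have mle (u : R) : measurable [set r | u <= X r].
  have := mX measurableT _ (measurable_itv `[u, +oo[).
  rewrite setTI; congr measurable.
  by apply/seteqP; split => r /=; rewrite in_itv /= andbT.
set D' := D `&` _.
have mD' : measurable D' by apply: measurableI.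
(* The factor 2^q is what makes [k] at least 2 X^(q-2) on the window: there 2 X^(q-1) = 2^q
   (X/2)^(q-1) <= 2^q u^(q-1), and 1/X <= 1/u. *)
pose k (u : R) := 2 `^ q * `|u| `^ (q - 2).
have k0 u : 0 <= k u by rewrite mulr_ge0 ?powR_ge0.
have mk : measurable_fun setT k.
  by apply: measurable_funM => //; apply: (measurableT_comp (@measurable_powR R _)).
pose G (p : R * R) := (((p.2 <= X p.1) && (X p.1 <= 2 * p.2))%:R * k p.2)%:E.
have mG : measurable_fun setT G.
  apply/measurable_EFinP; apply: measurable_funM; last by apply: (measurableT_comp mk).
  apply: measurable_bool_fun; apply: measurable_and; apply: measurable_fun_ler => //.
  - exact: (measurableT_comp mX).
  - exact: (measurableT_comp mX).
  - exact: measurable_funM.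
have G0 p : (0 <= G p)%E by rewrite lee_fin mulr_ge0.
have mB : measurable (`[lam / 2, +oo[%classic : set R) by [].
apply: (@le_trans _ _ (\int[mu]_(r in D') \int[mu]_(u in `[(lam / 2)%R, +oo[) G (r, u))%E).
  apply: ge0_le_integral_nomeas => r; first by move=> _; rewrite lee_fin powR_ge0.
  move=> [_ /= lamX]; have X0 : 0 < X r by exact: lt_le_trans lamX.
  apply: (@le_trans _ _ (\int[mu]_(u in `[(X r / 2)%R, X r]) (2 * (X r `^ (q - 1) / X r))%:E)%E).
    rewrite (_ : (fun=> _) = cst (2 * (X r `^ (q - 1) / X r))%:E)// integral_cst//= lebesgue_measure_itv /=.
    rewrite lte_fin ltr_pdivrMr// ltr_pMr// ltr1n -EFinB -EFinM lee_fin le_eqVlt; apply/orP; left.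
    by apply/eqP; field; rewrite gt_eqF.
  rewrite integral_mkcond [leRHS]integral_mkcond; apply: ge0_le_integral_nomeas => u _.
    by apply: erestrict_ge0 => v _; rewrite lee_fin !mulr_ge0 ?powR_ge0// invr_ge0 ltW.
  rewrite !patchE; case: ifPn => [/set_mem /=|_]; last by case: ifPn.
  rewrite in_itv /= => /andP[u1 u2].
  have u0 : 0 < u by rewrite (lt_le_trans _ u1)// divr_gt0.
  rewrite mem_set; last by rewrite /= in_itv /= andbT (le_trans _ u1)// ler_pM2r.
  have Xu : X r <= 2 * u by rewrite mulrC -ler_pdivrMr.
  rewrite /G /= u2 Xu mul1r lee_fin /k gtr0_norm//.
  have -> : u `^ (q - 2) = u `^ (q - 1) * u^-1.
    rewrite -powR_inv1 ?(ltW u0)// -powRD; last by rewrite (gt_eqF u0) implybT.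
    by congr powR; ring.
  rewrite !mulrA; apply: ler_pM.
  - by rewrite mulr_ge0 ?powR_ge0.
  - by rewrite invr_ge0 ltW.
  - have -> : 2 * X r `^ (q - 1) = 2 `^ q * (X r / 2) `^ (q - 1).
      rewrite powRM ?invr_ge0 ?(ltW X0)// [_ * 2^-1 `^ _]mulrC mulrA; congr (_ * _).
      rewrite -powR_inv1// -powRrM -powRD; last by apply/implyP.
      by rewrite (_ : q + _ = 1) ?powRr1//; ring.
    rewrite ler_wpM2l ?powR_ge0// ler_powR2// ?subr_ge0//.
    by rewrite divr_ge0 ?ltW.
  - by rewrite lef_pV2 ?posrE.
rewrite (tonelliR mD' mB mG G0).
apply: (@le_trans _ _ (\int[mu]_(u in `[(lam / 2)%R, +oo[) ((2 `^ q * A)%:E * (`|u| `^ (- 2))%:E))%E).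
  apply: ge0_le_integral_nomeas => u /=; rewrite in_itv /= andbT => lu.
    by apply: integral_ge0.
  have u0 : 0 < u by rewrite (lt_le_trans _ lu)// divr_gt0.
  apply: (@le_trans _ _ (\int[mu]_(r in D `&` [set r | (u <= X r)%R]) (k u)%:E)%E).
    rewrite integral_mkcond [leRHS]integral_mkcond; apply: ge0_le_integral_nomeas => r _.
      exact: erestrict_ge0.
    rewrite !patchE; case: ifPn => [/set_mem [Dr _]|_]; last first.
      by case: ifPn => // _; rewrite lee_fin.
    rewrite /G /=; have [uX|uX] := boolP (u <= X r); last first.
      by rewrite mul0r; case: ifPn => // _; rewrite lee_fin.
    by rewrite mem_set// lee_fin; case: (X r <= _); rewrite /= ?mul1r ?mul0r.
  have mDu : measurable (D `&` [set r | u <= X r]) by apply: measurableI.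
  rewrite (_ : (fun=> (k u)%:E) = cst (k u)%:E)// integral_cst//.
  apply: (le_trans (lee_wpmul2l _ (tail u u0))); first by rewrite lee_fin.
  rewrite -!EFinM lee_fin /k gtr0_norm//.
  have -> : u `^ (- 2) = u `^ (q - 2) * u `^ (- q).
    by rewrite -powRD; [congr powR; ring|rewrite (gt_eqF u0) implybT].
  by rewrite le_eqVlt; apply/orP; left; apply/eqP; ring.
rewrite ge0_integralZl_EFin//.
- by rewrite integral_inv_sq_tail ?divr_gt0// invf_div -EFinM.
- apply: measurable_funTS; apply/measurable_EFinP.
  by apply: (measurableT_comp (@measurable_powR R (- 2))).
- by rewrite mulr_ge0 ?powR_ge0.
Qed.

End tails.

Section regions.
Context {R : realType}.
Local Notation pos := (`]0%R, +oo[%classic : set R).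

Definition wint (m : nat) (p : R) (F : R -> R) : \bar R :=
  (\int[mu]_(s in pos) (F s `^ p * s ^+ m)%:E)%E.

(** [Psi] controls all t in [E] at once, and it is the function that is integrated in place of the
    maximal function. Normalizing [F] allows the splitting heights to ignore its norm. *)
Definition region_bound (n : nat) (p q : R) (E D : set R) : Prop :=
  exists C : R, forall F : R -> R, measurable_fun setT F -> (forall s, 0 <= F s) ->
  (wint n.+2 p F <= 1)%E ->
  exists Psi : R -> \bar R, [/\ measurable_fun setT Psi, (forall r, 0 <= Psi r)%E,
    (forall r t, D r -> E t -> poweR (Av n.+3 r t F) q <= Psi r)%E &
    (\int[mu]_(r in D) (Psi r * (r ^+ n.+2)%:E) <= C%:E)%E].

(** [split_height] integrated against [psi]. The height stays free, to be chosen later from the two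
    integrals, which makes this a substitute for Hoelder's inequality. *)
Lemma split_integral (I : set R) (v psi : R -> R) (p eta a b : R) :
  measurable I -> measurable_fun setT v -> measurable_fun setT psi ->
  (forall s, 0 <= v s) -> (forall s, 0 <= psi s) -> 1 <= p -> 0 < eta ->
  (\int[mu]_(s in I) (psi s)%:E <= a%:E)%E ->
  (\int[mu]_(s in I) (v s `^ p * psi s)%:E <= b%:E)%E ->
  (\int[mu]_(s in I) (v s * psi s)%:E <= (eta * a + eta `^ (1 - p) * b)%:E)%E.
Proof.
move=> mI mv mpsi v0 psi0 p1 eta0 ha hb.
have mpsiE : measurable_fun I (fun s => (psi s)%:E) by apply/measurable_EFinP; exact: measurable_funTS.
have mvp : measurable_fun setT (fun s => v s `^ p) by apply: (measurableT_comp (@measurable_powR R p)).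
have mvE : measurable_fun I (fun s => (v s `^ p * psi s)%:E).
  by apply/measurable_EFinP; apply: measurable_funTS; exact: measurable_funM.
apply: (@le_trans _ _ (\int[mu]_(s in I) (eta%:E * (psi s)%:E +
    (eta `^ (1 - p))%:E * (v s `^ p * psi s)%:E))%E).
  apply: ge0_le_integral_nomeas => s _; first by rewrite lee_fin mulr_ge0.
  rewrite -!EFinM -EFinD lee_fin.
  have := ler_wpM2r (psi0 s) (split_height p1 (v0 s) eta0).
  by rewrite mulrDl => h; apply: (le_trans h); rewrite le_eqVlt; apply/orP; left; apply/eqP; ring.
have e0 : (0 <= eta)%R by exact: ltW.
have mpe : measurable_fun I (fun s => (eta%:E * (psi s)%:E)%E).
  by apply: emeasurable_funM.
have mve : measurable_fun I (fun s => ((eta `^ (1 - p))%:E * (v s `^ p * psi s)%:E)%E).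
  by apply: emeasurable_funM.
have i1 := ge0_integralZl_EFin (@lebesgue_measure R) mI (f1 := fun s => (psi s)%:E)
  (fun s _ => psi0 s : (0 <= (psi s)%:E)%E) mpsiE e0.
have vp0 s : I s -> (0 <= (v s `^ p * psi s)%:E)%E by rewrite lee_fin mulr_ge0 ?powR_ge0.
have i2 := ge0_integralZl_EFin (@lebesgue_measure R) mI vp0 mvE (powR_ge0 eta (1 - p)).
rewrite ge0_integralD//.
- rewrite i1 i2 EFinD !EFinM; apply: leeD; apply: lee_wpmul2l => //; rewrite lee_fin ?powR_ge0//.
- by move=> s _; rewrite -EFinM lee_fin mulr_ge0.
- by move=> s _; rewrite -EFinM lee_fin !mulr_ge0 ?powR_ge0.
Qed.

Lemma integral_window (D : set R) (s a c : R) : measurable D -> 0 < a -> 0 <= c ->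
  (\int[mu]_(r in D) ((`|s - r| < a)%R%:R * c)%:E <= (2 * a * c)%:E)%E.
Proof.
move=> mD a0 c0.
apply: (@le_trans _ _ (\int[mu]_(r in `](s - a)%R, (s + a)%R[) c%:E)%E).
  rewrite integral_mkcond [leRHS]integral_mkcond; apply: ge0_le_integral_nomeas => r _.
    by apply: erestrict_ge0 => x _; rewrite lee_fin mulr_ge0.
  rewrite !patchE; have [h|h] := boolP (`|s - r| < a); last first.
    by case: ifPn => _; case: ifPn => _; rewrite ?mul0r ?lee_fin.
  rewrite (_ : r \in `](s - a)%R, (s + a)%R[%classic).
    by case: ifPn => _; rewrite ?mul1r ?lee_fin.
  by apply/mem_set; rewrite /= in_itv /=; move: h; rewrite ltr_norml => /andP[? ?]; apply/andP; split; lra.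
rewrite (_ : (fun=> _) = cst c%:E)// integral_cst//= lebesgue_measure_itv /= lte_fin.
rewrite ifT; last by lra.
by rewrite -EFinB -EFinM lee_fin le_eqVlt; apply/orP; left; apply/eqP; ring.
Qed.

Lemma Av_le_ker n r t (F G : R -> R) : 0 < r -> 0 < t -> measurable_fun setT F ->
  (forall s, 0 <= F s) -> (forall s, 0 <= G s) -> forall I : set R,
  (forall s, `|r - t| < s < r + t -> I s /\ F s * ker n r t s <= G s) ->
  (Av n.+3 r t F <= \int[mu]_(s in I) (G s)%:E)%E.
Proof.
move=> r0 t0 mF F0 G0 I h; rewrite Av_ker//.
rewrite integral_mkcond [leRHS]integral_mkcond; apply: ge0_le_integral_nomeas => s _.
  by apply: erestrict_ge0 => x _; rewrite lee_fin mulr_ge0// ker_ge0.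
rewrite !patchE; case: ifPn => [/set_mem /=|_]; last by case: ifPn => // _; rewrite lee_fin.
by rewrite in_itv /= => /h[Is FG]; rewrite mem_set// lee_fin.
Qed.

(** The hypothesis p <= q enters here: a power q/p >= 1 of a bounded quantity is at most linear in
    it, and linear quantities can be integrated by Tonelli. *)
Lemma powR_powR_le (theta p q : R) : 1 <= p -> p <= q -> 0 <= theta -> theta <= 2 ->
  (theta `^ p^-1) `^ q <= 2 `^ (q / p - 1) * theta.
Proof.
move=> p1 pq t0 t2; rewrite -powRrM mulrC.
apply: powR_addn_le => //.
by rewrite ler_pdivlMr ?mul1r// (lt_le_trans ltr01).
Qed.

(** For r >= 3 only s with |s - r| < 2 contribute, and there s > 1 and the kernel is at most 2. The
    average is thus governed by the integral [Db] of F^p over this window, and [Db] is at most 1. *)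
Lemma region_large n (p q : R) (E : set R) : 1 <= p -> p <= q -> E `<=` `[1, 2] ->
  region_bound n p q E `[3, +oo[.
Proof.
move=> p1 pq hE.
have p0 : 0 < p by exact: lt_le_trans p1.
have q0 : 0 <= q by rewrite (le_trans (ltW p0)).
pose m := n.+2.
pose K := 10 `^ q * 2 `^ (q / p - 1).
have K0 : 0 <= K by rewrite mulr_ge0 ?powR_ge0.
exists (K * (4 * 3 ^+ m + fine (@Jw R 2))) => F mF F0 F1.
have mFp : measurable_fun setT (fun s => F s `^ p) by apply: (measurableT_comp (@measurable_powR R p)).
pose G (x : R * R) := ((`|x.2 - x.1| < 2)%R%:R * F x.2 `^ p)%:E.
have mG : measurable_fun setT G.
  apply/measurable_EFinP; apply: measurable_funM; last by apply: (measurableT_comp mFp).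
  apply: measurable_bool_fun; apply: measurable_fun_ltr => //.
  by apply: measurableT_comp => //; exact: measurable_funB.
have G0 x : (0 <= G x)%E by rewrite lee_fin mulr_ge0 ?powR_ge0.
have mpos : measurable pos by [].
pose Db (r : R) := (\int[mu]_(s in pos) G (r, s))%E.
have mDb : measurable_fun setT Db by exact: measurable_integralR mpos mG G0.
have Db0 r : (0 <= Db r)%E by apply: integral_ge0.
have Db1 r : 3 <= r -> (Db r <= 1)%E.
  move=> r3; apply: le_trans F1; apply: ge0_le_integral_nomeas => // s /=.
  rewrite in_itv /= andbT => s0; rewrite /G /= lee_fin.
  have [h|h] := boolP (_ < _); last by rewrite mul0r mulr_ge0 ?powR_ge0// exprn_ge0// ltW.
  rewrite mul1r ler_peMr ?powR_ge0// exprn_ege1//.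
  by move: h; rewrite ltr_norml => /andP[? ?]; lra.
(* The added term decays like r^(-m-2): it makes the height positive and remains integrable against
   r^m. *)
pose th r := (fine (Db r) + hw r ^+ m.+2).
have Dbfin r : 3 <= r -> (fine (Db r))%:E = Db r.
  by move=> r3; rewrite fineK// ge0_fin_numE// (le_lt_trans (Db1 r r3))// ltry.
pose Psi r := (K%:E * (Db r + (hw r ^+ m.+2)%:E))%E.
have mhw : measurable_fun setT (fun r : R => (hw r ^+ m.+2)%:E) by exact: measurable_hwX.
exists Psi; split.
- by apply: emeasurable_funM => //; exact: emeasurable_funD.
- by move=> r; rewrite mule_ge0 ?lee_fin// adde_ge0// lee_fin exprn_ge0// ltW// hw_gt0.
- move=> r t; rewrite /= in_itv /= andbT => r3 /hE; rewrite /= in_itv /= => /andP[t1 t2].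
  have r0 : 0 < r by lra.
  have t0 : 0 < t by lra.
  have D1 : 0 <= fine (Db r) <= 1.
    by rewrite -!lee_fin Dbfin// Db0 Db1.
  have h1 : 0 < hw r ^+ m.+2 <= 1.
    by rewrite exprn_gt0 ?hw_gt0// exprn_ile1 ?hw_le1// ltW// hw_gt0.
  have th0 : 0 < th r by rewrite /th; lra.
  pose eta := th r `^ p^-1.
  have eta0 : 0 < eta by rewrite powR_gt0.
  have AvE : (Av n.+3 r t F <= (10 * eta)%:E)%E.
    pose I := (`](r - 2)%R, (r + 2)%R[%classic `&` pos : set R).
    have mI : measurable I by apply: measurableI.
    apply: (@le_trans _ _ (\int[mu]_(s in I) (F s * 2)%:E)%E).
      apply: Av_le_ker => // [s|s]; first by rewrite mulr_ge0.
      rewrite ger0_norm; last by lra.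
      move=> /andP[s1 s2]; split.
        by split; rewrite /= in_itv /= ?andbT; lra.
      rewrite ler_wpM2l// (le_trans (ker_le1 _ _ r0 t0))//.
      have s0 : 0 < s by lra.
      by rewrite gtr0_norm// ler_pdivrMr ?mulr_gt0//; nra.
    (* Here 8 is the kernel bound 2 times the window length 4. Since Db <= th = eta^p, the second
       summand is at most 2 eta. *)
    apply: (@le_trans _ _ (eta * 8 + eta `^ (1 - p) * (2 * fine (Db r)))%:E).
      apply: split_integral => //.
        apply: (@le_trans _ _ (\int[mu]_(s in `](r - 2)%R, (r + 2)%R[) 2%:E)%E).
          by apply: ge0_subset_integral => //; exact: subIsetl.
        rewrite (_ : (fun=> _) = cst 2%:E)// integral_cst//= lebesgue_measure_itv /= lte_fin.
        rewrite ifT; last by lra.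
        by rewrite -EFinB -EFinM lee_fin; lra.
      have -> : (2 * fine (Db r))%:E = (\int[mu]_(s in pos) (2%:E * G (r, s)))%E.
        rewrite EFinM Dbfin// -ge0_integralZl_EFin//.
        by apply: measurable_funTS; exact: (measurableT_comp mG).
      rewrite integral_mkcond [leRHS]integral_mkcond; apply: ge0_le_integral_nomeas => s _.
        by apply: erestrict_ge0 => x _; rewrite lee_fin mulr_ge0 ?powR_ge0.
      rewrite !patchE; case: ifPn => [/set_mem [/=]|_]; last by case: ifPn => // _; rewrite mule_ge0.
      rewrite in_itv /= => /andP[s1 s2] s0; rewrite mem_set// /G /= -EFinM lee_fin.
      rewrite (_ : `|s - r| < 2); last by rewrite ltr_norml; lra.
      by rewrite mul1r mulrC.
    rewrite lee_fin.
    have ep : eta `^ (1 - p) * fine (Db r) <= eta.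
      apply: (@le_trans _ _ (eta `^ (1 - p) * th r)).
        by rewrite ler_wpM2l ?powR_ge0// /th; lra.
      have -> : th r = eta `^ p by rewrite /eta powR_VK ?gt_eqF// ltW.
      rewrite -powRD; last by rewrite (gt_eqF eta0) implybT.
      by rewrite (_ : 1 - p + p = 1) ?powRr1 ?(ltW eta0)//; ring.
    by rewrite mulrCA; lra.
  have A0 := @Av_ge0 R n.+3 r t F F0.
  apply: (@le_trans _ _ (poweR (10 * eta)%:E q)).
    by apply: gt0_ler_poweR => //; rewrite in_itv /= ?A0 ?leey// lee_fin mulr_ge0// ltW.
  rewrite poweR_EFin powRM// ?(ltW eta0)// /Psi -Dbfin// -EFinD -EFinM lee_fin -mulrA.
  by rewrite ler_wpM2l ?powR_ge0// powR_powR_le// /th; lra.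
have hm (r : R) : 0 <= r -> hw r ^+ m.+2 * r ^+ m <= hw r ^+ 2.
  move=> r0; rewrite -[m.+2]addn2 exprD mulrAC -exprMn ler_piMl ?exprn_ge0 ?(ltW (hw_gt0 _))//.
  rewrite exprn_ile1 ?mulr_ge0 ?(ltW (hw_gt0 _))//.
  rewrite mulrC /hw ler_pdivrMr ?kw_gt0// mul1r -[leLHS](ger0_norm r0) -sqrtr_sqr ler_wsqrtr//.
  by rewrite lerDr.
have mD : measurable (`[3, +oo[%classic : set R) by [].
have mX : measurable_fun setT (fun r : R => (`|r| ^+ m)%:E).
  by apply/measurable_EFinP; apply: measurable_funX.
apply: (@le_trans _ _ (K%:E * (\int[mu]_(r in `[3%R, +oo[) (Db r * (`|r| ^+ m)%:E) +
    \int[mu]_(r in `[3%R, +oo[) (hw r ^+ 2)%:E)))%E.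
  have m1 : measurable_fun (`[3%R, +oo[%classic : set R) (fun r => (Db r * (`|r| ^+ m)%:E))%E.
    by apply: measurable_funTS; apply: emeasurable_funM.
  have m2 : measurable_fun (`[3%R, +oo[%classic : set R) (fun r => ((hw r ^+ 2)%:E)).
    by apply: measurable_funTS; exact: measurable_hwX.
  have g1 r : (0 <= Db r * (`|r| ^+ m)%:E)%E by rewrite mule_ge0.
  have g2 r : (0 <= (hw r ^+ 2)%:E)%E by rewrite lee_fin exprn_ge0// ltW// hw_gt0.
  rewrite -ge0_integralD// -ge0_integralZl_EFin//; [|by move=> r _; rewrite adde_ge0|exact: emeasurable_funD].
  apply: ge0_le_integral_nomeas => r /=; rewrite in_itv /= andbT => r3.
    rewrite mule_ge0 ?lee_fin ?exprn_ge0//; last by lra.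
    by rewrite mule_ge0 ?lee_fin// adde_ge0// lee_fin exprn_ge0// ltW// hw_gt0.
  rewrite /Psi -muleA lee_wpmul2l ?lee_fin// ger0_norm; last by lra.
  rewrite ge0_muleDl// ?lee_fin ?exprn_ge0 ?(ltW (hw_gt0 _))//.
  by rewrite leeD2l// -EFinM lee_fin hm//; lra.
rewrite [leRHS]EFinM lee_wpmul2l ?lee_fin// EFinD; apply: leeD; last first.
  rewrite fineK ?Jw_fin//; apply: ge0_subset_integral => //; first exact: measurable_hwX.
  by move=> r _; rewrite lee_fin exprn_ge0// ltW// hw_gt0.
pose H (x : R * R) := (G x * (`|x.1| ^+ m)%:E)%E.
have mH : measurable_fun setT H.
  by apply: emeasurable_funM => //; exact: (measurableT_comp mX).
have H0 x : (0 <= H x)%E by rewrite mule_ge0.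
have -> : (\int[mu]_(r in `[3%R, +oo[) (Db r * (`|r| ^+ m)%:E) =
    \int[mu]_(r in `[3%R, +oo[) \int[mu]_(s in pos) H (r, s))%E.
  apply: eq_integral => r _; rewrite -ge0_integralZr//.
  by apply: measurable_funTS; exact: (measurableT_comp mG).
rewrite (tonelliR mD mpos mH H0).
have mw : measurable_fun pos (fun s => (F s `^ p * s ^+ m)%:E).
  by apply/measurable_EFinP; apply: measurable_funTS; apply: measurable_funM => //; exact: measurable_funX.
have w0 s : pos s -> (0 <= (F s `^ p * s ^+ m)%:E)%E.
  by rewrite /= in_itv /= andbT => s0; rewrite lee_fin mulr_ge0 ?powR_ge0// exprn_ge0// ltW.
(* For fixed s the radii fill a window of length 4, on which r < s + 2 < 3 s because s > 1. *)
apply: (@le_trans _ _ ((4 * 3 ^+ m)%:E * wint m p F)%E); last first.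
  by rewrite -[leRHS]mule1 lee_wpmul2l// lee_fin mulr_ge0// exprn_ge0.
have c0 : (0 <= 4 * 3 ^+ m :> R)%R by apply: mulr_ge0 => //; exact: exprn_ge0.
rewrite /wint -(ge0_integralZl_EFin (@lebesgue_measure R) mpos w0 mw c0).
apply: ge0_le_integral_nomeas => s /=; rewrite in_itv /= andbT => s0; first by apply: integral_ge0.
apply: (@le_trans _ _ (\int[mu]_(r in `[3%R, +oo[) ((`|s - r| < 2)%R%:R * (F s `^ p * (3 ^+ m * s ^+ m)))%:E)%E).
  apply: ge0_le_integral_nomeas => r // /=; rewrite in_itv /= andbT => r3.
  rewrite /H /G /= -EFinM lee_fin -mulrA; have [h|_] := boolP (_ < _); last by rewrite !mul0r.
  move: h; rewrite ltr_norml !mul1r => /andP[h1 h2].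
  rewrite ler_wpM2l ?powR_ge0// -exprMn lerXn2r ?nnegrE//; last by rewrite ger0_norm; lra.
  by rewrite mulr_ge0// ltW.
apply: (le_trans (integral_window _ mD _ _)) => //.
  by rewrite mulr_ge0 ?powR_ge0// mulr_ge0 ?exprn_ge0// ltW.
by rewrite -EFinM lee_fin le_eqVlt; apply/orP; left; apply/eqP; ring.
Qed.

End regions.

Section small_region.
Context {R : realType}.
Local Notation pos := (`]0%R, +oo[%classic : set R).
Local Notation J := (`]2^-1%R, (5/2)%R[%classic : set R).

(** For r <= 1/2 and t in [1, 2] the window |s - t| < r lies in [J], where s^m is at least
    2^(-m). *)
Lemma wint_window m (p : R) (F : R -> R) : measurable_fun setT F ->
  (wint m p F <= 1)%E -> (\int[mu]_(s in J) (F s `^ p)%:E <= (2 ^+ m)%:E)%E.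
Proof.
move=> mF F1.
have mw : measurable_fun pos (fun s => (F s `^ p * s ^+ m)%:E).
  apply/measurable_EFinP; apply: measurable_funTS; apply: measurable_funM; last exact: measurable_funX.
  by apply: (measurableT_comp (@measurable_powR R p)).
have w0 s : pos s -> (0 <= (F s `^ p * s ^+ m)%:E)%E.
  by rewrite /= in_itv /= andbT => s0; rewrite lee_fin mulr_ge0 ?powR_ge0// exprn_ge0// ltW.
have c0 : (0 <= 2 ^+ m :> R) by exact: exprn_ge0.
apply: (@le_trans _ _ ((2 ^+ m)%:E * wint m p F)%E); last first.
  by rewrite -[leRHS]mule1; apply: lee_wpmul2l.
rewrite /wint -(ge0_integralZl_EFin (@lebesgue_measure R) _ w0 mw c0)//.
apply: ge0_le_integral_sub => [s _|s /w0 h|s /=]; first by rewrite lee_fin powR_ge0.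
  by rewrite mule_ge0.
rewrite !in_itv /= andbT => /andP[s1 s2]; split; first by lra.
rewrite -EFinM lee_fin mulrCA -exprMn ler_peMr ?powR_ge0// exprn_ege1//; lra.
Qed.

Lemma Av_small n r t (F : R -> R) : 0 < r -> r <= 2^-1 -> 1 <= t -> t <= 2 ->
  measurable_fun setT F -> (forall s, 0 <= F s) ->
  (Av n.+3 r t F <= \int[mu]_(s in `](t - r)%R, (t + r)%R[) (F s * (2 / r))%:E)%E.
Proof.
move=> r0 r1 t1 t2 mF F0.
apply: Av_le_ker => //; first by lra.
  by move=> s; rewrite mulr_ge0// divr_ge0// ltW.
move=> s; rewrite distrC ger0_norm; last by lra.
move=> /andP[s1 s2]; split; first by rewrite /= in_itv /=; lra.
have t0 : 0 < t by lra.
rewrite ler_wpM2l// (le_trans (ker_le1 _ _ r0 t0))// gtr0_norm; last by lra.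
rewrite ler_pdivrMr ?mulr_gt0//.
have -> : 2 / r * (r * t) = 2 * t by field; rewrite gt_eqF.
lra.
Qed.

(** The trivial bound 2/r times the norm is integrable against r^m. The exponent 1 is separated
    because the truncated power needs 1 - 1/p > 0; q = 1 is the only case that the type set meets
    when p = 1. *)
Lemma region_small1 n (E : set R) : E `<=` `[1, 2] -> region_bound n 1 1 E `]0, 2^-1].
Proof.
move=> hE; pose m := n.+2.
exists (2 ^+ m.+1) => F mF F0 F1.
have W := wint_window mF F1.
exists (fun r => (2 ^+ m.+1 * `|r|^-1)%:E); split.
- apply/measurable_EFinP; apply: measurable_funM => //.
  exact: (measurable_fun_inv (f := fun r : R => `|r|)).
- by move=> r; rewrite lee_fin mulr_ge0 ?exprn_ge0// invr_ge0.
- move=> r t; rewrite /= in_itv /= => /andP[r0 r1] /hE; rewrite /= in_itv /= => /andP[t1 t2].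
  rewrite poweRe1; last exact: Av_ge0.
  apply: (le_trans (Av_small _ r0 r1 t1 t2 mF F0)).
  have c0 : 0 <= 2 / r by rewrite divr_ge0// ltW.
  apply: (@le_trans _ _ ((2 / r)%:E * \int[mu]_(s in J) (F s `^ 1)%:E)%E); last first.
    apply: (le_trans (lee_wpmul2l _ W)); first by rewrite lee_fin.
    by rewrite -EFinM lee_fin gtr0_norm// mulrAC -exprS.
  rewrite -ge0_integralZl_EFin//; last 2 first.
  - by move=> s _; rewrite lee_fin powR_ge0.
  - by apply/measurable_EFinP; apply: measurable_funTS; apply: (measurableT_comp (@measurable_powR R 1)).
  apply: ge0_le_integral_sub => [s _|s _|s /=]; first by rewrite lee_fin mulr_ge0.
    by rewrite -EFinM lee_fin mulr_ge0 ?powR_ge0.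
  rewrite !in_itv /= => /andP[s1 s2]; split; first by lra.
  by rewrite -EFinM lee_fin powRr1// mulrC.
apply: (@le_trans _ _ (\int[mu]_(r in `]0%R, 2^-1%R]) (2 ^+ m.+1)%:E)%E).
  apply: ge0_le_integral_nomeas => r /=; rewrite in_itv /= => /andP[r0 r1]; rewrite -EFinM lee_fin.
    apply: mulr_ge0; last by apply: exprn_ge0; exact: ltW.
    by apply: mulr_ge0; [exact: exprn_ge0|rewrite invr_ge0].
  rewrite gtr0_norm// -mulrA ler_piMr ?exprn_ge0// exprS mulKf ?gt_eqF// exprn_ile1 ?(ltW r0)//; lra.
rewrite (_ : (fun=> _) = cst (2 ^+ m.+1)%:E)// integral_cst//= lebesgue_measure_itv /= lte_fin.
rewrite invr_gt0 ltr0n /= -EFinB -EFinM lee_fin subr0 ler_piMr ?exprn_ge0//; lra.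
Qed.

Section truncated_power.
Variables (p La : R) (m : nat).
Hypotheses (p1 : 1 < p) (La1 : 1 <= La) (m0 : (0 < m)%N).
Let e := m.+1%:R - p^-1.
Let Q := p * m.+1%:R.

(* The excess of [v] over a height [eta] is controlled by
   [trunc_pow v r * eta `^ (1 - Q)] as soon as [eta `^ Q <= (La / r) ^+ m.+1];
   truncating at [v `^ p = La / r] makes [\int r ^ (m - 1) * trunc_pow v r dr]
   finite, and by scaling it is a multiple of [v `^ p]. *)
Definition trunc_pow (v r : R) : R := Num.min (v `^ Q) (v * (La / `|r|) `^ e).

Let p0 : 0 < p. Proof. by rewrite (lt_trans _ p1). Qed.

Let eE : p * e = Q - 1.
Proof. by rewrite /e mulrBr divff ?gt_eqF. Qed.

Lemma trunc_pow_ge0 v r : 0 <= v -> 0 <= trunc_pow v r.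
Proof. by move=> v0; rewrite le_min powR_ge0 mulr_ge0// powR_ge0. Qed.

Lemma measurable_trunc_pow (F : R -> R) d (T : measurableType d) (f g : T -> R) :
  measurable_fun setT f -> measurable_fun setT g ->
  measurable_fun setT (fun x => trunc_pow (f x) (g x)).
Proof.
move=> mf mg; apply: measurable_minr; first by apply: (measurableT_comp (@measurable_powR R Q)).
apply: measurable_funM => //; apply: (measurableT_comp (@measurable_powR R e)).
apply: measurable_funM => //; apply: (measurable_fun_inv (f := fun r => `|g r|)) => //.
exact: measurableT_comp.
Qed.

(** Below the truncation, v^Q = v^p (v^p)^m with v^p <= La / r. Above it, e = m + (1 - 1/p) and (La
    / r)^(1 - 1/p) <= v^(p-1). The bound later shows that the height chosen from an integral of
    [trunc_pow] is admissible in [split_trunc]. *)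
Lemma trunc_pow_le v r : 0 <= v -> 0 < r -> trunc_pow v r <= v `^ p * (La / r) ^+ m.
Proof.
move=> v0 r0; rewrite /trunc_pow gtr0_norm//.
have L0 : 0 < La / r by rewrite divr_gt0// (lt_le_trans _ La1).
have [->|v_neq0] := eqVneq v 0.
  by rewrite mul0r ge_min mulr_ge0 ?powR_ge0 ?exprn_ge0 ?(ltW L0) ?orbT.
have {}v0 : 0 < v by rewrite lt_neqAle eq_sym v_neq0.
rewrite -powR_mulrn ?(ltW L0)// ge_min.
have QE : Q = p + p * m%:R by rewrite /Q -natr1; ring.
have [h|h] := leP (p * ln v) (ln (La / r)).
  apply/orP; left; rewrite !powR_expR// -expRD ler_expR QE mulrDl lerD2l.
  by rewrite mulrAC mulrC ler_wpM2l.
apply/orP; right; rewrite -{1}[v]lnK ?posrE// !powR_expR// -!expRD ler_expR.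
have -> : e = m%:R + (1 - p^-1) by rewrite /e -natr1; ring.
have pp : 0 <= 1 - p^-1 by rewrite subr_ge0 invf_le1// ltW.
have := ler_wpM2l pp (ltW h).
have -> : (1 - p^-1) * (p * ln v) = (p - 1) * ln v by field; rewrite gt_eqF.
by lra.
Qed.

(** If the minimum is v^Q, this is [split_height] with exponent Q. Otherwise the second term alone
    exceeds v: eta^p <= La / r and p e = Q - 1 give (La / r)^e eta^(1-Q) >= 1. *)
Lemma split_trunc v r eta : 0 <= v -> 0 < r -> 0 < eta -> eta `^ Q <= (La / r) ^+ m.+1 ->
  v <= eta + trunc_pow v r * eta `^ (1 - Q).
Proof.
move=> v0 r0 eta0 etaL.
have L0 : 0 < La / r by rewrite divr_gt0// (lt_le_trans _ La1).
rewrite /trunc_pow gtr0_norm//; case: (leP (v `^ Q)) => _.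
  apply: split_height => //; rewrite /Q -[leLHS]mul1r; apply: ler_pM => //; first exact: ltW.
  by rewrite ler1n.
rewrite -[leLHS]add0r lerD ?(ltW eta0)// -mulrA ler_peMr//.
move: etaL; rewrite -powR_mulrn ?(ltW L0)// !powR_expR// -expRD ler_expR => h.
rewrite -[leLHS]expR0 ler_expR.
have -> : e * ln (La / r) + (1 - Q) * ln eta = e * (ln (La / r) - p * ln eta).
  by rewrite mulrBr mulrA [e * p]mulrC eE; ring.
apply: mulr_ge0.
  rewrite /e subr_ge0 (@le_trans _ _ 1)// ?ler1n// invf_le1// ltW//.
rewrite subr_ge0; move: h; rewrite /Q mulrAC [_ * ln (La / r)]mulrC.
by rewrite ler_pM2r.
Qed.

Let kap : \bar R := (\int[mu]_(r in pos) (`|r| ^+ m.-1 * trunc_pow 1 r)%:E)%E.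

(** Near 0 the integrand is at most 1. At infinity it is a multiple of r^(m-1-e) = r^(-1-(1-1/p)),
    which is integrable exactly because p > 1. *)
Lemma integral_trunc_pow_fin : (kap < +oo)%E.
Proof.
pose eps := 1 - p^-1.
have eps0 : 0 < eps by rewrite subr_gt0 invf_lt1.
have me1 : measurable_fun setT (fun x : R => (x `^ (- 1 - eps))%:E).
  by apply/measurable_EFinP; exact: measurable_powR.
apply: (@le_lt_trans _ _ (\int[mu]_(r in `]0%R, 1%R]) 1 +
    (La `^ e)%:E * \int[mu]_(r in `[1%R, +oo[) (r `^ (- 1 - eps))%:E)%E); last first.
  rewrite integral_powR_tail// integral_cst//= lebesgue_measure_itv /= lte_fin ltr01.
  by rewrite mul1e -EFinB -EFinM -EFinD ltry.
rewrite -ge0_integralZl_EFin ?powR_ge0//; [|by move=> x _; rewrite lee_fin powR_ge0|exact: measurable_funTS].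
have mf : measurable_fun setT (fun r : R => (`|r| ^+ m.-1 * trunc_pow 1 r)%:E).
  apply/measurable_EFinP; apply: measurable_funM; last exact: measurable_trunc_pow.
  by apply: measurable_funX.
have f0 r : (0 <= (`|r| ^+ m.-1 * trunc_pow 1 r)%:E)%E.
  by rewrite lee_fin mulr_ge0 ?exprn_ge0 ?trunc_pow_ge0.
have posE : pos = `]0, 1]%classic `|` `]1, +oo[%classic.
  apply/seteqP; split => r /=; rewrite !in_itv /= !andbT.
    by move=> r0; case: (leP r 1) => r1; [left; rewrite r0|right].
  by move=> [/andP[]//|/(lt_trans _)]; exact.
rewrite /kap posE ge0_integral_setU//=; last 2 first.
- exact: measurable_funTS.
- apply/disj_set2P/seteqP; split => r //= []; rewrite !in_itv /= andbT => /andP[_ h1] h2.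
  by move: (le_lt_trans h1 h2); rewrite ltxx.
apply: leeD; apply: ge0_le_integral_sub => // r /=.
  rewrite in_itv /= => /andP[r0 r1]; split; first by rewrite r0.
  rewrite lee_fin mulr_ile1 ?exprn_ge0 ?trunc_pow_ge0//.
    by rewrite exprn_ile1// gtr0_norm.
  by rewrite /trunc_pow powR1 ge_min lexx.
  by rewrite mule_ge0// lee_fin powR_ge0.
rewrite !in_itv /= !andbT => r1; split; first exact: ltW.
have r0 : 0 < r by exact: lt_trans r1.
rewrite -EFinM lee_fin gtr0_norm//.
apply: (@le_trans _ _ (r ^+ m.-1 * (La / r) `^ e)).
  by rewrite ler_wpM2l ?exprn_ge0 ?(ltW r0)// /trunc_pow mul1r gtr0_norm// ge_min lexx orbT.
have La0 : 0 < La by rewrite (lt_le_trans _ La1).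
rewrite -powR_mulrn ?(ltW r0)// powRM ?invr_ge0 ?(ltW La0) ?(ltW r0)// mulrCA.
rewrite ler_wpM2l ?powR_ge0// -powR_inv1 ?(ltW r0)// -powRrM -powRD; last by rewrite (gt_eqF r0) implybT.
rewrite le_eqVlt; apply/orP; left; apply/eqP; congr powR.
by rewrite /e /eps -[in m.+1%:R](prednK m0) -!natr1; ring.
Qed.

Lemma integral_trunc_pow v : 0 <= v ->
  (\int[mu]_(r in pos) (`|r| ^+ m.-1 * trunc_pow v r)%:E <= (v `^ p)%:E * kap)%E.
Proof.
rewrite le_eqVlt => /predU1P[<-|v0].
  rewrite (_ : (\int[mu]_(r in pos) _)%E = 0%E).
    by rewrite mule_ge0 ?lee_fin ?powR_ge0// integral_ge0// => x _; rewrite lee_fin mulr_ge0 ?exprn_ge0 ?trunc_pow_ge0.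
  apply: integral0_eq => r _; rewrite /trunc_pow mul0r powR0; first by rewrite minxx mulr0.
  by rewrite /Q mulf_neq0// gt_eqF.
have mf w : measurable_fun setT (fun r : R => (`|r| ^+ m.-1 * trunc_pow w r)%:E).
  apply/measurable_EFinP; apply: measurable_funM.
    by apply: measurable_funX.
  exact: measurable_trunc_pow.
have f0 w r : 0 <= w -> (0 <= (`|r| ^+ m.-1 * trunc_pow w r)%:E)%E.
  by move=> w0; rewrite lee_fin mulr_ge0 ?exprn_ge0// trunc_pow_ge0.
(* In units of v^(-p) the truncation radius La v^(-p) becomes that of v = 1. The powers produced are
   v^Q and v^(-p m), with product v^p. *)
pose a := v `^ (- p).
have a0 : 0 < a by rewrite powR_gt0.
rewrite (integral_scale_pos a0 (mf v) (fun r => f0 v r (ltW v0))).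
have mpos : measurable pos by [].
have mfa : measurable_fun setT (fun r : R => (`|a * r| ^+ m.-1 * trunc_pow v (a * r))%:E).
  by apply: (measurableT_comp (mf v)); exact: measurable_funM.
rewrite -(ge0_integralZl_EFin (@lebesgue_measure R) mpos (fun r _ => f0 v (a * r) (ltW v0))
  (measurable_funTS mfa) (ltW a0)).
rewrite /kap -(ge0_integralZl_EFin (@lebesgue_measure R) mpos (fun r _ => f0 1 r ler01)
  (measurable_funTS (mf 1)) (powR_ge0 v p)).
apply: ge0_le_integral_nomeas => r /=; rewrite in_itv /= andbT => r0.
  by rewrite mule_ge0 ?lee_fin ?(ltW a0)//; exact: (f0 v (a * r) (ltW v0)).
rewrite -!EFinM lee_fin.
have tE : trunc_pow v (a * r) = v `^ Q * trunc_pow 1 r.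
  rewrite /trunc_pow minr_pMr ?powR_ge0// powR1 mulr1 mul1r; congr Num.min.
  have La0 : 0 < La / r by rewrite divr_gt0// (lt_le_trans _ La1).
  rewrite !gtr0_norm ?mulr_gt0//.
  have -> : La / (a * r) = a^-1 * (La / r) by field; rewrite !gt_eqF.
  rewrite (@powRM _ a^-1 (La / r)) ?invr_ge0 ?(ltW a0) ?(ltW La0)// mulrA; congr (_ * _).
  rewrite /a -powRN opprK -powRrM -{1}[v](powRr1 (ltW v0)) -powRD; last by rewrite (gt_eqF v0) implybT.
  by rewrite eE; congr powR; ring.
rewrite tE normrM gtr0_norm// exprMn.
have -> : a * (a ^+ m.-1 * `|r| ^+ m.-1 * (v `^ Q * trunc_pow 1 r)) =
   (a ^+ m * v `^ Q) * (`|r| ^+ m.-1 * trunc_pow 1 r).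
  by rewrite -[in RHS](prednK m0) exprS; ring.
rewrite ler_wpM2r ?mulr_ge0 ?exprn_ge0 ?trunc_pow_ge0//.
rewrite /a -powR_mulrn ?powR_ge0// -powRrM -powRD; last by rewrite (gt_eqF v0) implybT.
by rewrite le_eqVlt; apply/orP; left; apply/eqP; congr powR; rewrite /Q -natr1; ring.
Qed.

End truncated_power.

End small_region.

Section small_region_strong.
Context {R : realType}.
Local Notation pos := (`]0%R, +oo[%classic : set R).
Local Notation J := (`]2^-1%R, (5/2)%R[%classic : set R).

(** The averages are at most 6 b^(1/Q) with b = B + 1 and Q = p (m + 1), where B integrates
    [trunc_pow] of F over [J], divided by r. The restriction q <= Q makes b^(q/Q) <= b, and b is
    integrable against r^m by [integral_trunc_pow]. *)
Lemma region_small n (p q : R) (E : set R) : 1 < p -> 0 <= q -> q <= p * n.+3%:R ->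
  E `<=` `[1, 2] -> region_bound n p q E `]0, 2^-1].
Proof.
move=> p1 q0 qQ hE; pose m := n.+2.
(* [A] bounds the integral of F^p over [J], so B <= (La / r)^m A / r. The 1 in [La] pays for the 1
   in b = B + 1, giving b <= (La / r)^(m+1). *)
pose A : R := 2 ^+ m; pose La : R := A + 1.
have A0 : 0 <= A by exact: exprn_ge0.
have La1 : 1 <= La by rewrite lerDr.
have La0 : 0 < La by exact: lt_le_trans La1.
have p0 : 0 < p by exact: lt_trans p1.
have m0 : (0 < m)%N by [].
pose Q := p * m.+1%:R.
have Q0 : 0 < Q by rewrite mulr_gt0.
pose tp := trunc_pow p La m.
have kapfin := integral_trunc_pow_fin p1 La1 m0.
have kapE := @integral_trunc_pow _ p La m p1 La1 m0.
set kap := (\int[mu]_(r in pos) (`|r| ^+ m.-1 * trunc_pow p La m 1 r)%:E)%E in kapfin kapE.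
have tp0 v r : 0 <= v -> 0 <= tp v r by exact: trunc_pow_ge0.
have kap0 : (0 <= kap)%E.
  by apply: integral_ge0 => r _; rewrite lee_fin mulr_ge0 ?exprn_ge0 ?tp0.
exists (6 `^ q * (A * fine kap + 1)) => F mF F0 F1.
have W := wint_window mF F1.
have mJ : measurable J by [].
have mFp : measurable_fun setT (fun s => F s `^ p) by apply: (measurableT_comp (@measurable_powR R p)).
have minv : measurable_fun setT (fun x : R * R => `|x.1|^-1).
  apply: (measurable_fun_inv (f := fun x : R * R => `|x.1|)) => //.
  exact: measurableT_comp.
pose G (x : R * R) := (`|x.1|^-1 * tp (F x.2) x.1)%:E.
have mG : measurable_fun setT G.
  apply/measurable_EFinP; apply: measurable_funM => //.
  by apply: measurable_trunc_pow => //; exact: (measurableT_comp mF).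
have G0 x : (0 <= G x)%E by rewrite lee_fin mulr_ge0 ?invr_ge0// tp0.
pose B r := (\int[mu]_(s in J) G (r, s))%E.
have mB : measurable_fun setT B by exact: measurable_integralR mJ mG G0.
have B0 r : (0 <= B r)%E by apply: integral_ge0.
have Ble r : 0 < r -> (B r <= ((La / r) ^+ m * r^-1 * A)%:E)%E.
  move=> r0; have c0 : 0 <= (La / r) ^+ m * r^-1.
    by rewrite mulr_ge0 ?exprn_ge0 ?invr_ge0 ?divr_ge0// ltW.
  apply: (@le_trans _ _ (((La / r) ^+ m * r^-1)%:E * \int[mu]_(s in J) (F s `^ p)%:E)%E).
    rewrite -ge0_integralZl_EFin//; last 2 first.
    - by move=> s _; rewrite lee_fin powR_ge0.
    - by apply/measurable_EFinP; exact: measurable_funTS.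
    apply: ge0_le_integral_nomeas => s _ //; rewrite /G /= -EFinM lee_fin gtr0_norm//.
    rewrite mulrAC mulrC ler_wpM2r ?invr_ge0 ?(ltW r0)// mulrC.
    exact: trunc_pow_le.
  by rewrite [leRHS]EFinM lee_wpmul2l.
have BE r : B r = (\int[mu]_(s in J) G (r, s))%E by [].
clearbody B.
have Bfin r : 0 < r -> (fine (B r))%:E = B r.
  by move=> r0; rewrite fineK// ge0_fin_numE// (le_lt_trans (Ble r r0))// ltry.
exists (fun r => ((6 `^ q)%:E * (B r + 1))%E); split.
- by apply: emeasurable_funM => //; exact: emeasurable_funD.
- by move=> r; rewrite mule_ge0 ?lee_fin ?powR_ge0// adde_ge0.
- move=> r t; rewrite /= in_itv /= => /andP[r0 r1] /hE; rewrite /= in_itv /= => /andP[t1 t2].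
  pose b := fine (B r) + 1.
  have fB0 : 0 <= fine (B r) by rewrite -lee_fin Bfin.
  have b1 : 1 <= b by rewrite /b lerDr.
  have b0 : 0 < b by exact: lt_le_trans b1.
  have Lr0 : 0 < La / r by rewrite divr_gt0.
  pose eta := b `^ Q^-1.
  have eta0 : 0 < eta by rewrite powR_gt0.
  have etaQ : eta `^ Q = b by rewrite powR_VK ?gt_eqF// ltW.
  have bL : b <= (La / r) ^+ m.+1.
    have h : 1 <= (La / r) ^+ m * r^-1.
      have ri1 : 1 <= r^-1 by rewrite invf_ge1//; clear -r1; lra.
      have : 1 <= (La / r) ^+ m.
        by rewrite exprn_ege1// -[leLHS]mulr1; apply: ler_pM.
      by move=> h1; rewrite -[leLHS]mulr1; apply: ler_pM.
    have h2 : fine (B r) <= (La / r) ^+ m * r^-1 * A by rewrite -lee_fin Bfin// Ble.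
    have -> : (La / r) ^+ m.+1 = (La / r) ^+ m * r^-1 * A + (La / r) ^+ m * r^-1.
      by rewrite (exprSr (La / r) m) [in X in _ * X = _]/La; ring.
    by rewrite /b; exact: (lerD h2 h).
  have AvE : (Av n.+3 r t F <= (6 * eta)%:E)%E.
    pose I := (`](t - r)%R, (t + r)%R[%classic : set R).
    have mI : measurable I by exact: measurable_itv.
    have er0 : 0 <= eta * (2 / r).
      by apply: mulr_ge0; [exact: ltW|apply: divr_ge0 => //; exact: ltW].
    have e1Q : 0 <= eta `^ (1 - Q) by exact: powR_ge0.
    apply: (le_trans (Av_small _ r0 r1 t1 t2 mF F0)).
    have IJ s : I s -> J s.
      by rewrite /I /= !in_itv /= => /andP[s1 s2]; apply/andP; split; clear -r0 r1 t1 t2 s1 s2; lra.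
    apply: (@le_trans _ _ (\int[mu]_(s in I) (eta * (2 / r))%:E +
        (2 * eta `^ (1 - Q))%:E * \int[mu]_(s in J) G (r, s))%E).
      have mGr : measurable_fun setT (fun s => G (r, s)) by exact: (measurableT_comp mG).
      have c0 : 0 <= 2 * eta `^ (1 - Q) by rewrite mulr_ge0.
      apply: (@le_trans _ _ (\int[mu]_(s in I) (eta * (2 / r))%:E +
        \int[mu]_(s in I) ((2 * eta `^ (1 - Q))%:E * G (r, s)))%E).
        rewrite -ge0_integralD//; last 2 first.
        - by move=> s _; rewrite mule_ge0.
        - by apply: emeasurable_funM => //; exact: measurable_funTS.
        apply: ge0_le_integral_nomeas => s _.
          by rewrite lee_fin; apply: mulr_ge0 => //; apply: divr_ge0 => //; exact: ltW.
        rewrite /G /= -EFinM -EFinD lee_fin gtr0_norm//.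
        have ri : 0 <= 2 / r by rewrite divr_ge0// ltW.
        have etaL : eta `^ Q <= (La / r) ^+ m.+1 by rewrite etaQ.
        have := ler_wpM2r ri (split_trunc p1 La1 (F0 s) r0 eta0 etaL).
        move=> h; apply: (le_trans h); rewrite le_eqVlt; apply/orP; left; apply/eqP.
        by rewrite /tp -/Q; ring.
      rewrite leeD2l// -ge0_integralZl_EFin//; last exact: measurable_funTS.
      apply: ge0_le_integral_sub => s; first by rewrite mule_ge0.
      - by rewrite mule_ge0.
      - by move=> /IJ.
    rewrite (_ : (fun=> _) = cst (eta * (2 / r))%:E)// integral_cst//= lebesgue_measure_itv /= lte_fin.
    rewrite ifT; last by clear -r0; lra.
    rewrite -BE -Bfin// -EFinB -!EFinM -EFinD lee_fin.
    have h1 : eta `^ (1 - Q) * fine (B r) <= eta.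
      apply: (@le_trans _ _ (eta `^ (1 - Q) * b)); first by rewrite ler_wpM2l// lerDl.
      rewrite -etaQ -powRD; last by rewrite (gt_eqF eta0) implybT.
      by rewrite (_ : 1 - Q + Q = 1) ?powRr1 ?(ltW eta0)//; ring.
    have -> : eta * (2 / r) * (t + r - (t - r)) = 4 * eta by field; rewrite gt_eqF.
    by rewrite -mulrA; clear -h1; lra.
  have Av0 := @Av_ge0 R n.+3 r t F F0.
  apply: (@le_trans _ _ (poweR (6 * eta)%:E q)).
    by apply: gt0_ler_poweR => //; rewrite in_itv /= ?Av0 ?leey// lee_fin mulr_ge0// ltW.
  rewrite poweR_EFin powRM// ?(ltW eta0)// -Bfin// -EFinD -EFinM lee_fin.
  (* Here b >= 1 and q <= Q are used: b^(q/Q) <= b. *)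
  rewrite ler_wpM2l ?powR_ge0// -/b /eta -powRrM ler1_powR//.
  by rewrite mulrC ler_pdivrMr// mul1r.
have mD : measurable (`]0, 2^-1]%classic : set R) by [].
have mX : measurable_fun setT (fun r : R => (`|r| ^+ m)%:E).
  by apply/measurable_EFinP; apply: measurable_funX.
have mBX : measurable_fun setT (fun r => B r * (`|r| ^+ m)%:E)%E by apply: emeasurable_funM.
have BX0 r : (0 <= B r * (`|r| ^+ m)%:E)%E by rewrite mule_ge0.
apply: (@le_trans _ _ ((6 `^ q)%:E * (\int[mu]_(r in `]0%R, 2^-1%R]) (B r * (`|r| ^+ m)%:E) +
    \int[mu]_(r in `]0%R, 2^-1%R]) 1))%E).
  rewrite -ge0_integralD//; last exact: measurable_funTS.
  rewrite -ge0_integralZl_EFin ?powR_ge0//; last 2 first.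
  - by move=> r _; rewrite adde_ge0.
  - by apply: emeasurable_funD => //; exact: measurable_funTS.
  apply: ge0_le_integral_nomeas => r /=; rewrite in_itv /= => /andP[r0 r1].
    rewrite mule_ge0 ?lee_fin ?exprn_ge0 ?(ltW r0)//.
    by rewrite mule_ge0 ?lee_fin ?powR_ge0// adde_ge0.
  rewrite -muleA lee_wpmul2l ?lee_fin ?powR_ge0// gtr0_norm// ge0_muleDl// leeD2l// mul1e lee_fin.
  rewrite exprn_ile1 ?(ltW r0)//; clear -r1; lra.
rewrite [leRHS]EFinM lee_wpmul2l ?lee_fin ?powR_ge0// EFinD; apply: leeD; last first.
  rewrite integral_cst//= lebesgue_measure_itv /= lte_fin invr_gt0 ltr0n /= mul1e -EFinB lee_fin; lra.
pose H (x : R * R) := (G x * (`|x.1| ^+ m)%:E)%E.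
have mH : measurable_fun setT H.
  by apply: emeasurable_funM => //; exact: (measurableT_comp mX).
have H0 x : (0 <= H x)%E by rewrite mule_ge0.
have -> : (\int[mu]_(r in `]0%R, 2^-1%R]) (B r * (`|r| ^+ m)%:E) =
    \int[mu]_(r in `]0%R, 2^-1%R]) \int[mu]_(s in J) H (r, s))%E.
  apply: eq_integral => r _; rewrite BE -ge0_integralZr//.
  by apply: measurable_funTS; exact: (measurableT_comp mG).
rewrite (tonelliR mD mJ mH H0).
have mFpE : measurable_fun J (fun s => (F s `^ p)%:E).
  by apply/measurable_EFinP; exact: measurable_funTS.
have Fp0 s : J s -> (0 <= (F s `^ p)%:E)%E by rewrite lee_fin powR_ge0.
apply: (@le_trans _ _ (kap * \int[mu]_(s in J) (F s `^ p)%:E)%E); last first.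
  rewrite EFinM muleC fineK; last by rewrite ge0_fin_numE.
  exact: lee_wpmul2r.
rewrite -(ge0_integralZl (@lebesgue_measure R) mJ mFpE Fp0 kap0).
apply: ge0_le_integral_nomeas => s _; first by apply: integral_ge0.
rewrite muleC; apply: le_trans (kapE (F s) (F0 s)).
apply: ge0_le_integral_sub => r /=.
- by [].
- by move=> _; rewrite lee_fin mulr_ge0 ?exprn_ge0// tp0.
rewrite !in_itv /= andbT => /andP[r0 r1]; split => //.
rewrite /H /G /= -EFinM lee_fin mulrAC ler_wpM2r ?tp0// gtr0_norm//.
by rewrite /m /= (exprS r n.+1) mulKf ?lexx// gt_eqF.
Qed.

End small_region_strong.

(** * Radii comparable to one *)

Section middle_region.
Context {R : realType}.
Local Notation S := (`]0%R, 5%R[%classic : set R).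
Local Notation D := (`]2^-1%R, 3%R[%classic : set R).

(** The argument for an abstract weight. The function split is v = F s^(n+1) / psi, whose integral
    against [psi] is that of F s^(n+1). The inequality with [C1] trades v^p psi for F^p s^(n+2) Y.
    The null set [Z] collects the radii where [X] would be infinite. *)
Lemma region_mid n (p q A C1 : R) (E Z : set R) (delta X Y psi : R -> R) :
  1 <= p -> p <= q -> E `<=` `[1, 2] -> 0 <= A -> 0 <= C1 ->
  measurable_fun setT delta -> measurable_fun setT X -> measurable_fun setT Y ->
  measurable_fun setT psi -> measurable Z -> mu Z = 0%E ->
  (forall r t, E t -> delta r <= `|r - t|) ->
  (forall s, 0 <= psi s) -> (forall s, S s -> 0 < psi s) ->
  (forall s, 0 <= Y s) -> (forall s, S s -> 1 <= Y s) ->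
  (forall s, S s -> (s ^+ n.+1 / psi s) `^ p * psi s <= C1 * (s ^+ n.+2 * Y s)) ->
  (forall r, D r -> ~ Z r ->
     (\int[mu]_(s in S `&` [set s | (delta r <= s)%R]) (psi s)%:E <= (X r)%:E)%E) ->
  (forall r s, D r -> ~ Z r -> S s -> delta r <= s -> Y s <= X r) ->
  (forall r, D r -> ~ Z r -> 1 <= X r) ->
  (forall u, 0 < u -> (mu (D `&` [set r | (u <= X r)%R]) <= (A * u `^ (- q))%:E)%E) ->
  region_bound n p q E D.
Proof.
move=> p1 pq hE A0 C10 mdelta mX mY mpsi mZ Z0 deltaE psi0 psi_gt0 Y0 Y1 H1 H2 H3 X1 tail.
have p0 : 0 < p by exact: lt_le_trans p1.
have q0 : 0 <= q by rewrite (le_trans (ltW p0)).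
have q1 : 1 <= q by exact: le_trans pq.
pose m := n.+2.
(* The power of 2 comes from [ker_le2]; the summands 1 and [C1] are the two terms of the
   splitting. *)
pose M := 2 ^+ n.+1 * (1 + C1).
have M0 : 0 <= M by apply: mulr_ge0; [exact: exprn_ge0|lra].
pose K := M `^ q * 2 `^ (q / p - 1).
have K0 : 0 <= K by rewrite mulr_ge0 ?powR_ge0.
pose A' := 2 `^ q * A * 2.
have A'0 : 0 <= A' by rewrite !mulr_ge0 ?powR_ge0.
have moment (lam : R) : 0 < lam ->
    (\int[mu]_(r in D `&` [set r | (lam <= X r)%R]) (X r `^ (q - 1))%:E <= (A' / lam)%:E)%E.
  move=> lam0; rewrite (_ : A' / lam = 2 `^ q * A * (2 / lam)); last by rewrite /A' mulrA.
  by apply: (@tail_moment _ D X q A) => //; exact: measurable_itv.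
exists (K * 3 ^+ m * (A' + A')) => F mF F0 F1.
have mFp : measurable_fun setT (fun s => F s `^ p) by apply: (measurableT_comp (@measurable_powR R p)).
have mXq : measurable_fun setT (fun s => X s `^ (q - 1)) by apply: (measurableT_comp (@measurable_powR R (q - 1))).
pose w s := F s `^ p * (`|s| ^+ m * Y s).
have w0 s : 0 <= w s by rewrite mulr_ge0 ?powR_ge0// mulr_ge0// exprn_ge0.
have mw : measurable_fun setT w.
  by apply: measurable_funM => //; apply: measurable_funM => //; apply: measurable_funX.
pose G (x : R * R) := ((delta x.1 <= x.2)%R%:R * w x.2)%:E.
have mG : measurable_fun setT G.
  apply/measurable_EFinP; apply: measurable_funM; last by apply: (measurableT_comp mw).
  apply: measurable_bool_fun; apply: measurable_fun_ler => //.
  exact: (measurableT_comp mdelta).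
have G0 x : (0 <= G x)%E by rewrite lee_fin mulr_ge0.
have mS : measurable S by exact: measurable_itv.
pose B (r : R) := (\int[mu]_(s in S) G (r, s))%E.
have mB : measurable_fun setT B by exact: measurable_integralR mS mG G0.
have B0 r : (0 <= B r)%E by apply: integral_ge0.
have BE r : B r = (\int[mu]_(s in S) G (r, s))%E by [].
clearbody B.
have mp : measurable (`]0%R, +oo[%classic : set R) by exact: measurable_itv.
have BX r : D r -> ~ Z r -> (B r <= (X r)%:E)%E.
  move=> Dr Zr; rewrite BE.
  apply: (@le_trans _ _ ((X r)%:E * wint m p F)%E); last first.
    by rewrite -[leRHS]mule1; apply: lee_wpmul2l => //; rewrite lee_fin (le_trans _ (X1 r Dr Zr)).
  have X0 : 0 <= X r by rewrite (le_trans _ (X1 r Dr Zr)).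
  have mw' : measurable_fun (`]0%R, +oo[%classic : set R) (fun s => (F s `^ p * s ^+ m)%:E).
    by apply/measurable_EFinP; apply: measurable_funTS; apply: measurable_funM => //; exact: measurable_funX.
  have w0' s : (`]0%R, +oo[%classic : set R) s -> (0 <= (F s `^ p * s ^+ m)%:E)%E.
    by rewrite /= in_itv /= andbT => s0; rewrite lee_fin mulr_ge0 ?powR_ge0// exprn_ge0// ltW.
  rewrite /wint -(ge0_integralZl_EFin (@lebesgue_measure R) mp w0' mw' X0).
  apply: ge0_le_integral_sub => [s _|s h|s Ss].
  - exact: G0.
  - by rewrite mule_ge0 ?lee_fin ?X0//; move/w0': h; rewrite lee_fin.
  have /andP[s0 s5] : 0 < s < 5 by move: (Ss); rewrite /= in_itv.
  split; first by rewrite /= in_itv /= s0.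
  rewrite /G /= -EFinM lee_fin /w gtr0_norm//.
  have c0 : 0 <= F s `^ p * s ^+ m by rewrite mulr_ge0 ?powR_ge0// exprn_ge0// ltW.
  have [h|_] := boolP (_ <= s); last by rewrite mul0r mulr_ge0.
  by rewrite mul1r [leRHS]mulrC mulrA ler_wpM2l// H3.
have Bfin r : D r -> ~ Z r -> (fine (B r))%:E = B r.
  by move=> Dr Zr; rewrite fineK// ge0_fin_numE// (le_lt_trans (BX r Dr Zr))// ltry.
pose P0 r := ((K * X r `^ (q - 1))%:E * (B r + 1))%E.
(* On [Z] the majorant is infinite, so domination is free there and the integral does not see it. *)
pose P1 := (cst (+oo%E : \bar R)) \_ Z.
have mP0 : measurable_fun setT P0.
  apply: emeasurable_funM; last by apply: emeasurable_funD.
  by apply/measurable_EFinP; apply: measurable_funM.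
have mP1 : measurable_fun setT P1 by apply/(measurable_restrictT _ _).1.
have P00 r : (0 <= P0 r)%E.
  by apply: mule_ge0; [rewrite lee_fin mulr_ge0 ?powR_ge0|rewrite adde_ge0].
have P10 r : (0 <= P1 r)%E by apply: erestrict_ge0 => x _; exact: leey.
exists (fun r => (P0 r + P1 r)%E); split.
- exact: emeasurable_funD.
- by move=> r; exact: adde_ge0.
- move=> r t Dr Et.
  have [Zr|Zr] := pselect (Z r).
    rewrite /P1 patchE mem_set// addey ?leey//.
    by rewrite gt_eqF// (lt_le_trans _ (P00 r))// ltNyr.
  rewrite /P1 patchE memNset// adde0.
  have /andP[r1 r2] : 2^-1 < r < 3 by move: Dr; rewrite /= in_itv.
  have /andP[t1 t2] : 1 <= t <= 2 by move: (hE _ Et); rewrite /= in_itv.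
  have r0 : 0 < r by clear -r1; lra.
  have t0 : 0 < t by clear -t1; lra.
  have fB0 : 0 <= fine (B r) by rewrite -lee_fin Bfin.
  have fBX : fine (B r) <= X r by rewrite -lee_fin Bfin// BX.
  have Xr1 := X1 r Dr Zr.
  have X0 : 0 < X r by exact: lt_le_trans Xr1.
  (* The added 1 keeps the height positive; since B <= X and 1 <= X, [th] is still at most 2. *)
  pose th := (fine (B r) + 1) / X r.
  have th0 : 0 < th by rewrite divr_gt0//; clear -fB0; lra.
  have th2 : th <= 2 by rewrite ler_pdivrMr//; clear -fBX Xr1; lra.
  pose eta := th `^ p^-1.
  have eta0 : 0 < eta by rewrite powR_gt0.
  have etap : eta `^ p = th by rewrite powR_VK ?gt_eqF// ltW.
  have AvE : (Av n.+3 r t F <= (M * (eta * X r))%:E)%E.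
    pose I := S `&` [set s | delta r <= s].
    have mI : measurable I.
      apply: measurableI => //; rewrite (_ : [set _ | _] = `[delta r, +oo[%classic).
        exact: measurable_itv.
      by apply/seteqP; split => s /=; rewrite in_itv /= andbT.
    pose v s := F s * (`|s| ^+ n.+1 / psi s).
    have v0 s : 0 <= v s by rewrite mulr_ge0// mulr_ge0 ?exprn_ge0// invr_ge0.
    have mv : measurable_fun setT v.
      apply: measurable_funM => //; apply: measurable_funM; first by apply: measurable_funX.
      exact: measurable_fun_inv.
    have step1 : (\int[mu]_(s in I) (v s * psi s)%:E <= (eta * X r + eta `^ (1 - p) * (C1 * fine (B r)))%:E)%E.
      apply: split_integral => //; first exact: H2.
      rewrite EFinM Bfin// BE -ge0_integralZl_EFin//; last first.
        by apply: measurable_funTS; exact: (measurableT_comp mG).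
      apply: ge0_le_integral_sub => [s _|s _|s [Ss ds]].
      - by rewrite lee_fin mulr_ge0 ?powR_ge0.
      - by rewrite mule_ge0 ?lee_fin ?C10//; move: (G0 (r, s)); rewrite lee_fin.
      split => //; rewrite /G /= ds mul1r -EFinM lee_fin.
      have /andP[s0 s5] : 0 < s < 5 by move: (Ss); rewrite /= in_itv.
      rewrite /v /w gtr0_norm// (@powRM _ (F s) (s ^+ n.+1 / psi s))//; last first.
        by rewrite mulr_ge0 ?exprn_ge0 ?(ltW s0)// invr_ge0.
      rewrite -mulrA [leRHS]mulrCA ler_wpM2l ?powR_ge0//.
      exact: H1.
    apply: (@le_trans _ _ ((2 ^+ n.+1)%:E * \int[mu]_(s in I) (v s * psi s)%:E)%E); last first.
      have c0 : 0 <= 2 ^+ n.+1 :> R by exact: exprn_ge0.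
      apply: (le_trans (lee_wpmul2l _ step1)); first by rewrite lee_fin.
      rewrite -EFinM lee_fin /M -mulrA ler_wpM2l// mulrDl mul1r lerD2l// mulrCA ler_wpM2l//.
      apply: (@le_trans _ _ (eta `^ (1 - p) * (th * X r))).
        rewrite ler_wpM2l ?powR_ge0// /th divfK ?gt_eqF//; clear -fB0; lra.
      rewrite mulrA -etap -powRD; last by rewrite (gt_eqF eta0) implybT.
      by rewrite (_ : 1 - p + p = 1) ?powRr1 ?(ltW eta0)//; ring.
    have c0 : 0 <= 2 ^+ n.+1 :> R by exact: exprn_ge0.
    have mvp : measurable_fun I (fun s => (v s * psi s)%:E).
      by apply/measurable_EFinP; apply: measurable_funTS; exact: measurable_funM.
    have vp0 s : I s -> (0 <= (v s * psi s)%:E)%E by rewrite lee_fin mulr_ge0.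
    rewrite -(ge0_integralZl_EFin (@lebesgue_measure R) mI vp0 mvp c0).
    under eq_integral do rewrite -EFinM.
    apply: (@Av_le_ker _ n r t F (fun s => 2 ^+ n.+1 * (v s * psi s))) => //.
      by move=> s; apply: mulr_ge0 => //; exact: mulr_ge0.
    move=> s /andP[s1 s2].
    have s0 : 0 < s by exact: le_lt_trans s1.
    have Ss : S s by rewrite /= in_itv /= s0 /=; clear -r2 t2 s2; lra.
    split; first by split => //=; rewrite (le_trans (deltaE r t Et))// ltW.
    have -> : 2 ^+ n.+1 * (v s * psi s) = F s * (2 * s) ^+ n.+1.
      rewrite /v gtr0_norm// (@exprMn _ n.+1 2 s) -!mulrA mulVf ?gt_eqF ?psi_gt0//; ring.
    by rewrite ler_wpM2l//; apply: ker_le2 => //; [exact: ltW|rewrite s1 s2].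
  have Av0 := @Av_ge0 R n.+3 r t F F0.
  have eX0 : 0 <= eta * X r by rewrite mulr_ge0// ltW.
  apply: (@le_trans _ _ (poweR (M * (eta * X r))%:E q)).
    apply: gt0_ler_poweR => //; rewrite in_itv /= ?Av0 ?leey// lee_fin.
    by rewrite andbT; apply: mulr_ge0.
  rewrite poweR_EFin (@powRM _ M (eta * X r))// (@powRM _ eta (X r)) ?(ltW eta0) ?(ltW X0)//.
  rewrite /P0 -Bfin// -EFinD -EFinM lee_fin /K -!mulrA ler_wpM2l ?powR_ge0//.
  apply: (@le_trans _ _ (2 `^ (q / p - 1) * th * X r `^ q)).
    by rewrite ler_wpM2r ?powR_ge0// powR_powR_le// ltW.
  rewrite le_eqVlt; apply/orP; left; apply/eqP; rewrite -mulrA; congr (_ * _).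
  have -> : X r `^ q = X r `^ (q - 1) * X r.
    rewrite -{3}(powRr1 (ltW X0)) -powRD; last by rewrite (gt_eqF X0) implybT.
    by rewrite subrK.
  by rewrite /th; field; rewrite gt_eqF.
have mD : measurable D by exact: measurable_itv.
have mXm : measurable_fun setT (fun r : R => (r ^+ m)%:E).
  by apply/measurable_EFinP; apply: measurable_funX.
have mDZ : measurable (D `\` Z) by exact: measurableD.
apply: (@le_trans _ _ (\int[mu]_(r in D `\` Z) ((P0 r + P1 r) * (r ^+ m)%:E))%E).
  rewrite le_eqVlt; apply/orP; left; apply/eqP; apply: ge0_negligible_integral => //.
    by apply: measurable_funTS; apply: emeasurable_funM => //; exact: emeasurable_funD.
  move=> r; rewrite /= in_itv /= => /andP[r1 _]; apply: mule_ge0; first exact: adde_ge0.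
  by rewrite lee_fin exprn_ge0//; lra.
pose T1 r := ((X r `^ (q - 1))%:E * B r)%E.
have T10 r : (0 <= T1 r)%E by apply: mule_ge0; rewrite ?lee_fin ?powR_ge0.
have mXqE : measurable_fun setT (fun r => (X r `^ (q - 1))%:E) by apply/measurable_EFinP.
have mT1 : measurable_fun setT T1 by exact: emeasurable_funM.
have T1E r : T1 r = (\int[mu]_(s in S) ((X r `^ (q - 1))%:E * G (r, s)))%E.
  rewrite ge0_integralZl_EFin ?powR_ge0//; first by rewrite -BE.
  by apply: measurable_funTS; exact: (measurableT_comp mG).
have Xq0 r : (0 <= (X r `^ (q - 1))%:E)%E by rewrite lee_fin powR_ge0.
have c0 : 0 <= K * 3 ^+ m by apply: mulr_ge0 => //; exact: exprn_ge0.
apply: (@le_trans _ _ (\int[mu]_(r in D `\` Z) ((K * 3 ^+ m)%:E * (T1 r + (X r `^ (q - 1))%:E)))%E).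
  apply: ge0_le_integral_nomeas => r [Dr Zr].
    move: Dr; rewrite /= in_itv /= => /andP[r1 _]; apply: mule_ge0; first exact: adde_ge0.
    by rewrite lee_fin exprn_ge0//; clear -r1; lra.
  rewrite /P1 patchE memNset// adde0 /P0 /T1 -Bfin//.
  rewrite -[leLHS]/((K * X r `^ (q - 1) * (fine (B r) + 1) * r ^+ m)%:E).
  rewrite -[leRHS]/((K * 3 ^+ m * (X r `^ (q - 1) * fine (B r) + X r `^ (q - 1)))%:E) lee_fin.
  have fB0 : 0 <= fine (B r) by rewrite -lee_fin Bfin.
  have /andP[r1 r2] : 2^-1 < r < 3 by move: Dr; rewrite /= in_itv.
  have hpow : r ^+ m <= 3 ^+ m by rewrite lerXn2r ?nnegrE//; clear -r1 r2; lra.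
  have a0 : 0 <= K * X r `^ (q - 1) * (fine (B r) + 1).
    by apply: mulr_ge0; [apply: mulr_ge0 => //; exact: powR_ge0|clear -fB0; lra].
  apply: (le_trans (ler_wpM2l a0 hpow)).
  by rewrite le_eqVlt; apply/orP; left; apply/eqP; ring.
rewrite ge0_integralZl_EFin//; last 2 first.
- by move=> r _; rewrite adde_ge0.
- by apply: measurable_funTS; exact: emeasurable_funD.
rewrite [leRHS]EFinM; apply: lee_wpmul2l; first by rewrite lee_fin.
rewrite ge0_integralD//; last 2 first.
- exact: measurable_funTS.
- exact: measurable_funTS.
rewrite EFinD; apply: leeD; last first.
  have -> : A'%:E = (A' / 1)%:E by rewrite divr1.
  apply: le_trans (moment 1 ltr01).
  apply: ge0_le_integral_sub => // r [Dr Zr]; split => //; split => //=.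
  exact: X1.
pose H (x : R * R) := ((X x.1 `^ (q - 1))%:E * G x)%E.
have mH : measurable_fun setT H.
  by apply: emeasurable_funM => //; exact: (measurableT_comp mXqE).
have H0 x : (0 <= H x)%E by apply: mule_ge0; [exact: Xq0|exact: G0].
have -> : (\int[mu]_(r in D `\` Z) T1 r = \int[mu]_(r in D `\` Z) \int[mu]_(s in S) H (r, s))%E.
  by apply: eq_integral => r _; rewrite T1E.
rewrite (tonelliR mDZ mS mH H0).
have mw' : measurable_fun (`]0%R, +oo[%classic : set R) (fun s => (F s `^ p * s ^+ m)%:E).
  by apply/measurable_EFinP; apply: measurable_funTS; apply: measurable_funM => //; exact: measurable_funX.
have w0' s : (`]0%R, +oo[%classic : set R) s -> (0 <= (F s `^ p * s ^+ m)%:E)%E.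
  by rewrite /= in_itv /= andbT => s0; rewrite lee_fin mulr_ge0 ?powR_ge0// exprn_ge0// ltW.
apply: (@le_trans _ _ (A'%:E * wint m p F)%E); last first.
  by rewrite -[leRHS]mule1; apply: lee_wpmul2l; rewrite ?lee_fin.
rewrite /wint -(ge0_integralZl_EFin (@lebesgue_measure R) mp w0' mw' A'0).
apply: ge0_le_integral_sub => [s _|s h|s Ss].
- by apply: integral_ge0.
- by apply: mule_ge0; [rewrite lee_fin|exact: w0' h].
have /andP[s0 s5] : 0 < s < 5 by move: (Ss); rewrite /= in_itv.
split; first by rewrite /= in_itv /= s0.
have Ys := Y1 s Ss.
have Ys0 : 0 < Y s by exact: lt_le_trans Ys.
have mDs : measurable (D `&` [set r | Y s <= X r]).
  apply: measurableI => //; rewrite -[X in measurable X]setTI.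
  rewrite (_ : [set _ | _] = X @^-1` `[Y s, +oo[%classic); last first.
    by apply/seteqP; split => r /=; rewrite in_itv /= andbT.
  by apply: mX => //; exact: measurable_itv.
apply: (@le_trans _ _ ((w s)%:E * \int[mu]_(r in D `&` [set r | (Y s <= X r)%R]) (X r `^ (q - 1))%:E)%E).
  have -> : ((w s)%:E * \int[mu]_(r in D `&` [set r | (Y s <= X r)%R]) (X r `^ (q - 1))%:E =
      \int[mu]_(r in D `&` [set r | (Y s <= X r)%R]) ((w s)%:E * (X r `^ (q - 1))%:E))%E.
    by rewrite ge0_integralZl_EFin//; exact: measurable_funTS.
  rewrite integral_mkcond [leRHS]integral_mkcond; apply: ge0_le_integral_nomeas => r _.
    by apply: erestrict_ge0.
  rewrite !patchE; case: ifPn => [/set_mem [Dr Zr]|_]; last first.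
    by case: ifPn => // _; apply: mule_ge0; rewrite lee_fin ?powR_ge0 ?w0.
  rewrite /H /G /=; have [h|_] := boolP (delta r <= s); last first.
    rewrite mul0r mule0; case: ifPn => // _.
    by apply: mule_ge0; rewrite lee_fin ?powR_ge0 ?w0.
  by rewrite mem_set; [rewrite mul1r muleC|split => //=; exact: H3].
apply: (le_trans (lee_wpmul2l _ (moment _ Ys0))); first by rewrite lee_fin.
rewrite -!EFinM lee_fin le_eqVlt; apply/orP; left; apply/eqP.
by rewrite /w gtr0_norm//; field; rewrite gt_eqF.
Qed.

End middle_region.

(** * Covering numbers and neighborhoods of [E] *)

Section covering.
Context {R : realType}.
Implicit Types (E : set R) (a s r t : R).

Definition cdist E r : R := inf [set `|r - t| | t in E].

Lemma cdist_ge0 E r : E !=set0 -> 0 <= cdist E r.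
Proof.
move=> [t0 Et0]; apply: lb_le_inf; first by exists `|r - t0|, t0.
by move=> _ [t _ <-].
Qed.

Lemma cdist_le E r t : E t -> cdist E r <= `|r - t|.
Proof.
by move=> Et; apply: ge_inf; [exists 0 => _ [u _ <-]|exists t].
Qed.

Lemma cdist_lt E r s : E !=set0 -> cdist E r < s -> exists2 t, E t & `|r - t| < s.
Proof.
move=> [t0 Et0] h; have [|_ [t Et <-] ts] := inf_lt _ h; first by exists `|r - t0|, t0.
by exists t.
Qed.

Lemma measurable_cdist E : E !=set0 -> measurable_fun setT (cdist E).
Proof.
move=> E0; apply: (measurability _ (RGenInftyO.measurableE R)) => //.
move=> _ [_ [x ->] <-]; rewrite setTI.
rewrite (_ : _ @^-1` _ = \bigcup_(t in E) (`]t - x, t + x[%classic : set R)).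
  apply: open_measurable; apply: bigcup_open => t _; exact: interval_open.
apply/seteqP; split => r /=; rewrite in_itv /=.
  by move=> /(cdist_lt E0)[t Et h]; exists t => //=; rewrite in_itv /=; move: h;
    rewrite ltr_norml => /andP[? ?]; apply/andP; split; lra.
move=> [t Et]; rewrite /= in_itv /= => /andP[h1 h2].
by apply: (le_lt_trans (cdist_le r Et)); rewrite ltr_norml; apply/andP; split; lra.
Qed.

Lemma measurable_cdist_le E s : E !=set0 -> measurable [set r | cdist E r <= s].
Proof.
move=> E0; rewrite -[X in measurable X]setTI (_ : [set _ | _] = cdist E @^-1` `]-oo, s]%classic).
  by apply: (measurable_cdist E0) => //; exact: measurable_itv.
by apply/seteqP; split => r /=; rewrite in_itv.
Qed.

Lemma covers_exists E a : E `<=` `[1, 2] -> 0 < a -> exists2 k, covers E a k & k%:R <= 1 + a^-1.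
Proof.
move=> hE a0; exists (Num.truncn a^-1).+1; last first.
  by rewrite -natr1 addrC lerD2l truncn_le// invr_ge0 ltW.
exists (fun i => 1 + i%:R * a) => t /hE; rewrite /= in_itv /= => /andP[t1 t2].
have u0 : 0 <= (t - 1) / a by rewrite divr_ge0 ?(ltW a0)//; lra.
have i_lt : (Num.truncn ((t - 1) / a) < (Num.truncn a^-1).+1)%N.
  rewrite ltnS; apply: le_truncn; rewrite -[leRHS]mul1r ler_pM2r ?invr_gt0//; lra.
exists (Ordinal i_lt) => //=; rewrite in_itv /=.
have /andP[h1 h2] := truncn_itv u0.
move: h1 h2; rewrite ler_pdivlMr// ltr_pdivrMr// -(natr1 (Num.truncn _)). move: (Num.truncn _) => k; rewrite mulrDl mul1r => h1 h2.
by apply/andP; split; lra.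
Qed.

(** A uniform grid shows that finite covers exist, so the infimum is over a nonempty set of naturals
    and is a minimum. *)
Lemma Ncov_attained E a : E `<=` `[1, 2] -> 0 < a ->
  exists2 k, covers E a k & Ncov E a = k%:R /\ forall j, covers E a j -> (k <= j)%N.
Proof.
move=> hE a0; have [k0 hk0 _] := covers_exists hE a0.
have ex : exists k, `[< covers E a k >] by exists k0; apply/asboolP.
case: (ex_minnP ex) => k /asboolP hk kmin.
exists k => //; split; last by move=> j hj; apply: kmin; apply/asboolP.
apply/eqP; rewrite eq_le; apply/andP; split.
  by apply: ge_inf; [exists 0 => _ [j _ <-]; exact: ler0n|exists k].
apply: lb_le_inf; first by exists k%:R, k.
by move=> _ [j hj <-]; rewrite ler_nat; apply: kmin; apply/asboolP.
Qed.

Lemma Ncov_ge0 E a : E `<=` `[1, 2] -> 0 < a -> 0 <= Ncov E a.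
Proof. by move=> hE a0; have [k _ [-> _]] := Ncov_attained hE a0. Qed.

Lemma Ncov_ge1 E a : E `<=` `[1, 2] -> E !=set0 -> 0 < a -> 1 <= Ncov E a.
Proof.
move=> hE [t Et] a0; have [k [c hc] [-> _]] := Ncov_attained hE a0.
have [i _ _] := hc _ Et; rewrite ler1n.
exact: (leq_ltn_trans (leq0n i) (ltn_ord i)).
Qed.

Lemma Ncov_le E a : E `<=` `[1, 2] -> 0 < a -> Ncov E a <= 1 + a^-1.
Proof.
move=> hE a0; have [k [c hc] [-> h]] := Ncov_attained hE a0.
have [j hj jle] := covers_exists hE a0.
by apply: le_trans jle; rewrite ler_nat h.
Qed.

Lemma measure_cover_le n (c : 'I_n -> R) (x y : R) (A : set R) : x <= y -> measurable A ->
  A `<=` \bigcup_(i in setT) `[c i + x, c i + y]%classic -> (mu A <= (n%:R * (y - x))%:E)%E.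
Proof.
move=> xy mA hA; case: n => [|n] in c hA *.
  rewrite (_ : A = set0) ?measure0 ?mul0r//.
  by apply/seteqP; split => // r /hA[[]].
pose F (k : nat) := (`[c (inord k) + x, c (inord k) + y]%classic : set R).
have mF k : measurable (F k) by exact: measurable_itv.
have AF : A `<=` \big[setU/set0]_(i < n.+1) F i.
  move=> r /hA[i _ ri]; rewrite -bigcup_mkord; exists (i : nat); first exact: ltn_ord.
  by rewrite /F inord_val.
have mU : measurable (\big[setU/set0]_(i < n.+1) F i) by apply: bigsetU_measurable.
have := le_measure (@lebesgue_measure R) (mem_set mA) (mem_set mU) AF.
move=> h; apply: (le_trans h).
apply: (le_trans (@Boole_inequality _ _ _ (@lebesgue_measure R) F n.+1 (fun i _ => mF i))).
rewrite (eq_bigr (fun=> (y - x)%:E)).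
  by rewrite sumEFin sumr_const card_ord -[(_ *+ _)]mulr_natl.
move=> i _; rewrite /= lebesgue_measure_itv /= lte_fin ltrD2l.
case: ltP => h'; first by rewrite -EFinB; congr (_%:E); ring.
by congr (_%:E); apply/esym/eqP; rewrite subr_eq0 eq_le h'.
Qed.

(** The distance to [E] may not be attained, so a point at distance at most s is only within 2 s of
    some t in [E]. Enlarging each covering interval of length s by 2 s on both sides gives the
    factor 5. *)
Lemma measure_neighborhood_le E s (A : set R) : E `<=` `[1, 2] -> E !=set0 -> 0 < s -> measurable A ->
  A `<=` [set r | cdist E r <= s] -> (mu A <= (5 * (s * Ncov E s))%:E)%E.
Proof.
move=> hE E0 s0 mA hA; have [k [c hc] [-> _]] := Ncov_attained hE s0.
rewrite (_ : 5 * _ = k%:R * (3 * s - (- (2 * s)))); last by ring.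
apply: (@measure_cover_le _ c) => //; first lra.
move=> r /hA /= h; have [t Et] := @cdist_lt E r (2 * s) E0 ltac:(lra).
have [i _] := hc _ Et; rewrite /= in_itv /= => /andP[h1 h2].
rewrite ltr_norml => /andP[h3 h4].
by exists i => //=; rewrite in_itv /=; apply/andP; split; lra.
Qed.

Local Notation S := (`]0%R, 5%R[%classic : set R).
Local Notation D := (`]2^-1%R, 3%R[%classic : set R).

(** Takes X = Y o [cdist E]. The superlevel set of X at u lies in the s-neighborhood of [E] for the
    s attached to u, so the weak bound becomes a bound on s N(E,s). The end 5 of [S] exceeds r + t
    for all r in [D] and t in [E]. *)
Lemma region_mid_cov n (p q A C1 u0 : R) E (Y psi : R -> R) :
  1 <= p -> p <= q -> E `<=` `[1, 2] -> E !=set0 -> 0 <= A -> 0 <= C1 -> 1 <= u0 ->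
  measurable_fun setT Y -> measurable_fun setT psi ->
  (forall s, 0 <= psi s) -> (forall s, S s -> 0 < psi s) ->
  (forall s, 0 <= Y s) -> (forall s, S s -> 1 <= Y s) ->
  (forall x y, 0 < x -> x <= y -> y < 5 -> Y y <= Y x) ->
  (forall s, S s -> (s ^+ n.+1 / psi s) `^ p * psi s <= C1 * (s ^+ n.+2 * Y s)) ->
  (forall x, S x -> (\int[mu]_(s in `[x, 5%R[) (psi s)%:E <= (Y x)%:E)%E) ->
  (forall u, u0 < u -> exists s, [/\ 0 < s, forall x, S x -> u <= Y x -> x <= s &
      s * Ncov E s <= A * u `^ (- q)]) ->
  region_bound n p q E D.
Proof.
move=> p1 pq hE E0 A0 C10 u01 mY mpsi psi0 psi_gt0 Y0 Y1 Yanti H1 H2 T.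
have q1 : 1 <= q by exact: le_trans pq.
have q0 : 0 < q by exact: lt_le_trans q1.
have u00 : 0 < u0 by exact: lt_le_trans u01.
pose Z := [set r | cdist E r = 0].
have md := measurable_cdist E0.
have mle (s : R) := @measurable_cdist_le E s E0.
have mZ : measurable Z.
  rewrite (_ : Z = [set r | cdist E r <= 0]) //.
  apply/seteqP; split => r /=; rewrite /Z /=; first by move->.
  by move=> h; apply/eqP; rewrite eq_le h cdist_ge0.
(* The value 1 on [Z] is a default; no estimate is asked for there. *)
pose X r := if 0 < cdist E r then Y (cdist E r) else 1.
have mX : measurable_fun setT X.
  apply: measurable_fun_ifT => //; last by apply: (measurableT_comp mY).
  exact: measurable_fun_ltr.
have cd5 r : D r -> cdist E r < 5.
  rewrite /= in_itv /= => /andP[r1 r2]; have [t Et] := E0.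
  move: (hE _ Et); rewrite /= in_itv /= => /andP[t1 t2].
  by apply: (le_lt_trans (cdist_le r Et)); rewrite ltr_norml; apply/andP; split; lra.
have cd_gt0 r : ~ Z r -> 0 < cdist E r.
  by move=> h; rewrite lt_neqAle cdist_ge0// andbT eq_sym; apply/eqP.
have mDu u : measurable (D `&` [set r | u <= X r]).
  apply: measurableI; first exact: measurable_itv.
  rewrite -[X in measurable X]setTI (_ : [set _ | _] = X @^-1` `[u, +oo[%classic).
    by apply: mX => //; exact: measurable_itv.
  by apply/seteqP; split => r /=; rewrite in_itv /= andbT.
have tail0 : mu Z = 0%E.
  apply/eqP; rewrite eq_le measure_ge0 andbT; apply/lee_addgt0Pr => e e0; rewrite add0e.
  (* Large enough that 5 A u^(-q) <= e; letting e tend to 0, [Z] is null. *)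
  pose u := u0 + (5 * A / e) `^ q^-1 + 1.
  have pw0 : 0 <= (5 * A / e) `^ q^-1 by exact: powR_ge0.
  have u_gt : u0 < u by rewrite /u; lra.
  have [s [s0 _ sN]] := T u u_gt.
  have Zs : Z `<=` [set r | cdist E r <= s] by move=> r /= ->; exact: ltW.
  apply: (le_trans (measure_neighborhood_le hE E0 s0 mZ Zs)); rewrite lee_fin.
  have uq0 : 0 < u `^ q by rewrite powR_gt0//; lra.
  apply: (le_trans (ler_wpM2l (ler0n R 5) sN)); rewrite powRN mulrA ler_pdivrMr// [leRHS]mulrC -(ler_pdivrMr _ _ e0).
  have -> : 5 * A / e = ((5 * A / e) `^ q^-1) `^ q.
    by rewrite powR_VK ?gt_eqF//; rewrite divr_ge0 ?mulr_ge0// ltW.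
  by rewrite ler_powR2 ?(ltW q0)// /u; lra.
apply: (@region_mid _ n p q (5 * A + 3 * u0 `^ q) C1 E Z (cdist E) X Y psi) => //.
- by rewrite addr_ge0 ?mulr_ge0 ?powR_ge0.
- by move=> r t; exact: cdist_le.
- move=> r Dr Zr; have c0 := cd_gt0 r Zr; rewrite /X c0.
  apply: le_trans (H2 (cdist E r) _); last by rewrite /= in_itv /= c0 cd5.
  apply: ge0_le_integral_sub => [s _|s _|s [Ss /= h]]; rewrite ?lee_fin//.
  by split=> //; move: Ss; rewrite /= !in_itv /= h => /andP[].
- move=> r s Dr Zr Ss h; have c0 := cd_gt0 r Zr; rewrite /X c0.
  by apply: Yanti => //; move: Ss; rewrite /= in_itv /= => /andP[].
- move=> r Dr Zr; have c0 := cd_gt0 r Zr; rewrite /X c0.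
  by apply: Y1; rewrite /= in_itv /= c0 cd5.
(* For u <= u0 the bound is trivial, as [D] has measure below 3 and (u0 / u)^q >= 1; hence the
   summand 3 u0^q of the constant. *)
- move=> u u_gt0; have [uu0|u_gt] := leP u u0.
    apply: (@le_trans _ _ (mu D)).
      have mD : measurable D by exact: measurable_itv.
      by apply: (le_measure (@lebesgue_measure R) (mem_set (mDu u)) (mem_set mD)); exact: subIsetl.
    rewrite lebesgue_measure_itv /= lte_fin ifT; last lra.
    rewrite -EFinB lee_fin.
    apply: (@le_trans _ _ 3); first lra.
    have uq : 1 <= u0 `^ q * u `^ (- q).
      have uq0 : 0 < u `^ q by rewrite powR_gt0//.
      by rewrite powRN ler_pdivlMr// mul1r ler_powR2// ltW.
    have := powR_ge0 u (- q).
    by move=> h; rewrite mulrDl -[3 * _ * _]mulrA; nra.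
  have [s [s0 hs sN]] := T u u_gt.
  apply: (le_trans (measure_neighborhood_le hE E0 s0 (mDu u) _)).
    move=> r [Dr /=]; rewrite /X; case: ifPn => [c0|_]; last by move=> h; exfalso; lra.
    by apply: hs; rewrite /= in_itv /= c0 cd5.
  rewrite lee_fin; apply: (le_trans (ler_wpM2l (ler0n R 5) sN)).
  by rewrite mulrA ler_wpM2r ?powR_ge0// lerDl mulr_ge0// powR_ge0.
Qed.

End covering.

(** * The power weight and the logarithmic weight *)

Section weights.
Context {R : realType}.
Local Notation S := (`]0%R, 5%R[%classic : set R).
Local Notation D := (`]2^-1%R, 3%R[%classic : set R).

Lemma integral_decreasing_primitive (Y psi : R -> R) (a b c : R) : a < b -> b < c -> 0 < a ->
  (forall x, 0 < x < c -> is_derive x 1 Y (- psi x)) ->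
  (forall x, 0 < x < c -> derivable psi x 1) ->
  (forall x, 0 <= psi x) -> 0 <= Y b ->
  (\int[mu]_(x in `[a, b[) (psi x)%:E <= (Y a)%:E)%E.
Proof.
move=> ab bc a0 dY dpsi psi0 Yb0.
apply: (@le_trans _ _ (\int[mu]_(x in `[a, b]) (psi x)%:E)%E).
  apply: ge0_le_integral_sub => x; rewrite ?lee_fin// /= !in_itv /=.
  by move=> /andP[h1 h2]; rewrite h1 ltW.
have cY x : 0 < x < c -> {for x, continuous Y}.
  move=> hx; apply/differentiable_continuous/derivable1_diffP.
  by have := dY x hx; case.
have ha : 0 < a < c by rewrite a0 (lt_trans ab).
have hb : 0 < b < c by rewrite bc (lt_trans a0).
rewrite (@continuous_FTC2 _ psi (fun x => - Y x) a b ab); last 3 first.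
- apply: derivable_within_continuous => x; rewrite in_itv /= => /andP[x1 x2].
  by apply: dpsi; rewrite (lt_le_trans a0 x1) (le_lt_trans x2 bc).
- split.
  + move=> x; rewrite in_itv /= => /andP[x1 x2].
    apply: derivableN; have := dY x; rewrite (lt_trans a0 x1) (lt_trans x2 bc) => /(_ isT).
    by case.
  + by apply: cvgN; apply: cvg_at_right_filter; exact: cY.
  + by apply: cvgN; apply: cvg_at_left_filter; exact: cY.
- move=> x; rewrite in_itv /= => /andP[x1 x2].
  have := dY x; rewrite (lt_trans a0 x1) (lt_trans x2 bc) => /(_ isT) [d1 d2].
  by rewrite derive1E deriveN// d2 opprK.
by rewrite -EFinB lee_fin; lra.
Qed.

Lemma expR_powR (x a : R) : expR x `^ a = expR (a * x).
Proof. by rewrite powR_expR ?expR_gt0// expRK. Qed.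

Lemma expR_exprn (x : R) k : expR x ^+ k = expR (k%:R * x).
Proof. by rewrite -powR_mulrn ?expR_ge0// expR_powR. Qed.

(** The weight is Y(x) = (x/5)^(-g) with g = (1 - b') / q, normalized to be at least 1 on [S], and
    psi = -Y'. All quantities are written as exponentials, which makes the inequalities linear in
    logarithms. *)
Lemma region_mid_power n (p q b' C : R) (E : set R) : 1 <= p -> p <= q ->
  E `<=` `[1, 2] -> E !=set0 -> 0 <= C -> b' < 1 ->
  0 <= n.+2%:R - n.+3%:R / p + (1 - b') / q ->
  (forall s, 0 < s < 1 -> Ncov E s <= C * s `^ (- b')) ->
  region_bound n p q E D.
Proof.
move=> p1 pq hE E0 C0 b'1 hexp hN.
have p0 : 0 < p by exact: lt_le_trans p1.
have q1 : 1 <= q by exact: le_trans pq.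
have q0 : 0 < q by exact: lt_le_trans q1.
pose g := (1 - b') / q.
have gE : (1 - b') / q = g by [].
have g0 : 0 < g by rewrite divr_gt0// subr_gt0.
clearbody g; rewrite gE in hexp.
have gq : 1 - b' = q * g by rewrite -gE; field; rewrite gt_eqF.
pose k : R := g * ln 5.
have ln5 : 0 < ln 5 :> R by rewrite ln_gt0// ltr1n.
pose w := k + ln g.
have gw : g = expR (ln g) by rewrite lnK.
pose Y (x : R) := expR k * x `^ (- g).
pose psi (x : R) := expR w * x `^ (- g - 1).
have psi0 x : 0 <= psi x by rewrite mulr_ge0 ?powR_ge0 ?expR_ge0.
have Y0 x : 0 <= Y x by rewrite mulr_ge0 ?powR_ge0 ?expR_ge0.
have YE x : 0 < x -> Y x = expR (k - g * ln x).
  by move=> x0; rewrite /Y powR_expR// -expRD mulNr.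
have psiE x : 0 < x -> psi x = expR (w - (g + 1) * ln x).
  by move=> x0; rewrite /psi powR_expR// -expRD; congr expR; ring.
(* The inequality for v^p psi compares two powers of s whose exponents differ by p e; it therefore
   holds near 0 because e >= 0. *)
pose e := n.+2%:R - n.+3%:R / p + g.
have e0 : 0 <= e by [].
have pe : p * e = p * (n.+2%:R + g) - n.+3%:R by rewrite /e; field; rewrite gt_eqF.
clearbody e.
(* The logarithm of the quotient of the two sides is (1 - p) w - k + p e ln s, and ln s <= ln 5. *)
pose M := (1 - p) * w - k + p * e * ln 5.
apply: (@region_mid_cov _ n p q (C * expR ((1 - b') * ln 5)) (expR M) (expR k) E Y psi) => //.
- by rewrite mulr_ge0 ?expR_ge0.
- by rewrite -[leLHS]expR0 ler_expR mulr_ge0 ?(ltW g0) ?(ltW ln5).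
- by apply: measurable_funM => //; exact: measurable_powR.
- by apply: measurable_funM => //; exact: measurable_powR.
- move=> s; rewrite /= in_itv /= => /andP[s0 _].
  by rewrite psiE// expR_gt0.
- move=> s; rewrite /= in_itv /= => /andP[s0 s5].
  rewrite YE// -[leLHS]expR0 ler_expR /k -mulrBr mulr_ge0 ?(ltW g0)// subr_ge0 ler_ln ?posrE//.
  exact: ltW.
- move=> x y x0 xy y5; have y0 : 0 < y by exact: lt_le_trans xy.
  by rewrite !YE// ler_expR lerD2l lerN2 ler_wpM2l ?(ltW g0)// ler_ln ?posrE.
- move=> s; rewrite /= in_itv /= => /andP[s0 s5].
  rewrite psiE// YE//.
  have -> : s ^+ n.+1 = expR (n.+1%:R * ln s) by rewrite -expR_exprn lnK.
  have -> : s ^+ n.+2 = expR (n.+2%:R * ln s) by rewrite -expR_exprn lnK.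
  rewrite -expRN -expRD expR_powR -!expRD ler_expR.
  have lns : ln s <= ln 5 by rewrite ler_ln ?posrE// ltW.
  have pe0 : 0 <= p * e by rewrite mulr_ge0// ltW.
  have := ler_wpM2l pe0 lns.
  rewrite /M pe -!natr1; nra.
- move=> x; rewrite /= in_itv /= => /andP[x0 x5].
  apply: (@integral_decreasing_primitive Y psi x 5 6 x5 _ x0 _ _ psi0 (Y0 5)); first lra.
  + move=> y /andP[y0 _].
    have := is_derive1_powR (- g) y0 => h.
    have -> : - psi y = expR k *: (- g * y `^ (- g - 1)).
      by rewrite /psi /w expRD lnK//; rewrite /GRing.scale /=; ring.
    exact: is_deriveZ.
  + move=> y /andP[y0 _].
    have := is_derive1_powR (- g - 1) y0 => h.
    have h2 : is_derive y 1 psi (expR w *: ((- g - 1) * y `^ (- g - 1 - 1))) by exact: is_deriveZ.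
    by case: h2.
- move=> u cu; have u0 : 0 < u by apply: (lt_trans _ cu); exact: expR_gt0.
  have lu : k < ln u by rewrite -[ltLHS]expRK ltr_ln ?posrE// expR_gt0.
  (* The level set Y = u is the point s = 5 u^(-1/g), and s^(1-b') = 5^(1-b') u^(-q). *)
  pose l := ln 5 - ln u / g.
  have l0 : l < 0 by rewrite /l subr_lt0 ltr_pdivlMr// mulrC.
  exists (expR l); split.
  + exact: expR_gt0.
  + move=> x; rewrite /= in_itv /= => /andP[x0 x5]; rewrite YE//.
    rewrite -{1}[u]lnK ?posrE// ler_expR => h.
    rewrite -[x]lnK ?posrE// ler_expR /l lerBrDr -lerBrDl.
    by rewrite ler_pdivrMr// mulrBl; move: h; rewrite /k; lra.
  + have s01 : 0 < expR l < 1 by rewrite expR_gt0 -[ltRHS]expR0 ltr_expR.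
    apply: (le_trans (ler_wpM2l (expR_ge0 l) (hN _ s01))).
    rewrite expR_powR mulrCA -expRD powR_expR// -mulrA -expRD ler_wpM2l// ler_expR le_eqVlt.
    apply/orP; left; apply/eqP; rewrite gq /l.
    have -> : b' = 1 - q * g by rewrite -gq; ring.
    by field; rewrite gt_eqF.
Qed.

End weights.

Section log_weight.
Context {R : realType}.
Local Notation S := (`]0%R, 5%R[%classic : set R).
Local Notation D := (`]2^-1%R, 3%R[%classic : set R).

(** At p = d/(d-1) the exponent n + 2 - (n + 3)/p vanishes, so for covering exponent 1 the power
    weight degenerates to a constant. With Y = L^a and psi = -Y' = a L^(a-1) / x, powers of x
    balance and those of L require (p - 1)(1 - a) = a, that is a = 1/d; the comparison of v^p psi
    with F^p s^(n+2) Y is then an equality up to a constant. *)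
Lemma region_mid_log n (q C : R) (E : set R) (p := n.+3%:R / n.+2%:R : R) : p <= q ->
  E `<=` `[1, 2] -> E !=set0 -> 0 <= C ->
  (forall s, 0 < s < 1 -> ln s^-1 `^ (q / n.+3%:R) * s * Ncov E s <= C) ->
  region_bound n p q E D.
Proof.
move=> pq hE E0 C0 hN.
pose d : R := n.+3%:R.
have d3 : 3 <= d by rewrite ler_nat.
have pE : p = d / (d - 1).
  by rewrite /p /d; congr (_ / _); rewrite -(natr1 n.+2); ring.
have p1 : 1 <= p by rewrite pE ler_pdivlMr; lra.
have q1 : 1 <= q by exact: le_trans pq.
have q0 : 0 < q by exact: lt_le_trans q1.
have d0 : 0 < d by lra.
have nE : n%:R = d - 3 :> R by rewrite /d -!natr1; ring.
have ln5 : 0 < ln 5 :> R by rewrite ln_gt0// ltr1n.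
pose a := d^-1.
have ad : a * d = 1 by rewrite /a mulVf// gt_eqF.
have a0 : 0 < a by rewrite invr_gt0.
(* The shift by 1 + ln 5 makes L exceed 1 on all of [S]. *)
pose L (x : R) := 1 + ln 5 - ln x.
have mL : measurable_fun setT L by apply: measurable_funB => //; exact: measurable_ln.
pose Y x := L x `^ a.
pose psi x := a * L x `^ (a - 1) * x `^ (-1).
have mY : measurable_fun setT Y by apply: (measurableT_comp (@measurable_powR R a)).
have mpsi : measurable_fun setT psi.
  apply: measurable_funM; last exact: measurable_powR.
  by apply: measurable_funM => //; apply: (measurableT_comp (@measurable_powR R (a - 1))).
have psi0 x : 0 <= psi x by rewrite !mulr_ge0 ?powR_ge0// ltW.
have Y0 x : 0 <= Y x by exact: powR_ge0.
have L6 x : 0 < x < 6 -> 0 < L x.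
  move=> /andP[x0 x6]; rewrite /L subr_gt0 -ltr_expR expRD !lnK ?posrE//.
  have := @expR_ge1Dx R 1; lra.
have L1 x : S x -> 1 < L x.
  rewrite /= in_itv /= => /andP[x0 x5]; rewrite /L -addrA ltrDl subr_gt0 ltr_ln ?posrE//.
have YE x : 0 < L x -> Y x = expR (a * ln (L x)) by move=> h; rewrite /Y powR_expR.
have psiE x : 0 < x -> 0 < L x -> psi x = expR (ln a + (a - 1) * ln (L x) - ln x).
  move=> x0 h; rewrite /psi !powR_expR// !expRD lnK ?posrE// mulN1r//.
have aE : a = d^-1 by [].
clearbody a.
pose M := - (p - 1) * ln a.
(* The level Y = u is at ln s = 1 + ln 5 - u^d. For u > u0 the shift is at most half of u^d, so
   ln(1/s) >= u^d / 2 and the hypothesis on N(E,s) gives u^(-q). *)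
pose u0 := (2 * (1 + ln 5)) `^ a.
apply: (@region_mid_cov _ n p q (C * 2 `^ (q * a)) (expR M) u0 E Y psi) => //.
- by rewrite mulr_ge0 ?powR_ge0.
- by rewrite -[leLHS](congr1 (fun f => f a) (@powR1 R)) /u0 ler_powR2 ?(ltW a0)//; lra.
- move=> s Ss; have := L1 s Ss; move: Ss; rewrite /= in_itv /= => /andP[s0 _] L1s.
  by rewrite psiE ?expR_gt0//; lra.
- move=> s Ss; have := L1 s Ss => L1s.
  by rewrite -[leLHS](congr1 (fun f => f a) (@powR1 R)) ler_powR2 ?(ltW a0)// ltW.
- move=> x y x0 xy y5; have y0 : 0 < y by exact: lt_le_trans xy.
  have Ly : 0 < L y by apply: L6; rewrite y0/=; lra.
  by rewrite ler_powR2 ?(ltW a0) ?(ltW Ly)// lerD2l lerN2 ler_ln ?posrE.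
- move=> s Ss; have := L1 s Ss; move: Ss; rewrite /= in_itv /= => /andP[s0 _] L1s.
  have L0 : 0 < L s by lra.
  rewrite psiE// YE//.
  have -> : s ^+ n.+1 = expR (n.+1%:R * ln s) by rewrite -expR_exprn lnK.
  have -> : s ^+ n.+2 = expR (n.+2%:R * ln s) by rewrite -expR_exprn lnK.
  rewrite -expRN -expRD expR_powR -!expRD ler_expR le_eqVlt; apply/orP; left; apply/eqP.
  rewrite /M pE -(natr1 n.+1) -(natr1 n) nE.
  move: (ln (L s)) (ln s) (ln a) => X1 X2 X3; rewrite aE; field.
  by apply/andP; split; rewrite gt_eqF//; lra.
- move=> x; rewrite /= in_itv /= => /andP[x0 x5].
  have dL (y : R) : 0 < y < 6 -> is_derive y (1 : R) L (- y^-1).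
    move=> /andP[y0 _]; have := is_derive1_ln y0 => h.
    by rewrite -[- _]add0r; apply: is_deriveB.
  have := (@integral_decreasing_primitive R Y psi x 5 6 x5 _ x0 _ _ psi0 (Y0 5)).
  apply; first lra.
  + move=> y hy; have y0 : 0 < y by case/andP: hy.
    have := is_derive1_powR a (L6 _ hy) => h.
    have -> : - psi y = a * L y `^ (a - 1) * - y^-1 by rewrite /psi powR_inv1 ?(ltW y0)// mulrN.
    exact: (is_derive1_comp (f := fun x => x `^ a) (g := L) h (dL y hy)).
  + move=> y hy; have y0 : 0 < y by case/andP: hy.
    have h1 := is_derive1_powR (-1) y0.
    have h2 := is_derive1_powR (a - 1) (L6 _ hy).
    have h3 := is_derive1_comp (f := fun x => x `^ (a - 1)) (g := L) h2 (dL y hy).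
    have h4 := is_deriveZ a h3.
    have h5 := is_deriveM h4 h1.
    by case: h5.
- move=> u hu.
  have u00 : 0 < u0 by rewrite powR_gt0; lra.
  have u_gt0 : 0 < u by lra.
  have ud : 2 * (1 + ln 5) <= u `^ d.
    rewrite (_ : 2 * (1 + ln 5) = u0 `^ d); last by rewrite /u0 -powRrM ad powRr1//; lra.
    by rewrite ler_powR2 ?(ltW d0)// ltW.
  pose l := 1 + ln 5 - u `^ d.
  have l0 : l < 0 by rewrite /l; lra.
  exists (expR l); split.
  + exact: expR_gt0.
  + move=> x Sx; have := L1 x Sx; move: Sx; rewrite /= in_itv /= => /andP[x0 x5] L1x h.
    have : u `^ d <= L x.
      have -> : L x = Y x `^ d by rewrite /Y -powRrM ad powRr1//; lra.
      by rewrite ler_powR2 ?(ltW d0)// ltW.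
    by rewrite -{2}[x]lnK ?posrE// ler_expR /l /L; lra.
  + have s01 : 0 < expR l < 1 by rewrite expR_gt0 -[ltRHS]expR0 ltr_expR.
    have := hN _ s01; rewrite -expRN expRK -mulrA.
    have hl : u `^ d / 2 <= - l by rewrite /l; lra.
    have ud0 : 0 < u `^ d by exact: powR_gt0.
    have h0 : 0 < (u `^ d / 2) `^ (q / d) by apply: powR_gt0; lra.
    have h1 : (u `^ d / 2) `^ (q / d) <= (- l) `^ (q / d).
      by rewrite ler_powR2 ?divr_ge0 ?(ltW q0) ?(ltW d0)//; lra.
    have N0 : 0 <= expR l * Ncov E (expR l) by rewrite mulr_ge0 ?expR_ge0// Ncov_ge0// expR_gt0.
    move=> /(le_trans (ler_wpM2r N0 h1)); rewrite -ler_pdivlMl// => h.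
    apply: (le_trans h); rewrite le_eqVlt; apply/orP; left; apply/eqP.
    have -> : (u `^ d / 2) `^ (q / d) = u `^ q / 2 `^ (q * a).
      rewrite powRM ?(ltW ud0) ?invr_ge0// -powRrM -(powR_inv1 (ler0n R 2)) -powRrM mulN1r powRN -aE.
      by congr (_ `^ _ / _); rewrite aE; field; rewrite gt_eqF.
    by rewrite powRN; field; rewrite !gt_eqF ?powR_gt0.
Qed.

End log_weight.

(** * Boundedness of the maximal operator *)

Section upper_bound.
Context {R : realType}.
Local Notation pos := (`]0%R, +oo[%classic : set R).

Definition polar_cst n (c : R) : Prop := 0 < c /\
  forall h : R -> \bar R, measurable_fun setT h -> (forall x, 0 <= h x)%E ->
  iint (fun z : 'rV[R]_n.+1 => h (enorm z)) =
  (c%:E * \int[mu]_(rho in pos) (h rho * (rho ^+ n)%:E))%E.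

Lemma polar_cst_exists n : exists c, polar_cst n c.
Proof.
have [c [c0 hc]] := @radial_cst_exists R n; exists c; split => // h mh h0.
have ms : measurable_fun setT (@Num.sqrt R) by apply: continuous_measurable_fun; exact: sqrt_continuous.
have := hc (h \o Num.sqrt) (measurableT_comp mh ms) (fun x => h0 _).
rewrite /comp => ->; apply: (congr1 (fun u => c%:E * u)%E); apply: eq_integral => x /set_mem.
by rewrite /= in_itv /= andbT => x0; rewrite sqrtr_sqr gtr0_norm.
Qed.

Lemma poweR_KV (x : \bar R) (q : R) : (0 <= x)%E -> q != 0 -> poweR (poweR x q) q^-1 = x.
Proof. by move=> x0 q0; rewrite -poweRrM mulfV// poweRe1. Qed.

Lemma le_poweR (x y : \bar R) (q : R) : 0 <= q -> (0 <= x)%E -> (x <= y)%E -> (poweR x q <= poweR y q)%E.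
Proof.
move=> q0 x0 xy; apply: gt0_ler_poweR => //; rewrite in_itv /= leey ?andbT//.
exact: le_trans xy.
Qed.

Lemma integral_patch_le (D B : set R) (f g : R -> \bar R) :
  (forall x, 0 <= f x)%E -> (forall x, B x -> 0 <= g x)%E ->
  (\int[mu]_(r in D) ((f \_ B) r * g r) <= \int[mu]_(r in B) (f r * g r))%E.
Proof.
move=> f0 g0; rewrite integral_mkcond [leRHS]integral_mkcond.
apply: ge0_le_integral_nomeas => x _; rewrite !patchE.
  case: ifPn => // _; case: ifPn => [/set_mem Bx|_]; last by rewrite mul0e.
  by apply: mule_ge0 => //; exact: g0.
case: ifPn => _; last by case: ifPn => // /set_mem Bx; apply: mule_ge0 => //; exact: g0.
by case: ifPn => _; rewrite ?mul0e.
Qed.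

Lemma region_boundU n (p q : R) (E A B : set R) : measurable A -> measurable B ->
  A `<=` pos -> B `<=` pos ->
  region_bound n p q E A -> region_bound n p q E B -> region_bound n p q E (A `|` B).
Proof.
move=> mA mB Ap Bp [CA hA] [CB hB]; exists (CA + CB) => F mF F0 F1.
have [PA [mPA PA0 PAE PAi]] := hA F mF F0 F1.
have [PB [mPB PB0 PBE PBi]] := hB F mF F0 F1.
have mPA' : measurable_fun setT (PA \_ A).
  by apply/(measurable_restrictT _ _).1 => //; exact: measurable_funTS.
have mPB' : measurable_fun setT (PB \_ B).
  by apply/(measurable_restrictT _ _).1 => //; exact: measurable_funTS.
have A0 r : (0 <= (PA \_ A) r)%E by apply: erestrict_ge0.
have B0 r : (0 <= (PB \_ B) r)%E by apply: erestrict_ge0.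
exists (fun r => (PA \_ A) r + (PB \_ B) r)%E; split.
- exact: emeasurable_funD.
- by move=> r; exact: adde_ge0.
- move=> r t [Ar|Br] Et.
    apply: (le_trans (PAE r t Ar Et)); rewrite [(PA \_ A) r]patchE mem_set// leeDl//.
  by apply: (le_trans (PBE r t Br Et)); rewrite [(PB \_ B) r]patchE mem_set// leeDr.
have p0 r : pos r -> (0 <= (r ^+ n.+2)%:E)%E.
  by rewrite /= in_itv /= andbT => r0; rewrite lee_fin exprn_ge0// ltW.
have mX : measurable_fun setT (fun r : R => (r ^+ n.+2)%:E).
  by apply/measurable_EFinP; exact: measurable_funX.
have mU : measurable (A `|` B) by apply: measurableU.
have U0 r : (A `|` B) r -> (0 <= (r ^+ n.+2)%:E)%E by move=> [/Ap|/Bp] /p0.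
apply: (@le_trans _ _ (\int[mu]_(r in A `|` B) ((PA \_ A) r * (r ^+ n.+2)%:E) +
  \int[mu]_(r in A `|` B) ((PB \_ B) r * (r ^+ n.+2)%:E))%E).
  rewrite -ge0_integralD//.
  - apply: ge0_le_integral_nomeas => r Ur.
      by apply: mule_ge0; [exact: adde_ge0|exact: U0].
    by rewrite ge0_muleDl.
  - by move=> r Ur; apply: mule_ge0 => //; exact: U0.
  - by apply: measurable_funTS; exact: emeasurable_funM.
  - by move=> r Ur; apply: mule_ge0 => //; exact: U0.
  - by apply: measurable_funTS; exact: emeasurable_funM.
rewrite EFinD; apply: leeD.
  by apply: le_trans PAi; apply: integral_patch_le => // r /Ap/p0.
by apply: le_trans PBi; apply: integral_patch_le => // r /Bp/p0.
Qed.

Lemma Av_scale n r t (k : R) (F : R -> R) : 0 <= k -> measurable_fun setT F -> (forall s, 0 <= F s) ->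
  Av n.+2 r t (fun s => k * F s) = (k%:E * Av n.+2 r t F)%E.
Proof.
move=> k0 mF F0; rewrite /Av.
under eq_integral do rewrite -mulrA EFinM.
rewrite ge0_integralZl_EFin//.
- by move=> w _; rewrite lee_fin mulr_ge0// exprn_ge0// ltW// hw_gt0.
- by apply: measurable_Av_integrand.
Qed.

Lemma wint_scale m (p k : R) (F : R -> R) : 0 <= k -> measurable_fun setT F -> (forall s, 0 <= F s) ->
  wint m p (fun s => k * F s) = ((k `^ p)%:E * wint m p F)%E.
Proof.
move=> k0 mF F0; rewrite /wint.
rewrite -ge0_integralZl_EFin ?powR_ge0//.
- by apply: eq_integral => s _; rewrite -EFinM powRM// mulrA.
- move=> s; rewrite /= in_itv /= andbT => s0.
  by rewrite lee_fin mulr_ge0 ?powR_ge0// exprn_ge0// ltW.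
- apply/measurable_EFinP; apply: measurable_funTS; apply: measurable_funM; last exact: measurable_funX.
  by apply: (measurableT_comp (@measurable_powR R p)).
Qed.

Lemma Lnormd_radial n (c p : R) (f0 : R -> R) : polar_cst n.+2 c -> 0 < p -> measurable_fun setT f0 ->
  Lnormd p^-1 (fun x : 'rV[R]_n.+3 => (f0 (enorm x))%:E) =
  ((c `^ p^-1)%:E * poweR (wint n.+2 p (fun s => `|f0 s|%R)) p^-1)%E.
Proof.
move=> [c0 hc] p0 mf0; rewrite /Lnormd invr_eq0 gt_eqF// invrK.
have mh : measurable_fun setT (fun s : R => (`|f0 s| `^ p)%:E).
  apply/measurable_EFinP; apply: (measurableT_comp (@measurable_powR R p)).
  exact: measurableT_comp.
have -> : iint (fun x : 'rV[R]_n.+3 => poweR `|(f0 (enorm x))%:E| p) =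
    (c%:E * wint n.+2 p (fun s => `|f0 s|%R))%E.
  have := hc _ mh (fun s => _); rewrite /wint => <-; first by apply: eq_iint => x.
  by move=> x; rewrite lee_fin powR_ge0.
rewrite poweRM ?lee_fin ?(ltW c0)//.
apply: integral_ge0 => s; rewrite /= in_itv /= andbT => s0.
by rewrite lee_fin mulr_ge0 ?powR_ge0// exprn_ge0// ltW.
Qed.

(** Polar coordinates turn both norms into radial integrals, and [Psi] for the normalized profile
    majorizes the q-th power of the maximal function up to constants. *)
Lemma strong_type n (p q : R) (E : set R) : E !=set0 -> 0 < p -> 0 < q ->
  region_bound n p q E pos -> bounded_rad n.+3 E p^-1 q^-1.
Proof.
move=> [t0 Et0] p0 q0 [C hC].
have [c hc] := polar_cst_exists n.+2; have c0 := hc.1.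
have [K [K0 hK]] := @sph_avgE R n.+1.
pose C' := Num.max C 0.
have C'0 : 0 <= C' by rewrite le_max lexx orbT.
pose M := K * (c * C') `^ q^-1.
have M0 : 0 <= M by rewrite mulr_ge0 ?powR_ge0// ltW.
exists (M * (c `^ p^-1)^-1) => f0 mf0 f.
have maf : measurable_fun setT (fun s => `|f0 s|%R) by exact: measurableT_comp.
rewrite (Lnormd_radial hc p0 mf0).
set W := wint _ _ _ => Wfin.
have W0 : (0 <= W)%E.
  apply: integral_ge0 => s; rewrite /= in_itv /= andbT => s0.
  by rewrite lee_fin mulr_ge0 ?powR_ge0// exprn_ge0// ltW.
have cp0 : 0 < c `^ p^-1 by exact: powR_gt0.
have Wp0 : (0 <= poweR W p^-1)%E by exact: poweR_ge0.
have Wpfin : poweR W p^-1 \is a fin_num.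
  rewrite ge0_fin_numE//; move: Wfin.
  by move: (poweR W p^-1) Wp0 => [w| |]//= _; rewrite ?ltry// gt0_muley ?lte_fin.
(* The norm may vanish, so the profile is divided by an arbitrary k > 0 above it (up to the polar
   constant); k tends to the norm at the end. *)
have key (k : R) : 0 < k -> (W <= (k `^ p)%:E)%E -> (Lnormd q^-1 (ME E f) <= (M * k)%:E)%E.
  move=> k0 Wk.
  pose F s := k^-1 * `|f0 s|.
  have k10 : 0 <= k^-1 by rewrite invr_ge0 ltW.
  have mF : measurable_fun setT F by exact: measurable_funM.
  have F0 s : 0 <= F s by exact: mulr_ge0.
  have F1 : (wint n.+2 p F <= 1)%E.
    rewrite (wint_scale _ _ k10 maf)//.
    have kp0 : 0 <= k^-1 `^ p by exact: powR_ge0.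
    apply: (le_trans (lee_wpmul2l _ Wk)); first by rewrite lee_fin.
    by rewrite -EFinM -powRM ?(ltW k0)// mulVf ?gt_eqF// powR1.
  have [Psi [mPsi Psi0 PsiE Psii]] := hC F mF F0 F1.
  have Kk0 : 0 <= K * k by rewrite mulr_ge0// ltW.
  (* Only the origin receives the value +oo, and polar integration ignores it. *)
  pose g (r : R) : \bar R := if 0 < r then (((K * k) `^ q)%:E * Psi r)%E else +oo%E.
  have mg : measurable_fun setT g.
    apply: measurable_fun_ifT => //; first exact: measurable_fun_ltr.
    exact: emeasurable_funM.
  have g0 r : (0 <= g r)%E.
    by rewrite /g; case: ifP => // _; apply: mule_ge0; rewrite ?lee_fin ?powR_ge0.
  have MEg x : (poweR `|ME E f x| q <= g (enorm x))%E.
    rewrite /g; case: ifPn => [x0|_]; last exact: leey.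
    have ME0 : (0 <= ME E f x)%E.
      apply: (@le_trans _ _ `|sph_avg f t0 x|%E); first exact: abse_ge0.
      by apply: ereal_sup_ubound; exists t0.
    rewrite gee0_abs//.
    have PsiV0 : (0 <= poweR (Psi (enorm x)) q^-1)%E by exact: poweR_ge0.
    have KkE : (0 <= (K * k)%:E)%E by rewrite lee_fin.
    have -> : (((K * k) `^ q)%:E * Psi (enorm x) =
        poweR ((K * k)%:E * poweR (Psi (enorm x)) q^-1) q)%E.
      by rewrite poweRM// -poweRrM mulVf ?gt_eqF// poweRe1.
    apply: le_poweR => //; first exact: ltW.
    apply: ge_ereal_sup => _ [t Et <-].
    have [h _] := hK f0 t x mf0.
    apply: (le_trans h).
    have -> : Av n.+3 (enorm x) t (fun s => `|f0 s|%R) = (k%:E * Av n.+3 (enorm x) t F)%E.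
      rewrite -(Av_scale _ _ _ (ltW k0) mF F0); congr (Av _ _ _ _).
      by apply/funext => s; rewrite /F mulrA mulfV ?gt_eqF// mul1r.
    rewrite muleA -EFinM; apply: lee_wpmul2l => //.
    have Av0 := @Av_ge0 R n.+3 (enorm x) t F F0.
    rewrite -(poweR_KV Av0 (q := q)) ?gt_eqF//.
    apply: le_poweR; first by rewrite invr_ge0 ltW.
      exact: poweR_ge0.
    by apply: PsiE => //; rewrite /= in_itv /= x0.
  rewrite /Lnormd invr_eq0 gt_eqF// invrK.
  have iME0 : (0 <= iint (fun x => poweR `|ME E f x| q))%E by apply: iint_ge0 => x; exact: poweR_ge0.
  have bound : (iint (fun x => poweR `|ME E f x| q) <= (c * ((K * k) `^ q * C'))%:E)%E.
    apply: (@le_trans _ _ (iint (fun x : 'rV[R]_n.+3 => g (enorm x)))).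
      by apply: le_iint => // x; exact: poweR_ge0.
    have /= -> := hc.2 g mg g0.
    have c0E : (0 <= c%:E)%E by rewrite lee_fin ltW.
    rewrite EFinM; apply: lee_wpmul2l => //.
    have Kq0 : 0 <= (K * k) `^ q by exact: powR_ge0.
    have mPX : measurable_fun pos (fun r => Psi r * (r ^+ n.+2)%:E)%E.
      apply: measurable_funTS; apply: emeasurable_funM => //.
      by apply/measurable_EFinP; exact: measurable_funX.
    have PX0 r : pos r -> (0 <= Psi r * (r ^+ n.+2)%:E)%E.
      rewrite /= in_itv /= andbT => r0; apply: mule_ge0 => //.
      by rewrite lee_fin exprn_ge0// ltW.
    apply: (@le_trans _ _ (((K * k) `^ q)%:E * \int[mu]_(r in pos) (Psi r * (r ^+ n.+2)%:E))%E).
      have mpos : measurable pos by exact: measurable_itv.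
      rewrite -(ge0_integralZl_EFin (@lebesgue_measure R) mpos PX0 mPX Kq0).
      apply: ge0_le_integral_nomeas => r r0.
        have := PX0 r r0; move: r0; rewrite /= in_itv /= andbT => r0 _.
        by apply: mule_ge0 => //; rewrite lee_fin exprn_ge0// ltW.
      by move: r0; rewrite /= in_itv /= andbT => r0; rewrite /g r0 muleA.
    rewrite EFinM; apply: lee_wpmul2l; first by rewrite lee_fin.
    by apply: (le_trans Psii); rewrite lee_fin le_max lexx.
  have qi0 : 0 <= q^-1 by rewrite invr_ge0 ltW.
  apply: (le_trans (le_poweR qi0 iME0 bound)).
  rewrite poweR_EFin lee_fin le_eqVlt; apply/orP; left; apply/eqP.
  have -> : c * ((K * k) `^ q * C') = (c * C') * (K * k) `^ q by ring.
  have cC0 : 0 <= c * C' by rewrite mulr_ge0// ltW.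
  rewrite (@powRM _ (c * C') ((K * k) `^ q)) ?powR_ge0// powR_KV ?gt_eqF// /M; ring.
have -> : ((M * (c `^ p^-1)^-1)%:E * ((c `^ p^-1)%:E * poweR W p^-1) = M%:E * poweR W p^-1)%E.
  by rewrite muleA -EFinM divfK ?gt_eqF.
apply/lee_addgt0Pr => e e0.
pose e' := e / (M + 1).
have M10 : 0 < M + 1 by lra.
have e'0 : 0 < e' by rewrite divr_gt0.
pose w := fine (poweR W p^-1).
have w0 : 0 <= w by rewrite /w fine_ge0.
have wE : poweR W p^-1 = w%:E by rewrite /w fineK.
apply: (le_trans (key (w + e') _ _)).
- lra.
- have pi0 : p^-1 != 0 by rewrite invr_eq0 gt_eqF.
  have := poweR_KV W0 pi0; rewrite invrK => <-.
  rewrite wE -[leRHS]poweR_EFin; apply: le_poweR; rewrite ?lee_fin ?(ltW p0)//; lra.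
- rewrite wE -EFinM -EFinD lee_fin mulrDr lerD2l /e' mulrA ler_pdivrMr//.
  by rewrite mulrC ler_wpM2l ?(ltW e0)//; lra.
Qed.

End upper_bound.

Section sufficiency.
Context {R : realType}.
Local Notation pos := (`]0%R, +oo[%classic : set R).

Lemma region_bound_pos n (p q : R) (E : set R) :
  region_bound n p q E `]0, 2^-1] -> region_bound n p q E `]2^-1, 3[ ->
  region_bound n p q E `[3, +oo[ -> region_bound n p q E pos.
Proof.
move=> h1 h2 h3.
have -> : pos = (`]0, 2^-1]%classic `|` `]2^-1, 3[%classic) `|` `[3, +oo[%classic.
  apply/seteqP; split => r /=; rewrite !in_itv /= !andbT.
    move=> r0; case: (leP r 2^-1) => r1; first by left; left; rewrite r0.
    by case: (ltP r 3) => r2; [left; right|right].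
  by move=> [[/andP[]//|/andP[h _]]|h]; lra.
have s1 : `]0, 2^-1]%classic `<=` pos by move=> r /=; rewrite !in_itv /= andbT => /andP[].
have s2 : `]2^-1, 3[%classic `<=` pos by move=> r /=; rewrite !in_itv /= andbT => /andP[? _]; lra.
have s3 : `[3, +oo[%classic `<=` pos by move=> r /=; rewrite !in_itv /= !andbT => ?; lra.
apply: region_boundU => //.
- by apply: measurableU; exact: measurable_itv.
- by move=> r [/s1|/s2].
- exact: region_boundU.
Qed.

Lemma bounded_rad_power n (a b b' C : R) (E : set R) : E `<=` `[1, 2] -> E !=set0 ->
  0 < b -> b <= a -> a <= 1 -> a <= n.+3%:R * b -> 0 <= C -> 0 <= b' -> b' < 1 ->
  n.+3%:R * a - n.+2%:R <= (1 - b') * b ->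
  (forall s, 0 < s < 1 -> Ncov E s <= C * s `^ (- b')) ->
  bounded_rad n.+3 E a b.
Proof.
move=> hE E0 b0 ba a1 adb C0 b'0 b'1 hk hN.
have a0 : 0 < a by exact: lt_le_trans ba.
rewrite -[a]invrK -[b]invrK; apply: strong_type => //; rewrite ?invr_gt0//.
have p1 : 1 <= a^-1 by rewrite invf_ge1.
have pq : a^-1 <= b^-1 by rewrite lef_pV2.
apply: region_bound_pos.
(* For p = 1 the exponent condition reads 1 <= (1 - b') b, which forces b = 1. *)
- move: p1; rewrite le_eqVlt => /predU1P[e|p1].
    have {}e : a = 1 by rewrite -[a]invrK -e invr1.
    have -> : b = 1.
      apply/le_anti; rewrite -{1}e ba /=; move: hk; rewrite e mulr1 -(natr1 n.+2); nra.
    by rewrite e invr1; exact: region_small1.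
  apply: region_small => //; first by rewrite invr_ge0 ltW.
  by rewrite -ler_pdivrMl ?invr_gt0// invrK ler_pdivrMr// mulrC.
- apply: (@region_mid_power _ n a^-1 b^-1 b' C E) => //.
  by rewrite !invrK; lra.
- exact: region_large.
Qed.

Lemma bounded_rad_log n (b C : R) (E : set R) (a := n.+2%:R / n.+3%:R : R) :
  E `<=` `[1, 2] -> E !=set0 -> 0 < b -> b <= a -> a <= n.+3%:R * b -> 0 <= C ->
  (forall s, 0 < s < 1 -> ln s^-1 `^ (b^-1 / n.+3%:R) * s * Ncov E s <= C) ->
  bounded_rad n.+3 E a b.
Proof.
move=> hE E0 b0 ba adb C0 hN.
have a0 : 0 < a by exact: lt_le_trans ba.
have a1 : a < 1 by rewrite /a ltr_pdivrMr// mul1r ltr_nat.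
have pE : a^-1 = n.+3%:R / n.+2%:R by rewrite /a invf_div.
rewrite -[a]invrK -[b]invrK; apply: strong_type => //; rewrite ?invr_gt0//.
have p1 : 1 < a^-1 by rewrite invf_gt1.
have pq : a^-1 <= b^-1 by rewrite lef_pV2.
apply: region_bound_pos.
- apply: region_small => //; first by rewrite invr_ge0 ltW.
  by rewrite -ler_pdivrMl ?invr_gt0// invrK ler_pdivrMr// mulrC.
- by rewrite pE; apply: (@region_mid_log _ n b^-1 C E) => //; rewrite -pE.
- by apply: region_large => //; exact: ltW.
Qed.

Lemma Lnormd0_le n (f : 'rV[R]_n -> \bar R) (M : \bar R) :
  (iint (fun x => ((M < `|f x|)%E%:R)%:E) = 0)%E -> (Lnormd 0 f <= M)%E.
Proof. by move=> h; rewrite /Lnormd eqxx; apply: ereal_inf_lbound. Qed.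

Lemma lt_Lnormd0 n (f : 'rV[R]_n -> \bar R) (M : \bar R) : (Lnormd 0 f < M)%E ->
  (iint (fun x => ((M < `|f x|)%E%:R : R)%:E) = 0)%E.
Proof.
rewrite /Lnormd eqxx => /ereal_inf_lt[L hL LM].
apply/eqP; rewrite eq_le; apply/andP; split; last by apply: iint_ge0 => x; rewrite lee_fin.
rewrite -hL; apply: le_iint => x; rewrite lee_fin ?ler0n//.
rewrite ler_nat; case: ltP => // h.
by rewrite (lt_trans LM h).
Qed.

(** For M above the essential supremum, the part of |f0| exceeding M vanishes almost everywhere on
    the half-line. As the averages have a density in s, they do not see this part, for every center
    other than the origin and every radius t in [E]. *)
Lemma bounded_rad_infty n (E : set R) : E `<=` `[1, 2] -> E !=set0 ->
  bounded_rad n.+3 E 0 0.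
Proof.
move=> hE [t0 Et0].
have [c hc] := @polar_cst_exists R n.+2; have c0 := hc.1.
have [K [K0 hK]] := @sph_avgE R n.+1.
pose J := fine (@Jw R n.+3).
have J0 : 0 <= J by rewrite fine_ge0// ltW// Jw_gt0.
have JE : (J%:E = @Jw R n.+3)%E by rewrite fineK// Jw_fin.
exists (K * J) => f0 mf0 f Nfin.
set N := Lnormd 0 _ in Nfin *.
have maf : measurable_fun setT (fun s => `|f0 s|) by exact: measurableT_comp.
pose F (M : R) s := (M < `|f0 s|)%R%:R * `|f0 s|.
have mB (M : R) : measurable_fun setT (fun s => (M < `|f0 s|)%R%:R : R).
  by apply: measurable_bool_fun; apply: measurable_fun_ltr.
have mF M : measurable_fun setT (F M) by exact: measurable_funM.
have F0 M s : 0 <= F M s by exact: mulr_ge0.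
have null (M : R) : (N < M%:E)%E ->
    (\int[mu]_(r in pos) (((M < `|f0 r|)%R%:R * r ^+ n.+2)%:E) = 0)%E.
  move=> /lt_Lnormd0 h0.
  have := hc.2 (fun s => ((M < `|f0 s|)%R%:R)%:E) _ _.
  have -> : iint (fun z : 'rV[R]_n.+3 => ((M < `|f0 (enorm z)|)%R%:R : R)%:E) = 0%E.
    by rewrite -h0; apply: eq_iint => z; rewrite lte_fin.
  move=> h.
  have /esym/eqP := h ltac:(by apply/measurable_EFinP) ltac:(by move=> x; rewrite lee_fin).
  by rewrite mule_eq0 eqe gt_eqF//= => /eqP.
have N0 : (0 <= N)%E.
  rewrite leNgt; apply/negP; rewrite /N /Lnormd eqxx => /ereal_inf_lt[L hL L0].
  have h1 : iint (fun z : 'rV[R]_n.+3 => (1 : R)%:E) = 0%E.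
    rewrite -hL; apply: eq_iint => z; rewrite (_ : (L < _)%E)//.
    by apply: (lt_le_trans L0); exact: abse_ge0.
  have := hc.2 (fun=> 1%:E) (@measurable_cst _ _ _ _ _ _) ltac:(by move=> x; rewrite lee_fin).
  rewrite h1 => /esym/eqP; rewrite mule_eq0 eqe gt_eqF//= => /eqP h2.
  have : (1 <= (0 : \bar R))%E.
    rewrite -h2; apply: (@le_trans _ _ (\int[mu]_(r in `[1%R, 2%R]) 1)%E).
      by rewrite integral_cst//= lebesgue_measure_itv /= lte_fin ltr1n mul1e -EFinB lee_fin; lra.
    apply: ge0_le_integral_sub => r; first by [].
      rewrite /= in_itv /= andbT => r0; rewrite mul1e lee_fin exprn_ge0// ltW//.
    rewrite /= !in_itv /= andbT => /andP[r1 _]; split; first by lra.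
    by rewrite mul1e lee_fin exprn_ege1.
  by rewrite lee_fin ler10.
have key (M : R) : (N < M%:E)%E -> (Lnormd 0 (ME E f) <= (K * J * M)%:E)%E.
  move=> NM.
  have M0 : 0 <= M by rewrite -lee_fin (le_trans N0)// ltW.
  have Avnull r t : 0 < r -> 0 < t -> Av n.+3 r t (F M) = 0%E.
    move=> r0 t0'; rewrite Av_ker//.
    apply/eqP; rewrite eq_le; apply/andP; split; last first.
      by apply: integral_ge0 => s _; rewrite lee_fin mulr_ge0// ker_ge0.
    have g0 s : pos s -> (0 <= ((M < `|f0 s|)%R%:R * s ^+ n.+2)%:E)%E.
      by rewrite /= in_itv /= andbT => s0; rewrite lee_fin mulr_ge0// exprn_ge0// ltW.
    have mg : measurable_fun pos (fun s => ((M < `|f0 s|)%R%:R * s ^+ n.+2)%:E).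
      apply/measurable_EFinP; apply: measurable_funTS; apply: measurable_funM; [exact: mB|exact: measurable_funX].
    have mpos : measurable pos by exact: measurable_itv.
    (* The factor +oo dominates any value of the integrand without a bound on F, and +oo times 0 is
       0. *)
    have e0 : (+oo * \int[mu]_(r in pos) (((M < `|f0 r|)%R%:R * r ^+ n.+2)%:E) = 0 :> \bar R)%E.
      by rewrite null// mule0.
    rewrite -[leRHS]e0 -(ge0_integralZl (@lebesgue_measure R) mpos mg g0 (leey 0)).
    apply: ge0_le_integral_sub => s.
    - by move=> _; rewrite lee_fin mulr_ge0// ker_ge0.
    - by move=> s0; apply: mule_ge0 => //; exact: g0.
    rewrite /= !in_itv /= andbT => /andP[s1 s2].
    have s0 : 0 < s by exact: le_lt_trans s1.
    split => //; rewrite /F; case: (M < _); last by rewrite !mul0r mule0.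
    by rewrite !mul1r gt0_mulye ?leey// lte_fin exprn_gt0.
  have MEle x : 0 < enorm x -> (`|ME E f x| <= (K * J * M)%:E)%E.
    move=> x0; rewrite gee0_abs; last first.
      apply: (@le_trans _ _ `|sph_avg f t0 x|%E); first exact: abse_ge0.
      by apply: ereal_sup_ubound; exists t0.
    apply: ge_ereal_sup => _ [t Et <-].
    have [h _] := hK f0 t x mf0.
    have t_gt0 : 0 < t by move: (hE _ Et); rewrite /= in_itv /= => /andP[? _]; lra.
    apply: (le_trans h); rewrite -mulrA EFinM; apply: lee_wpmul2l; first by rewrite lee_fin ltW.
    apply: (@le_trans _ _ (\int[mu]_w (M%:E * (hw w ^+ n.+3)%:E + (F M (Sf (enorm x) t w) * hw w ^+ n.+3)%:E))%E).
      apply: ge0_le_integral_nomeas => w _.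
        by rewrite lee_fin mulr_ge0// exprn_ge0// ltW// hw_gt0.
      rewrite -EFinM -EFinD lee_fin -mulrDl ler_wpM2r ?exprn_ge0 ?(ltW (hw_gt0 w))//.
      by rewrite /F; case: ltP => hM; rewrite ?mul1r ?mul0r ?addr0// lerDr.
    have hX0 w : (0 <= (hw w ^+ n.+3)%:E)%E by rewrite lee_fin exprn_ge0// ltW// hw_gt0.
    rewrite ge0_integralD//.
    - rewrite -/(Av n.+3 (enorm x) t (F M)) Avnull// adde0 ge0_integralZl_EFin//; last exact: measurable_hwX.
      by rewrite -/(Jw n.+3) -JE -EFinM mulrC.
    - by move=> w _; apply: mule_ge0; [rewrite lee_fin|exact: hX0].
    - by apply: emeasurable_funM => //; exact: measurable_hwX.
    - by move=> w _; rewrite lee_fin mulr_ge0// exprn_ge0// ltW// hw_gt0.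
    - exact: measurable_Av_integrand.
  apply: Lnormd0_le.
  pose g (r : R) : \bar R := if 0 < r then 0%E else +oo%E.
  have mg : measurable_fun setT g.
    by apply: measurable_fun_ifT => //; exact: measurable_fun_ltr.
  have g0 r : (0 <= g r)%E by rewrite /g; case: ifP.
  apply/eqP; rewrite eq_le; apply/andP; split; last by apply: iint_ge0 => x; rewrite lee_fin.
  apply: (@le_trans _ _ (iint (fun x : 'rV[R]_n.+3 => g (enorm x)))).
    apply: le_iint => x; first by rewrite lee_fin.
    rewrite /g; case: ifPn => [x0|_]; last exact: leey.
    by rewrite ltNge MEle.
  have /= -> := hc.2 g mg g0.
  rewrite (_ : (\int[mu]_(rho in pos) _)%E = 0%E) ?mule0//.
  apply: integral0_eq => r; rewrite /= in_itv /= andbT => r0.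
  by rewrite /g r0 mul0e.
have Nf : N \is a fin_num by rewrite ge0_fin_numE.
have KJ0 : 0 <= K * J by rewrite mulr_ge0// ltW.
rewrite -(fineK Nf) in key *.
move: (fine N) => v in key *.
apply/lee_addgt0Pr => e e0.
have KJ1 : 0 < K * J + 1 by lra.
apply: (le_trans (key (v + e / (K * J + 1)) _)).
  by rewrite lte_fin ltrDl divr_gt0.
rewrite -EFinM -EFinD lee_fin mulrDr lerD2l mulrA ler_pdivrMr// mulrC ler_wpM2l ?(ltW e0)//; lra.
Qed.

End sufficiency.

(** * Test functions *)

Section testing.
Context {R : realType}.
Local Notation pos := (`]0%R, +oo[%classic : set R).

Lemma iint_indic_ge n (c k V : R) (Z : set R) : polar_cst n c -> 0 <= k -> measurable Z -> Z `<=` pos ->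
  (V%:E <= \int[mu]_(r in Z) (r ^+ n)%:E)%E ->
  ((k * (c * V))%:E <= iint (fun x : 'rV[R]_n.+1 => (\1_Z (enorm x) * k)%:E))%E.
Proof.
move=> [c0 hc] k0 mZ Zp hV.
have m1 : measurable_fun setT (fun r : R => (\1_Z r * k)%:E).
  by apply/measurable_EFinP; apply: measurable_funM => //; exact: measurable_indic.
have Z0 (r : R) : (0 <= (\1_Z r * k)%:E :> \bar R)%E by rewrite lee_fin mulr_ge0.
have /= -> := hc _ m1 Z0.
have c0E : (0 <= c%:E)%E by rewrite lee_fin ltW.
have k0E : (0 <= k%:E)%E by rewrite lee_fin.
rewrite mulrCA EFinM; apply: lee_wpmul2l => //.
rewrite EFinM; apply: (le_trans (lee_wpmul2l k0E hV)).
have p0 r : pos r -> (0 <= (r ^+ n)%:E)%E.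
  by rewrite /= in_itv /= andbT => r0; rewrite lee_fin exprn_ge0// ltW.
have mX : measurable_fun Z (fun r : R => (r ^+ n)%:E).
  by apply/measurable_EFinP; apply: measurable_funTS; exact: measurable_funX.
rewrite -(ge0_integralZl_EFin (@lebesgue_measure R) mZ (fun r h => p0 r (Zp r h)) mX k0).
apply: ge0_le_integral_sub => r.
- by move=> /Zp/p0 h; apply: mule_ge0.
- by move=> /p0 h; apply: mule_ge0.
- by move=> Zr; split; [exact: Zp|rewrite indicE mem_set// mul1r].
Qed.

(** Chebyshev's inequality by comparison with a multiple of the indicator of [Z]. For b = 0 the norm
    is an essential supremum, and the positive measure of [Z] is what counts. *)
Lemma Lnormd_ge n (c b eta V : R) (Z : set R) (g : 'rV[R]_n.+1 -> \bar R) : polar_cst n c ->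
  0 <= b -> 0 <= eta -> 0 < V -> measurable Z -> Z `<=` pos ->
  (V%:E <= \int[mu]_(r in Z) (r ^+ n)%:E)%E ->
  (forall x, Z (enorm x) -> (eta%:E <= `|g x|)%E) ->
  ((eta * (c * V) `^ b)%:E <= Lnormd b g)%E.
Proof.
move=> hc b0 eta0 V0 mZ Zp hV hg; have c0 := hc.1.
have cV0 : 0 < c * V by exact: mulr_gt0.
rewrite /Lnormd; case: ifPn => [/eqP ->|bN0].
  rewrite powRr0 mulr1; apply/ereal_infP => M h'.
  have hM : iint (fun x => ((M < `|g x|)%E%:R : R)%:E) = 0%E by exact: h'.
  rewrite leNgt; apply/negP => Me.
  have := iint_indic_ge hc ler01 mZ Zp hV.
  rewrite mul1r => h; have : ((c * V)%:E <= 0)%E.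
    rewrite -hM; apply: (le_trans h); apply: le_iint => x; first by rewrite lee_fin mulr_ge0.
    rewrite indicE mulr1; case: (pselect (Z (enorm x))) => Zx.
      by rewrite mem_set// (lt_le_trans Me (hg x Zx)).
    by rewrite memNset// lee_fin.
  by rewrite lee_fin leNgt cV0.
have bp : 0 < b by rewrite lt_neqAle eq_sym bN0.
have e0 : 0 <= eta `^ b^-1 by exact: powR_ge0.
apply: (@le_trans _ _ (poweR (iint (fun x : 'rV[R]_n.+1 => (\1_Z (enorm x) * (eta `^ b^-1))%:E)) b)).
  have h := iint_indic_ge hc e0 mZ Zp hV.
  have h0 : (0 <= (eta `^ b^-1 * (c * V))%:E)%E by rewrite lee_fin mulr_ge0// ltW.
  have := le_poweR b0 h0 h.
  by rewrite poweR_EFin powRM ?(ltW cV0)// powR_VK.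
apply: le_poweR => //; first by apply: iint_ge0 => x; rewrite lee_fin mulr_ge0.
apply: le_iint => x; first by rewrite lee_fin mulr_ge0.
rewrite indicE; case: (pselect (Z (enorm x))) => Zx; last first.
  by rewrite memNset// mul0r poweR_ge0.
rewrite mem_set// mul1r -poweR_EFin; apply: le_poweR; first by rewrite invr_ge0.
  by rewrite lee_fin.
exact: hg.
Qed.

(** The common form of all lower bounds: [B] bounds the norm of the test function, [eta] bounds its
    averages from below on the radii in [Z], and [V] bounds the volume of [Z] from below. *)
Lemma testing n (E : set R) (a b : R) : E !=set0 -> 0 <= b -> bounded_rad n.+3 E a b ->
  exists2 C, 0 <= C & forall (f0 : R -> R) (B eta V : R) (Z : set R),
    measurable_fun setT f0 -> (forall s, 0 <= f0 s) ->
    (Lnormd a (fun x : 'rV[R]_n.+3 => (f0 (enorm x))%:E) <= B%:E)%E ->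
    0 <= B -> 0 <= eta -> 0 < V -> measurable Z -> Z `<=` pos ->
    (V%:E <= \int[mu]_(r in Z) (r ^+ n.+2)%:E)%E ->
    (forall r, Z r -> exists2 t, E t & (eta%:E <= Av n.+3 r t f0)%E) ->
    eta * V `^ b <= C * B.
Proof.
move=> E0 b0 [C0 hC].
have [c hc] := @polar_cst_exists R n.+2; have c0 := hc.1.
have [K [K0 hK]] := @sph_avgE R n.+1.
have cb0 : 0 < c `^ b by exact: powR_gt0.
pose C1 := Num.max C0 0.
have C10 : 0 <= C1 by rewrite le_max lexx orbT.
exists (C1 / (K * c `^ b)); first by rewrite divr_ge0// mulr_ge0 ?ltW.
move=> f0 B eta V Z mf0 f00 hB B0 eta0 V0 mZ Zp hV hAv.
have hb := hC f0 mf0 (le_lt_trans hB (ltry B)).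
have Kb0 : 0 < K * c `^ b by exact: mulr_gt0.
rewrite mulrAC ler_pdivlMr//.
have -> : eta * V `^ b * (K * c `^ b) = (K * eta) * (c * V) `^ b.
  by rewrite (@powRM _ c V) ?(ltW c0) ?(ltW V0)//; ring.
rewrite -lee_fin.
have Ke0 : 0 <= K * eta by rewrite mulr_ge0// ltW.
apply: (@le_trans _ _ (Lnormd b (ME E (fun x : 'rV[R]_n.+3 => f0 (enorm x))))).
  apply: (Lnormd_ge hc b0 Ke0 V0 mZ Zp hV) => x Zx.
  have [t Et hat] := hAv _ Zx.
  apply: (@le_trans _ _ (ME E (fun x : 'rV[R]_n.+3 => f0 (enorm x)) x)); last exact: lee_abs.
  apply: (@le_trans _ _ `|sph_avg (fun x : 'rV[R]_n.+3 => f0 (enorm x)) t x|%E); last first.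
    by apply: ereal_sup_ubound; exists t.
  have [_ /(_ f00) ->] := hK f0 t x mf0.
  rewrite gee0_abs; last by apply: mule_ge0; [rewrite lee_fin ltW|exact: Av_ge0].
  by rewrite EFinM; apply: lee_wpmul2l => //; rewrite lee_fin ltW.
apply: (le_trans hb).
have L0 : (0 <= Lnormd a (fun x : 'rV[R]_n.+3 => (f0 (enorm x))%:E))%E.
  rewrite /Lnormd; case: ifP => _; last exact: poweR_ge0.
  apply/ereal_infP => M h'; rewrite leNgt; apply/negP => M0.
  have hM : iint (fun x : 'rV[R]_n.+3 => ((M < `|(f0 (enorm x))%:E|)%E%:R : R)%:E) = 0%E by exact: h'.
  have mp : measurable (`[1%R, 2%R]%classic : set R) by exact: measurable_itv.
  have p1 : `[1%R, 2%R]%classic `<=` pos by move=> r; rewrite /= !in_itv /= andbT => /andP[? _]; lra.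
  have h1 : (1%:E <= \int[mu]_(r in `[1%R, 2%R]) ((r : R) ^+ n.+2)%:E)%E.
    apply: (@le_trans _ _ (\int[mu]_(r in `[1%R, 2%R]) 1)%E).
      by rewrite integral_cst//= lebesgue_measure_itv /= lte_fin ltr1n mul1e -EFinB lee_fin; lra.
    apply: ge0_le_integral_nomeas => r; first by [].
    by rewrite /= in_itv /= => /andP[r1 _]; rewrite lee_fin exprn_ege1.
  have := iint_indic_ge hc ler01 mp p1 h1.
  rewrite mul1r mulr1 => h; have : (c%:E <= 0)%E.
    rewrite -hM; apply: (le_trans h); apply: le_iint => x; first by rewrite lee_fin mulr_ge0.
    by rewrite mulr1 (lt_le_trans M0) ?abse_ge0// lee_fin indicE lern1; case: (_ \in _).
  by rewrite lee_fin leNgt c0.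
apply: (@le_trans _ _ (C1%:E * Lnormd a (fun x : 'rV[R]_n.+3 => (f0 (enorm x))%:E))%E).
  by apply: lee_wpmul2r => //; rewrite lee_fin le_max lexx.
by rewrite EFinM; apply: lee_wpmul2l.
Qed.

Lemma Lnormd_indic_le n (a : R) : 0 <= a -> exists2 c, 0 < c & forall (I : set R) (V : R),
  measurable I -> 0 <= V -> (\int[mu]_(r in I `&` pos) (r ^+ n.+2)%:E <= V%:E)%E ->
  (Lnormd a (fun x : 'rV[R]_n.+3 => (\1_I (enorm x))%:E) <= ((c * V) `^ a)%:E)%E.
Proof.
move=> a0; have [c hc] := @polar_cst_exists R n.+2; have c0 := hc.1.
exists c => // I V mI V0 hV.
have [->|aN0] := eqVneq a 0.
  have e x : ((1 < `|(\1_I (enorm (x : 'rV[R]_n.+3)) : R)%:E|)%E%:R : R)%:E = 0%E.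
    have h : (`|(\1_I (enorm x) : R)%:E| <= 1)%E.
      by rewrite /= lee_fin ger0_norm// indicE lern1; case: (_ \in _).
    by rewrite (le_gtF h).
  rewrite powRr0; apply: Lnormd0_le; rewrite (eq_iint e).
  have -> := hc.2 (fun=> 0%E) (@measurable_cst _ _ _ _ _ _) (fun=> lexx _).
  by rewrite integral0_eq ?mule0// => r _; rewrite mul0e.
have ap : 0 < a by rewrite lt_neqAle eq_sym aN0.
have ai0 : 0 < a^-1 by rewrite invr_gt0.
have mI1 : measurable_fun setT (\1_I : R -> R) by exact: measurable_indic.
have := Lnormd_radial hc ai0 mI1; rewrite invrK => ->.
rewrite powRM ?(ltW c0)// EFinM; apply: lee_wpmul2l; first by rewrite lee_fin powR_ge0.
rewrite -poweR_EFin; apply: le_poweR => //.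
  apply: integral_ge0 => s; rewrite /= in_itv /= andbT => s0.
  by rewrite lee_fin mulr_ge0 ?powR_ge0// exprn_ge0// ltW.
apply: le_trans hV; rewrite /wint integral_mkcond [leRHS]integral_mkcond.
have g0 s : pos s -> 0 <= s ^+ n.+2 by rewrite /= in_itv /= andbT => s0; rewrite exprn_ge0// ltW.
apply: ge0_le_integral_nomeas => s _; rewrite !patchE.
  by case: ifPn => [/set_mem/g0 h|//]; rewrite lee_fin mulr_ge0// powR_ge0.
case: ifPn => [/set_mem ps|ps]; last first.
  by rewrite memNset// => -[_]; move/mem_set; apply/negP.
rewrite indicE; case: (pselect (I s)) => Is.
  by rewrite mem_set// mem_set// normr1 powR1 mul1r.
rewrite memNset// memNset; last by case.
by rewrite normr0 powR0 ?mul0r// invr_eq0.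
Qed.

End testing.

(** * Necessary conditions on the exponents *)

Section necessity.
Context {R : realType}.
Local Notation pos := (`]0%R, +oo[%classic : set R).

Lemma exponent_le0 (k C e d0 : R) : 0 < k -> 0 < d0 ->
  (forall d, 0 < d < d0 -> k <= C * d `^ e) -> e <= 0.
Proof.
move=> k0 d00 h; rewrite leNgt; apply/negP => e0.
pose C' := Num.max C 1.
have C'0 : 0 < C' by rewrite lt_max ltr01 orbT.
pose d := Num.min (d0 / 2) ((k / (2 * C')) `^ e^-1).
have d_gt0 : 0 < d by rewrite lt_min divr_gt0// powR_gt0// divr_gt0// mulr_gt0.
have dd0 : d < d0 by rewrite gt_min; apply/orP; left; lra.
have := h d; rewrite d_gt0 dd0 => /(_ isT) h1.
have h2 : d `^ e <= k / (2 * C').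
  have k2 : 0 <= k / (2 * C') by rewrite divr_ge0 ?mulr_ge0// ltW.
  rewrite -[leRHS](powR_VK k2 (a := e)) ?gt_eqF//.
  by rewrite ler_powR2 ?(ltW e0) ?(ltW d_gt0)// ge_min lexx orbT.
have h3 : C * d `^ e <= C' * (k / (2 * C')).
  apply: (@le_trans _ _ (C' * d `^ e)); first by rewrite ler_wpM2r ?powR_ge0// le_max lexx.
  by rewrite ler_wpM2l// ltW.
have : C' * (k / (2 * C')) = k / 2 by field; rewrite gt_eqF.
lra.
Qed.

Lemma integral_pow_le m (x y : R) (I : set R) : 0 <= x -> x <= y -> measurable I -> I `<=` `[x, y] ->
  (\int[mu]_(r in I) (r ^+ m)%:E <= ((y - x) * y ^+ m)%:E)%E.
Proof.
move=> x0 xy mI hI; have y0 : 0 <= y by exact: le_trans xy.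
apply: (@le_trans _ _ (\int[mu]_(r in `[x, y]) (y ^+ m)%:E)%E).
  apply: ge0_le_integral_sub => r; last 2 first.
  - by move=> _; rewrite lee_fin exprn_ge0.
  - move=> Ir; split; first exact: hI.
    have := hI r Ir; rewrite /= in_itv /= => /andP[r1 r2].
    by rewrite lee_fin lerXn2r ?nnegrE ?(le_trans x0 r1).
  by move=> /hI; rewrite /= in_itv /= => /andP[r1 r2]; rewrite lee_fin exprn_ge0// (le_trans x0).
rewrite (_ : (fun=> _) = cst (y ^+ m)%:E)// integral_cst//=.
rewrite lebesgue_measure_itv /= lte_fin; case: ltP => h.
  by rewrite -EFinB -EFinM mulrC.
by rewrite mule0 lee_fin mulr_ge0 ?subr_ge0// exprn_ge0.
Qed.

Lemma integral_pow_ge m (x V : R) (Z : set R) : 0 <= x -> measurable Z -> Z `<=` `[x, +oo[ ->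
  (V%:E <= mu Z)%E -> ((x ^+ m * V)%:E <= \int[mu]_(r in Z) (r ^+ m)%:E)%E.
Proof.
move=> x0 mZ hZ hV.
have xm0 : 0 <= x ^+ m by exact: exprn_ge0.
apply: (@le_trans _ _ (\int[mu]_(r in Z) (x ^+ m)%:E)%E).
  rewrite (_ : (fun=> _) = cst (x ^+ m)%:E)// integral_cst// EFinM.
  by apply: lee_wpmul2l => //; rewrite lee_fin.
apply: ge0_le_integral_nomeas => r Zr; first by rewrite lee_fin.
have := hZ r Zr; rewrite /= in_itv /= andbT => xr.
by rewrite lee_fin lerXn2r ?nnegrE ?(le_trans x0 xr).
Qed.

Lemma Av_cst1 n r t (f0 : R -> R) : (forall w, f0 (Sf r t w) = 1) -> Av n r t f0 = @Jw R n.
Proof. by move=> h; rewrite /Av /Jw; apply: eq_integral => w _; rewrite h mul1r. Qed.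

(** Closing the grid cells of length s that meet [E] gives a cover, so there are at least N(E,s) of
    them. They are disjoint, being half-open, and each lies in the s-neighborhood. *)
Lemma measure_neighborhood_ge (E : set R) (s : R) : E `<=` `[1, 2] -> E !=set0 -> 0 < s -> s <= 1 ->
  ((s * Ncov E s)%:E <= mu (`[2^-1%R, 3%R] `&` [set r | (cdist E r <= s)%R]))%E.
Proof.
move=> hE E0 s0 s1; have [k hk [-> kmin]] := Ncov_attained hE s0.
pose cell (i : nat) := (`[1 + i%:R * s, 1 + i%:R * s + s[%classic : set R).
have celli (i : nat) r : cell i r -> i = Num.truncn ((r - 1) / s).
  rewrite /cell /= in_itv /= => /andP[h1 h2]; apply/esym/truncn_def.
  rewrite ler_pdivlMr// ltr_pdivrMr// -(natr1 i) mulrDl mul1r; apply/andP; split; lra.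
(* One cell more than 1/s rounded down, so that the point 2 is covered too. *)
pose K := (Num.truncn s^-1).+1.
pose T (i : 'I_K) : bool := `[< exists t, E t /\ cell i t >].
have cov : covers E s #|T|.
  exists (fun j : 'I_#|T| => 1 + (nat_of_ord (enum_val j : 'I_K))%:R * s) => t Et.
  have := hE t Et; rewrite /= in_itv /= => /andP[t1 t2].
  have u0 : 0 <= (t - 1) / s by rewrite divr_ge0 ?(ltW s0)//; lra.
  have iK : (Num.truncn ((t - 1) / s) < K)%N.
    rewrite ltnS; apply: le_truncn; rewrite -[leRHS]mul1r ler_pM2r ?invr_gt0//; lra.
  have ct : cell (Ordinal iK) t.
    rewrite /cell /= in_itv /=; have := truncn_itv u0.
    move: (Num.truncn _) => j; rewrite ler_pdivlMr// ltr_pdivrMr// -(natr1 j) mulrDl mul1r => /andP[h1 h2].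
    by apply/andP; split; lra.
  have Ti : Ordinal iK \in T by apply/asboolP; exists t.
  exists (enum_rank_in Ti (Ordinal iK)) => //.
  rewrite enum_rankK_in//; move: ct; rewrite /cell /= !in_itv /= => /andP[-> h].
  exact: ltW.
have mcell i : measurable (cell i) by exact: measurable_itv.
have mA : measurable (`[2^-1%R, 3%R] `&` [set r | (cdist E r <= s)%R]).
  by apply: measurableI; [exact: measurable_itv|exact: measurable_cdist_le].
apply: (@le_trans _ _ (mu (\big[setU/set0]_(i < K | T i) cell i))); last first.
  have mU : measurable (\big[setU/set0]_(i < K | T i) cell i).
    by apply: bigsetU_measurable => i _; exact: mcell.
  apply: (le_measure (@lebesgue_measure R) (mem_set mU) (mem_set mA)).
  apply: (big_ind (fun X => X `<=` _)) => [//|X Y hX hY r [/hX|/hY]//|i /asboolP[t [Et ct]] r].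
  have := hE t Et; move: ct; rewrite /cell /= !in_itv /= => /andP[h1 h2] /andP[t1 t2] /andP[r1 r2].
  have is0 : 0 <= i%:R * s by rewrite mulr_ge0// ltW.
  split; first by apply/andP; split; lra.
  by apply: (le_trans (cdist_le r Et)); rewrite ler_norml; apply/andP; split; lra.
have tri : trivIset (fun x : 'I_K => T x) (fun i : 'I_K => cell i).
  by move=> i j _ _ [r [/celli e1 /celli e2]]; apply: val_inj; rewrite /= e1 e2.
have -> : mu (\big[setU/set0]_(i < K | T i) cell i) = (\sum_(i < K | T i) mu (cell i))%E.
  apply: (@measure_bigsetU_ord_cond _ _ _ (@lebesgue_measure R) K (fun i => T i) (fun i => cell i)).
    by move=> i _; exact: mcell.
  exact: tri.
rewrite (eq_bigr (fun=> s%:E)); last first.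
  move=> i _; rewrite /= lebesgue_measure_itv /= lte_fin ltrDl s0 -EFinB; congr (_%:E); ring.
rewrite sumEFin sumr_const -(mulr_natr s) lee_fin ler_wpM2l ?(ltW s0)// ler_nat.
exact: kmin.
Qed.

Lemma expR_pow_powR (x b : R) k : (expR x ^+ k) `^ b = expR (b * (k%:R * x)).
Proof. by rewrite expR_exprn expR_powR. Qed.

(** For a ball of radius rho > 4 the average is full at radii between rho/4 and rho/2, since r + t <
    rho. Comparing rho^(d b) with rho^(d a) for large rho gives b <= a. *)
Lemma necessary_le n (E : set R) (a b : R) : E `<=` `[1, 2] -> E !=set0 -> 0 <= a -> 0 <= b ->
  bounded_rad n.+3 E a b -> b <= a.
Proof.
move=> hE E0 a0 b0 /(testing E0 b0)[C C0 hC].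
have [c c0 hc] := @Lnormd_indic_le R n a a0.
pose J := fine (@Jw R n.+3).
have JE : (J%:E = @Jw R n.+3)%E by rewrite fineK// Jw_fin.
have J0 : 0 < J by rewrite -lte_fin JE Jw_gt0.
pose N : R := n.+3%:R.
have N0 : 0 < N by rewrite ltr0n.
suff : N * (b - a) <= 0 by rewrite pmulr_rle0// subr_le0.
apply: (@exponent_le0 (J * expR (b * (N * - ln 4))) (C * c `^ a) _ 4^-1)=> // [|d /andP[d0 d4]].
  by rewrite mulr_gt0// expR_gt0.
pose l := ln d.
have dE : d = expR l by rewrite lnK.
(* The radius is 1/d, so that [exponent_le0], which lets d tend to 0, applies. *)
pose rho := expR (- l).
have rho4 : 4 < rho.
  rewrite /rho expRN -dE -[ltLHS]invrK ltf_pV2 ?posrE// ?invr_gt0//; lra.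
pose I := (`]-oo, rho]%classic : set R).
pose Z := (`](rho / 4), (rho / 2)[%classic : set R).
have mI : measurable I by exact: measurable_itv.
have mZ : measurable Z by exact: measurable_itv.
have rho0 : 0 < rho by lra.
have r4E : rho / 4 = expR (- l - ln 4) by rewrite expRD [expR (- ln 4)]expRN lnK ?posrE.
have V0 : 0 <= rho ^+ n.+3 by rewrite exprn_ge0// ltW.
have hI : (\int[mu]_(r in I `&` pos) (r ^+ n.+2)%:E <= (rho ^+ n.+3)%:E)%E.
  have -> : rho ^+ n.+3 = (rho - 0) * rho ^+ n.+2 by rewrite subr0 -exprS.
  apply: integral_pow_le => //; [exact: ltW|by apply: measurableI|].
  by move=> r []; rewrite /I /= !in_itv /= andbT => -> /ltW ->.
have VZ : (((rho / 4) ^+ n.+2 * (rho / 4))%:E <= \int[mu]_(r in Z) (r ^+ n.+2)%:E)%E.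
  apply: integral_pow_ge => //; first by rewrite divr_ge0// ltW.
    by move=> r; rewrite /Z /= !in_itv /= andbT => /andP[/ltW].
  rewrite /Z lebesgue_measure_itv /= lte_fin ifT; last lra.
  by rewrite -EFinB lee_fin; lra.
have := hC (\1_I : R -> R) ((c * rho ^+ n.+3) `^ a) J ((rho / 4) ^+ n.+2 * (rho / 4)) Z.
rewrite -exprSr in VZ *.
move=> /(_ _ _ (hc I _ mI V0 hI) (powR_ge0 _ _) (ltW J0) _ mZ _ VZ) h.
have {}h : J * ((rho / 4) ^+ n.+3) `^ b <= C * (c * rho ^+ n.+3) `^ a.
  apply: h.
  - exact: measurable_indic.
  - by move=> s.
  - by rewrite exprn_gt0// divr_gt0.
  - by move=> r; rewrite /Z /= !in_itv /= andbT => /andP[h _]; lra.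
  move=> r; rewrite /Z /= in_itv /= => /andP[r1 r2]; have [t Et] := E0; exists t => //.
  have := hE t Et; rewrite /= in_itv /= => /andP[t1 t2].
  rewrite Av_cst1 ?JE// => w; rewrite indicE mem_set// /I /= in_itv /=.
  have /andP[_ h2] : `|r - t| < Sf r t w < r + t by apply: Sf_itv; lra.
  by lra.
move: h; rewrite r4E expR_pow_powR (@powRM _ c) ?(ltW c0)// expR_pow_powR dE expR_powR => h.
have -> : expR (N * (b - a) * l) = expR (a * (N * - l)) * (expR (b * (N * - l)))^-1.
  by rewrite -expRN -expRD; congr expR; ring.
rewrite [leRHS]mulrA ler_pdivlMr ?expR_gt0// -[leLHS]mulrA -expRD -[leRHS]mulrA.
by apply: le_trans h; rewrite le_eqVlt; apply/orP; left; apply/eqP; congr (_ * expR _); rewrite /N; ring.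
Qed.

(** For |x| < d the sphere of radius t about x stays in the shell of width d around radius t. The
    average is thus full on a set of volume about d^(n+3), while the shell has volume about d. *)
Lemma necessary_dim n (E : set R) (a b : R) : E `<=` `[1, 2] -> E !=set0 -> 0 <= a -> 0 <= b ->
  bounded_rad n.+3 E a b -> a <= n.+3%:R * b.
Proof.
move=> hE E0 a0 b0 /(testing E0 b0)[C C0 hC].
have [c c0 hc] := @Lnormd_indic_le R n a a0.
have [t Et] := E0; have := hE t Et; rewrite /= in_itv /= => /andP[t1 t2].
pose J := fine (@Jw R n.+3).
have JE : (J%:E = @Jw R n.+3)%E by rewrite fineK// Jw_fin.
have J0 : 0 < J by rewrite -lte_fin JE Jw_gt0.
pose N : R := n.+3%:R.
pose c3 := c * (2 * 3 ^+ n.+2).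
have c30 : 0 <= c3 by apply: mulr_ge0; [exact: ltW|apply: mulr_ge0 => //; exact: exprn_ge0].
suff : a - N * b <= 0 by rewrite subr_le0.
apply: (@exponent_le0 (J * expR (b * (N * - ln 2))) (C * c3 `^ a) _ 4^-1)=> // [|d /andP[d0 d4]].
  by rewrite mulr_gt0// expR_gt0.
pose l := ln d.
have dE : d = expR l by rewrite lnK.
pose I := (`[t - d, t + d]%classic : set R).
pose Z := (`](d / 2), d[%classic : set R).
have mI : measurable I by exact: measurable_itv.
have mZ : measurable Z by exact: measurable_itv.
have d2E : d / 2 = expR (l - ln 2) by rewrite expRD expRN lnK ?posrE// -dE.
have V0 : 0 <= 2 * 3 ^+ n.+2 * d.
  by apply: mulr_ge0; [apply: mulr_ge0 => //; exact: exprn_ge0|exact: ltW].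
have hI : (\int[mu]_(r in I `&` pos) (r ^+ n.+2)%:E <= (2 * 3 ^+ n.+2 * d)%:E)%E.
  apply: (@le_trans _ _ (((t + d) - (t - d)) * (t + d) ^+ n.+2)%:E).
    apply: integral_pow_le; [lra|lra|by apply: measurableI; [|exact: measurable_itv]|].
    by move=> r [].
  have -> : 2 * 3 ^+ n.+2 * d = (t + d - (t - d)) * 3 ^+ n.+2 by ring.
  have h3 : (t + d) ^+ n.+2 <= 3 ^+ n.+2 by rewrite lerXn2r ?nnegrE//; lra.
  by rewrite lee_fin ler_wpM2l//; lra.
have VZ : (((d / 2) ^+ n.+2 * (d / 2))%:E <= \int[mu]_(r in Z) (r ^+ n.+2)%:E)%E.
  apply: integral_pow_ge => //; first by rewrite divr_ge0// ltW.
    by move=> r; rewrite /Z /= !in_itv /= andbT => /andP[/ltW].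
  rewrite /Z lebesgue_measure_itv /= lte_fin ifT; last lra.
  by rewrite -EFinB lee_fin; lra.
have := hC (\1_I : R -> R) ((c * (2 * 3 ^+ n.+2 * d)) `^ a) J ((d / 2) ^+ n.+2 * (d / 2)) Z.
rewrite -exprSr in VZ *.
move=> /(_ _ _ (hc I _ mI V0 hI) (powR_ge0 _ _) (ltW J0) _ mZ _ VZ) h.
have {}h : J * ((d / 2) ^+ n.+3) `^ b <= C * (c * (2 * 3 ^+ n.+2 * d)) `^ a.
  apply: h.
  - exact: measurable_indic.
  - by move=> s.
  - by rewrite exprn_gt0// divr_gt0.
  - by move=> r; rewrite /Z /= !in_itv /= andbT => /andP[h _]; lra.
  move=> r; rewrite /Z /= in_itv /= => /andP[r1 r2]; exists t => //.
  rewrite Av_cst1 ?JE// => w; rewrite indicE mem_set// /I /= in_itv /=.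
  have /andP[] : `|r - t| < Sf r t w < r + t by apply: Sf_itv; lra.
  rewrite distrC ger0_norm; last lra.
  by move=> h1 h2; apply/andP; split; lra.
move: h; rewrite mulrA -/c3 d2E expR_pow_powR (@powRM _ c3 d) ?(ltW d0)// dE !expR_powR => h.
have -> : expR ((a - N * b) * l) = expR (a * l) * (expR (b * (N * l)))^-1.
  by rewrite -expRN -expRD; congr expR; ring.
rewrite [leRHS]mulrA ler_pdivlMr ?expR_gt0// -[leLHS]mulrA -expRD -[leRHS]mulrA.
by apply: le_trans h; rewrite le_eqVlt; apply/orP; left; apply/eqP; congr (_ * expR _); rewrite /N; ring.
Qed.

(** If r is within s of [E], some t in [E] has |r - t| < 2 s. Then every u in [4 s, 5 s] satisfies
    the hypotheses of [ker_ge] (5 s <= 1/2 since s <= 1/16) and lies in the ball of radius 8 s. *)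
Lemma necessary_cover n (E : set R) (a b : R) : E `<=` `[1, 2] -> E !=set0 -> 0 <= a -> 0 <= b ->
  bounded_rad n.+3 E a b ->
  exists2 C, 0 <= C & forall s, 0 < s -> s <= 16^-1 ->
    (s * Ncov E s) `^ b <= C * s `^ (n.+3%:R * a - n.+2%:R).
Proof.
move=> hE E0 a0 b0 /(testing E0 b0)[C C0 hC].
have [c c0 hc] := @Lnormd_indic_le R n a a0.
pose A := (2^-1 ^+ n.+2) `^ b * 2^-1 ^+ n.+1 : R.
have A0 : 0 < A by rewrite mulr_gt0 ?powR_gt0 ?exprn_gt0.
pose B := C * (c * 8 ^+ n.+3) `^ a.
exists (B / A) => [|s s0 s1].
  by rewrite divr_ge0 ?(ltW A0)// mulr_ge0 ?powR_ge0.
have N1 : 1 <= Ncov E s by exact: Ncov_ge1.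
pose I := (`]-oo, 8 * s]%classic : set R).
pose Z := `[2^-1, 3]%classic `&` [set r | cdist E r <= s].
have mI : measurable I by exact: measurable_itv.
have mZ : measurable Z.
  by apply: measurableI; [exact: measurable_itv|exact: measurable_cdist_le].
have V0 : 0 <= (8 * s) ^+ n.+3 by rewrite exprn_ge0// mulr_ge0// ltW.
have hI : (\int[mu]_(r in I `&` pos) (r ^+ n.+2)%:E <= ((8 * s) ^+ n.+3)%:E)%E.
  have -> : (8 * s) ^+ n.+3 = (8 * s - 0) * (8 * s) ^+ n.+2 by rewrite subr0 -exprS.
  apply: integral_pow_le => //; [lra|by apply: measurableI; [|exact: measurable_itv]|].
  by move=> r []; rewrite /I /= !in_itv /= andbT => -> /ltW ->.
have Zs : Z `<=` `[2^-1, +oo[ by move=> r []; rewrite /= !in_itv /= andbT => /andP[].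
have VZ : (((2^-1 ^+ n.+2) * (s * Ncov E s))%:E <= \int[mu]_(r in Z) (r ^+ n.+2)%:E)%E.
  apply: integral_pow_ge => //.
  by apply: measure_neighborhood_ge => //; lra.
(* The interval [4 s, 5 s] has length s, and u/6 >= s/2 on it. *)
pose eta := s * (s / 2) ^+ n.+1.
have eta0 : 0 <= eta by apply: mulr_ge0; [exact: ltW|apply: exprn_ge0; rewrite divr_ge0// ltW].
have sN0 : 0 < s * Ncov E s by rewrite mulr_gt0//; lra.
have V'0 : 0 < 2^-1 ^+ n.+2 * (s * Ncov E s) :> R by apply: mulr_gt0 => //; rewrite exprn_gt0.
have := hC (\1_I : R -> R) ((c * (8 * s) ^+ n.+3) `^ a) eta (2^-1 ^+ n.+2 * (s * Ncov E s)) Z.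
move=> /(_ _ _ (hc I _ mI V0 hI) (powR_ge0 _ _) eta0 V'0 mZ _ VZ) h.
have {}h : eta * (2^-1 ^+ n.+2 * (s * Ncov E s)) `^ b <= C * (c * (8 * s) ^+ n.+3) `^ a.
  apply: h.
  - exact: measurable_indic.
  - by move=> u.
  - by move=> r /Zs; rewrite /= !in_itv /= !andbT => ?; lra.
  move=> r [] /=; rewrite in_itv /= => /andP[r1 r2] hr.
  have [t Et rt] := @cdist_lt _ E r (2 * s) E0 ltac:(lra).
  exists t => //; have := hE t Et; rewrite /= in_itv /= => /andP[t1 t2].
  have mI1 : measurable_fun setT (\1_I : R -> R) by exact: measurable_indic.
  have r0 : 0 < r by clear -r1; lra.
  have t0 : 0 < t by clear -t1; lra.
  rewrite Av_ker//.
  apply: (@le_trans _ _ (\int[mu]_(u in `[(4 * s)%R, (5 * s)%R]) ((s / 2) ^+ n.+1)%:E)%E).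
    rewrite (_ : (fun=> _) = cst ((s / 2) ^+ n.+1)%:E)// integral_cst//= lebesgue_measure_itv /= lte_fin.
    rewrite ifT; last by clear -s0; lra.
    rewrite -EFinB -EFinM lee_fin /eta le_eqVlt; apply/orP; left; apply/eqP; ring.
  have s20 : 0 <= (s / 2) ^+ n.+1 by apply: exprn_ge0; rewrite divr_ge0// ltW.
  apply: ge0_le_integral_sub => u.
  - by rewrite lee_fin.
  - by rewrite lee_fin mulr_ge0// ker_ge0.
  rewrite /= in_itv /= => /andP[u1 u2]; split.
    rewrite in_itv /=.
    have h1 : `|r - t| < u by clear -rt u1 s0; lra.
    have h2 : u < r + t by clear -u2 s1 r1 t1; lra.
    by rewrite h1 h2.
  rewrite indicE mem_set ?mul1r; last by rewrite /I /= in_itv /=; clear -u2 s0; lra.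
  rewrite lee_fin; apply: (@le_trans _ _ ((u / 6) ^+ n.+1)).
    have h1 : 0 <= s / 2 by clear -s0; lra.
    have h2 : 0 <= u / 6 by clear -u1 s0; lra.
    have h3 : s / 2 <= u / 6 by clear -u1 s0; lra.
    by rewrite lerXn2r ?nnegrE.
  have h1 : 0 < u by clear -u1 s0; lra.
  have h2 : u <= 2^-1 by clear -u2 s1; lra.
  have h3 : 2 * `|r - t| <= u by clear -rt u1; lra.
  exact: ker_ge.
rewrite mulrAC ler_pdivlMr//.
have s'0 : 0 < s ^+ n.+2 by exact: exprn_gt0.
have -> : s `^ (n.+3%:R * a - n.+2%:R) = s `^ (n.+3%:R * a) / s ^+ n.+2.
  rewrite powRD; last by rewrite (gt_eqF s0) implybT.
  by rewrite powRN powR_mulrn// ltW.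
rewrite [leRHS]mulrA ler_pdivlMr//.
have e1 : (2^-1 ^+ n.+2 * (s * Ncov E s)) `^ b = (2^-1 ^+ n.+2) `^ b * (s * Ncov E s) `^ b.
  by rewrite powRM ?(ltW sN0)// exprn_ge0.
have e2 : (c * (8 * s) ^+ n.+3) `^ a = (c * 8 ^+ n.+3) `^ a * s `^ (n.+3%:R * a).
  rewrite (@exprMn _ n.+3 8 s) mulrA (@powRM _ (c * 8 ^+ n.+3)) ?exprn_ge0 ?(ltW s0)//; last first.
    by rewrite mulr_ge0 ?exprn_ge0// ltW.
  by rewrite -(powR_mulrn n.+3 (ltW s0)) -powRrM.
have e3 : eta = s ^+ n.+2 * 2^-1 ^+ n.+1 by rewrite /eta (@exprMn _ n.+1 s) mulrA -exprS.
move: h; rewrite e1 e2 e3 [leRHS]mulrA -/B => h; apply: le_trans h.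
by rewrite le_eqVlt; apply/orP; left; apply/eqP; rewrite /A; ring.
Qed.

End necessity.

(** * The logarithmic necessary condition *)

Section necessity_log.
Context {R : realType}.
Local Notation pos := (`]0%R, +oo[%classic : set R).

Lemma integral_inv (x y : R) : 0 < x -> x < y ->
  (\int[mu]_(u in `[x, y]) (u^-1)%:E = (ln y - ln x)%:E)%E.
Proof.
move=> x0 xy; have y0 : 0 < y by exact: lt_trans xy.
have cln (u : R) : 0 < u -> {for u, continuous (@ln R)}.
  move=> u0; apply/differentiable_continuous/derivable1_diffP.
  by have := is_derive1_ln u0; case.
rewrite (@continuous_FTC2 _ (fun u => u^-1) (@ln R) x y xy) ?EFinB//.
- apply: continuous_in_subspaceT => u /set_mem; rewrite /= in_itv /= => /andP[u1 _].
  by apply: inv_continuous; rewrite gt_eqF// (lt_le_trans x0 u1).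
- split.
  + move=> u; rewrite in_itv /= => /andP[u1 _].
    by have := is_derive1_ln (lt_trans x0 u1); case.
  + by apply: cvg_at_right_filter; exact: cln.
  + by apply: cvg_at_left_filter; exact: cln.
- move=> u; rewrite in_itv /= => /andP[u1 _].
  by rewrite derive1E; have := is_derive1_ln (lt_trans x0 u1); case.
Qed.

(** The exponent of the test function is critical: since p (n + 2) = n + 3, both its p-th power norm
    and its averages near [E] are governed by the integral of 1/u, called [La]. Testing gives La (s
    N)^b <= C La^a, and 1 - a = 1/d produces the power q/d of the logarithm. *)
Lemma necessary_log_small n (E : set R) (b : R) (a := n.+2%:R / n.+3%:R : R) :
  E `<=` `[1, 2] -> E !=set0 -> 0 < b -> bounded_rad n.+3 E a b ->
  exists2 C, 0 <= C & forall s, 0 < s -> s < 16^-1 ->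
    (- ln (8 * s)) `^ (b^-1 / n.+3%:R) * (s * Ncov E s) <= C.
Proof.
move=> hE E0 b0 /(testing E0 (ltW b0))[C C0 hC].
have [c hc] := @polar_cst_exists R n.+2; have c0 := hc.1.
pose p : R := n.+3%:R / n.+2%:R.
have p0 : 0 < p by rewrite divr_gt0.
have aE : p^-1 = a by rewrite /p invf_div.
have pm : p * n.+2%:R = n.+3%:R by rewrite /p divfK.
have a1 : 1 - a = n.+3%:R^-1.
  by rewrite /a -(natr1 n.+2); field; rewrite gt_eqF// addr_gt0.
pose A := (2^-1 ^+ n.+2) `^ b * 6^-1 ^+ n.+1 : R.
have A0 : 0 < A by rewrite mulr_gt0 ?powR_gt0 ?exprn_gt0.
pose D := C * c `^ a / A.
have D0 : 0 <= D by rewrite divr_ge0 ?(ltW A0)// mulr_ge0 ?powR_ge0.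
exists (D `^ b^-1) => [|s s0 s1]; first exact: powR_ge0.
(* The integral of 1/u over [4 s, 1/2]. *)
pose La := - ln (8 * s).
have La0 : 0 < La by rewrite oppr_gt0 ln_lt0//; lra.
have N1 : 1 <= Ncov E s by exact: Ncov_ge1.
pose I := (`[4 * s, 2^-1]%classic : set R).
have mI : measurable I by exact: measurable_itv.
have IE : (\int[mu]_(u in I) (u^-1)%:E = La%:E)%E.
  rewrite /I integral_inv; [|lra|lra].
  congr (_%:E); rewrite /La (_ : 8 * s = (4 * s) / 2^-1); last by field.
  by rewrite ln_div ?posrE; lra.
pose f0 (u : R) := \1_I u * (`|u|^-1) ^+ n.+2.
have f00 u : 0 <= f0 u by rewrite mulr_ge0// exprn_ge0// invr_ge0.
have mi : measurable_fun setT (fun u : R => `|u|^-1).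
  have mn : measurable_fun setT (fun u : R => `|u|) by exact: measurableT_comp.
  exact: measurable_fun_inv mn.
have mf0 : measurable_fun setT f0.
  by apply: measurable_funM; [exact: measurable_indic|exact: measurable_funX].
have Ip u : I u -> 0 < u by rewrite /I /= in_itv /= => /andP[? _]; lra.
have hB : (Lnormd a (fun x : 'rV[R]_n.+3 => (f0 (enorm x))%:E) <= (c `^ a * La `^ a)%:E)%E.
  have := Lnormd_radial hc p0 mf0; rewrite aE => ->.
  rewrite EFinM; apply: lee_wpmul2l; first by rewrite lee_fin powR_ge0.
  rewrite -poweR_EFin; apply: le_poweR; first by rewrite -aE invr_ge0 ltW.
    apply: integral_ge0 => u; rewrite /= in_itv /= andbT => u0.
    by rewrite lee_fin mulr_ge0 ?powR_ge0// exprn_ge0// ltW.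
  rewrite -IE /wint integral_mkcond [leRHS]integral_mkcond.
  apply: ge0_le_integral_nomeas => u _; rewrite !patchE.
    case: ifPn => // /set_mem; rewrite /= in_itv /= andbT => u0.
    by rewrite lee_fin mulr_ge0 ?powR_ge0// exprn_ge0// ltW.
  rewrite /f0 indicE; case: (pselect (I u)) => Iu; last first.
    rewrite (memNset Iu) mul0r normr0 powR0 ?gt_eqF// mul0r.
    by case: ifP.
  have u0 := Ip u Iu.
  rewrite (mem_set Iu) mem_set ?mul1r; last by rewrite /= in_itv /= u0.
  rewrite lee_fin normrX normfV normr_id gtr0_norm//.
  have ui : 0 <= u^-1 by rewrite invr_ge0 ltW.
  rewrite -(powR_mulrn _ ui) -powRrM mulrC -(powR_inv1 (ltW u0)) -powRrM -(powR_mulrn _ (ltW u0)).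
  rewrite -powRD; last by rewrite (gt_eqF u0) implybT.
  rewrite le_eqVlt; apply/orP; left; apply/eqP; congr (_ `^ _).
  by rewrite [_ * p]mulrC pm -(natr1 n.+2); ring.
pose Z := `[2^-1, 3]%classic `&` [set r | cdist E r <= s].
have mZ : measurable Z.
  by apply: measurableI; [exact: measurable_itv|exact: measurable_cdist_le].
have Zs : Z `<=` `[2^-1, +oo[ by move=> r []; rewrite /= !in_itv /= andbT => /andP[].
have VZ : (((2^-1 ^+ n.+2) * (s * Ncov E s))%:E <= \int[mu]_(r in Z) (r ^+ n.+2)%:E)%E.
  apply: integral_pow_ge => //.
  by apply: measure_neighborhood_ge => //; lra.
have sN0 : 0 < s * Ncov E s by rewrite mulr_gt0//; lra.
have V'0 : 0 < 2^-1 ^+ n.+2 * (s * Ncov E s) :> R by apply: mulr_gt0 => //; rewrite exprn_gt0.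
have k0 : 0 <= 6^-1 ^+ n.+1 :> R by exact: exprn_ge0.
pose eta := 6^-1 ^+ n.+1 * La.
have eta0 : 0 <= eta by apply: mulr_ge0 => //; exact: ltW.
have B0 : 0 <= c `^ a * La `^ a by rewrite mulr_ge0 ?powR_ge0.
have := hC f0 _ eta (2^-1 ^+ n.+2 * (s * Ncov E s)) Z mf0 f00 hB B0 eta0 V'0 mZ _ VZ.
move=> h.
have {}h : eta * (2^-1 ^+ n.+2 * (s * Ncov E s)) `^ b <= C * (c `^ a * La `^ a).
  apply: h.
    by move=> r /Zs; rewrite /= !in_itv /= !andbT => ?; lra.
  move=> r [] /=; rewrite in_itv /= => /andP[r1 r2] hr.
  have [t Et rt] := @cdist_lt _ E r (2 * s) E0 ltac:(lra).
  exists t => //; have := hE t Et; rewrite /= in_itv /= => /andP[t1 t2].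
  have r0 : 0 < r by clear -r1; lra.
  have t0 : 0 < t by clear -t1; lra.
  rewrite Av_ker// /eta EFinM -IE.
  have mIi : measurable_fun I (fun u : R => (u^-1)%:E).
    apply/measurable_EFinP; apply: (eq_measurable_fun (fun u : R => `|u|^-1)).
      by move=> u /set_mem/Ip u0; rewrite gtr0_norm.
    exact: measurable_funTS.
  have Ii0 u : I u -> (0 <= (u^-1)%:E)%E by move=> /Ip u0; rewrite lee_fin invr_ge0 ltW.
  rewrite -(ge0_integralZl_EFin (@lebesgue_measure R) mI Ii0 mIi k0).
  apply: ge0_le_integral_sub => u.
  - by move=> Iu; apply: mule_ge0; [rewrite lee_fin|exact: Ii0].
  - by rewrite lee_fin mulr_ge0// ker_ge0.
  move=> Iu; have u0 := Ip u Iu.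
  have /andP[u1 u2] : 4 * s <= u <= 2^-1 by move: Iu; rewrite /I /= in_itv.
  have h1 : `|r - t| < u by clear -rt u1 s0; lra.
  have h2 : u < r + t by clear -u2 r1 t1; lra.
  split; first by rewrite /= in_itv /= h1 h2.
  have h3 : 2 * `|r - t| <= u by clear -rt u1; lra.
  rewrite -EFinM lee_fin /f0 indicE (mem_set Iu) mul1r gtr0_norm//.
  apply: (@le_trans _ _ (u^-1 ^+ n.+2 * (u / 6) ^+ n.+1)); last first.
    by rewrite ler_wpM2l ?exprn_ge0 ?invr_ge0 ?(ltW u0)//; exact: ker_ge.
  have e1 : u^-1 ^+ n.+1 * u ^+ n.+1 = 1 by rewrite -exprMn mulVf ?gt_eqF// expr1n.
  have -> : u^-1 ^+ n.+2 * (u / 6) ^+ n.+1 = u^-1 ^+ n.+1 * u ^+ n.+1 * (6^-1 ^+ n.+1 * u^-1).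
    by rewrite (@exprMn _ n.+1 u) exprS; ring.
  by rewrite e1 mul1r.
have h4 : (s * Ncov E s) `^ b * La `^ (1 - a) <= D.
  have Laa : 0 < La `^ a by exact: powR_gt0.
  have LE : La = La `^ (1 - a) * La `^ a.
    rewrite -powRD; last by rewrite (gt_eqF La0) implybT.
    by rewrite subrK powRr1// ltW.
  rewrite /D ler_pdivlMr// -(ler_pM2r Laa).
  have e1 : (2^-1 ^+ n.+2 * (s * Ncov E s)) `^ b = (2^-1 ^+ n.+2) `^ b * (s * Ncov E s) `^ b.
    by rewrite powRM ?(ltW sN0)// exprn_ge0.
  move: h; rewrite e1 /eta {1}LE [leRHS]mulrA => h; apply: le_trans h.
  by rewrite le_eqVlt; apply/orP; left; apply/eqP; rewrite /A; ring.
have bi0 : 0 <= b^-1 by rewrite invr_ge0 ltW.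
have l0 : 0 <= (s * Ncov E s) `^ b * La `^ (1 - a) by rewrite mulr_ge0 ?powR_ge0.
have := ler_powR2 bi0 l0 h4.
rewrite powRM ?powR_ge0// powR_KV ?(ltW sN0) ?gt_eqF// -powRrM a1 mulrC.
by rewrite [n.+3%:R^-1 * _]mulrC.
Qed.

Lemma necessary_log n (E : set R) (b : R) (a := n.+2%:R / n.+3%:R : R) :
  E `<=` `[1, 2] -> E !=set0 -> 0 < b -> bounded_rad n.+3 E a b ->
  exists C, forall s, 0 < s < 1 ->
    ln s^-1 `^ (b^-1 / n.+3%:R) * s * Ncov E s <= C.
Proof.
move=> hE E0 b0 /(necessary_log_small hE E0 b0)[C C0 hC].
pose e := b^-1 / n.+3%:R.
have e0 : 0 <= e by rewrite divr_ge0// invr_ge0 ltW.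
have l8 : 0 < ln 8 :> R by rewrite ln_gt0// ltr1n.
exists (2 `^ e * C + (2 * ln 8) `^ e * 2) => s /andP[s0 s1].
have lns : ln s^-1 = - ln s by rewrite lnV.
have ln_s0 : 0 < - ln s by rewrite oppr_gt0 ln_lt0// s0.
have N1 : 1 <= Ncov E s by exact: Ncov_ge1.
have sN : 0 <= s * Ncov E s by rewrite mulr_ge0 ?ltW//; lra.
rewrite lns -mulrA -/e.
(* For s <= 1/64, -ln(8 s) is at least half of -ln s. For larger s the logarithm is bounded and s
   N(E,s) <= 1 + s <= 2. *)
have [h|h] := leP (2 * ln 8) (- ln s).
  have ls : ln s < ln 16^-1.
    rewrite (_ : 16 = 2 * 8) ?lnV ?posrE//; last by lra.
    rewrite lnM ?posrE//; have : ln 2 < ln 8 :> R by rewrite ltr_ln ?posrE// ltr_nat.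
    by lra.
  have s16 : s < 16^-1 by rewrite -ltr_ln ?posrE.
  have L8 : ln (8 * s) = ln 8 + ln s by rewrite lnM ?posrE.
  rewrite -[leLHS]addr0 lerD ?mulr_ge0 ?powR_ge0//.
  apply: le_trans (ler_wpM2l (powR_ge0 2 e) (hC s s0 s16)).
  rewrite [leRHS]mulrA ler_wpM2r// -powRM//; last by rewrite L8; lra.
  by rewrite ler_powR2 ?L8 ?(ltW ln_s0)//; lra.
rewrite -[leLHS]add0r lerD ?mulr_ge0 ?powR_ge0//.
apply: ler_pM; rewrite ?powR_ge0//.
  by rewrite ler_powR2 ?(ltW ln_s0)// ltW.
apply: (le_trans (ler_wpM2l (ltW s0) (Ncov_le hE s0))).
by rewrite mulrDr mulfV ?gt_eqF//; lra.
Qed.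

End necessity_log.

(** * The type set *)

Section dimension.
Context {R : realType}.
Implicit Types (E : set R) (s : R).

Lemma ler_powR_exponent (s x y : R) : 0 < s -> s <= 1 -> x <= y -> s `^ y <= s `^ x.
Proof.
move=> s0 s1 xy; rewrite !powR_expR// ler_expR ler_wnM2r//.
by rewrite -ln1 ler_ln ?posrE.
Qed.

Lemma Ncov_le2 E s : E `<=` `[1, 2] -> 0 < s -> s <= 1 -> Ncov E s <= 2 * s `^ (- 1).
Proof.
move=> hE s0 s1; apply: (le_trans (Ncov_le hE s0)); rewrite powR_inv1 ?(ltW s0)//.
have : 1 <= s^-1 by rewrite invf_ge1.
lra.
Qed.

Lemma dimM_ge0 E : 0 <= dimM E.
Proof.
have [[x Sx]|h] := pselect ([set a : R | 0 < a /\ exists c : R, 0 < c /\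
        forall delta : R, 0 < delta < 1 -> Ncov E delta <= c * powR delta (- a)] !=set0).
  by apply: lb_le_inf; [exists x|move=> y [/ltW]].
by rewrite /dimM (_ : [set _ | _] = set0) ?inf0//; apply/eqP; apply/negPn/negP => /set0P.
Qed.

Lemma dimM_le E (e c : R) : 0 <= e ->
  (forall s, 0 < s < 1 -> Ncov E s <= c * s `^ (- e)) -> dimM E <= e.
Proof.
(* The infimum in [dimM] is over positive exponents and e may be 0, hence the approach from
   above. *)
move=> e0 h; apply/ler_addgt0Pr => eps eps0.
apply: ge_inf; first by exists 0 => a [/ltW].
split; first lra.
exists (Num.max c 1); split; first by rewrite lt_max ltr01 orbT.
move=> s /andP[s0 s1]; apply: (le_trans (h s _)); first by rewrite s0.
apply: (@le_trans _ _ (Num.max c 1 * s `^ (- e))).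
  by rewrite ler_wpM2r ?powR_ge0// le_max lexx.
rewrite ler_wpM2l ?le_max ?ler01 ?orbT//.
apply: ler_powR_exponent => //; [exact: ltW|lra].
Qed.

Lemma dimM_le1 E : E `<=` `[1, 2] -> dimM E <= 1.
Proof.
move=> hE; apply: (@dimM_le _ 1 2) => // s /andP[s0 /ltW s1].
exact: Ncov_le2.
Qed.

Lemma Ncov_dimM E (eps : R) : E `<=` `[1, 2] -> 0 < eps ->
  exists2 c, 0 <= c & forall s, 0 < s < 1 -> Ncov E s <= c * s `^ (- (dimM E + eps)).
Proof.
move=> hE eps0.
have [|a [a0 [c [c0 hc]]] ha] := @inf_adherent R [set a : R | 0 < a /\ exists c : R, 0 < c /\
        forall delta : R, 0 < delta < 1 -> Ncov E delta <= c * powR delta (- a)] eps eps0.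
  split; last by exists 0 => a [/ltW].
  exists 1; split => //; exists 2; split => // s /andP[s0 /ltW s1].
  exact: Ncov_le2.
exists c => [|s /andP[s0 s1]]; first exact: ltW.
apply: (le_trans (hc s _)); first by rewrite s0.
rewrite ler_wpM2l ?(ltW c0)//; apply: ler_powR_exponent => //; first exact: ltW.
by rewrite lerN2 ltW.
Qed.

(** Solving [necessary_cover] for N(E,s) gives the bound for small s. As N(E,s) >= 1, letting s tend
    to 0 shows that the exponent is nonnegative. *)
Lemma necessary_exponent n E (a b : R) (e := 1 - (n.+3%:R * a - n.+2%:R) / b) :
  E `<=` `[1, 2] -> E !=set0 -> 0 <= a -> 0 < b -> bounded_rad n.+3 E a b ->
  0 <= e /\ exists c, forall s, 0 < s < 1 -> Ncov E s <= c * s `^ (- e).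
Proof.
move=> hE E0 a0 b0 /(necessary_cover hE E0 a0 (ltW b0))[C C0 hC].
pose kap := n.+3%:R * a - n.+2%:R.
have bi0 : 0 <= b^-1 by rewrite invr_ge0 ltW.
pose D := C `^ b^-1.
have D0 : 0 <= D by exact: powR_ge0.
have h s : 0 < s -> s <= 16^-1 -> Ncov E s <= D * s `^ (- e).
  move=> s0 s1; have := hC s s0 s1.
  have N1 : 1 <= Ncov E s by exact: Ncov_ge1.
  have sN : 0 <= s * Ncov E s by rewrite mulr_ge0 ?(ltW s0)//; lra.
  move=> /(ler_powR2 bi0 (powR_ge0 _ _)).
  rewrite powR_KV ?gt_eqF// powRM ?powR_ge0// -powRrM -/kap -/D => h1.
  have -> : - e = kap / b + (- 1) by rewrite /e -/kap; ring.
  rewrite powRD; last by rewrite (gt_eqF s0) implybT.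
  by rewrite powR_inv1 ?(ltW s0)// mulrA ler_pdivlMr// mulrC.
split.
  suff : - e <= 0 by lra.
  apply: (@exponent_le0 _ 1 D (- e) 16^-1) => // s /andP[s0 s1].
  by apply: le_trans (h s s0 (ltW s1)); exact: Ncov_ge1.
(* [k] bounds s^(-e) from below on [1/16, 1], where N(E,s) <= 1 + 16. *)
pose k : R := Num.min 1 (16^-1 `^ (- e)).
have k0 : 0 < k by rewrite lt_min ltr01 powR_gt0.
exists (D + 17 / k) => s /andP[s0 s1].
have [s16|s16] := leP s 16^-1.
  apply: (le_trans (h s s0 s16)); rewrite ler_wpM2r ?powR_ge0// lerDl.
  by rewrite divr_ge0// ltW.
have ks : k <= s `^ (- e).
  have [e0|e0] := leP 0 e.
    by rewrite ge_min -[1]/(1%R) -{1}(powRr0 s) ler_powR_exponent ?(ltW s1)//; lra.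
  by rewrite ge_min; apply/orP; right; rewrite ler_powR2 ?(ltW s16)//; lra.
apply: (@le_trans _ _ (17 / k * k)).
  rewrite divfK ?gt_eqF//; apply: (le_trans (Ncov_le hE s0)).
  have : s^-1 <= 16 by rewrite -[leRHS]invrK lef_pV2 ?posrE ?invr_gt0// ltW.
  lra.
have k17 : 0 <= 17 / k by rewrite divr_ge0// ltW.
by apply: ler_pM => //; [exact: ltW|rewrite lerDr].
Qed.

Lemma natr_pred_sq n : ((n.+3 ^ 2).-1)%:R = n.+3%:R ^+ 2 - 1 :> R.
Proof.
have h : (0 < n.+3 ^ 2)%N by rewrite expn_gt0.
by rewrite -natrX -[in RHS](prednK h) -(natr1 (n.+3 ^ 2).-1) addrK.
Qed.

(** The three inequalities are the sides of the triangle: b = a through O and Q1, a = d b through O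
    and Q2, and the line through Q1 and Q2. *)
Lemma Delta_ineq n (beta a b : R) : 0 <= beta ->
  Delta n.+3 beta (a, b) <->
  [/\ b <= a, a <= n.+3%:R * b & n.+3%:R * a - n.+2%:R <= (1 - beta) * b].
Proof.
move=> be0; rewrite /Delta /Q1 /Q2 /=.
pose M : R := n.+2%:R.
have NE : n.+3%:R = M + 1 by rewrite -natr1.
have M2 : 2 <= M by rewrite ler_nat.
have e1 : (n.+3 * n.+2)%:R = (M + 1) * M by rewrite natrM NE.
have e2 : ((n.+3 ^ 2).-1)%:R = (M + 1) ^+ 2 - 1.
  by rewrite -NE natr_pred_sq.
rewrite e1 e2 NE -/M.
clearbody M.
have d1 : 0 < M + beta by lra.
have d2 : 0 < (M + 1) ^+ 2 - 1 + beta by nra.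
split.
  move=> [l1 [l2 [l10 [l20 [l12 [-> ->]]]]]].
  set q1 := M / (M + beta); set q2 := M / ((M + 1) ^+ 2 - 1 + beta).
  have q10 : 0 <= q1 by rewrite divr_ge0 ?(ltW d1)//; lra.
  have q20 : 0 <= q2 by rewrite divr_ge0 ?(ltW d2)//; lra.
  have Q2E : (M + 1) * M / ((M + 1) ^+ 2 - 1 + beta) = (M + 1) * q2 by rewrite /q2 mulrA.
  rewrite Q2E.
  have h1 : (M + 1) * q1 - (1 - beta) * q1 = M by rewrite /q1; field; rewrite gt_eqF.
  have h2 : (M + 1) * ((M + 1) * q2) - (1 - beta) * q2 = M by rewrite /q2; field; rewrite gt_eqF.
  have p1 : 0 <= l1 * q1 by rewrite mulr_ge0.
  have p2 : 0 <= l2 * q2 by rewrite mulr_ge0.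
  have Mp1 : 0 <= M * (l1 * q1) by rewrite mulr_ge0//; lra.
  have Mp2 : 0 <= M * (l2 * q2) by rewrite mulr_ge0//; lra.
  split; [nra|nra|].
  have : (l1 + l2) * M <= M by rewrite ler_piMl//; lra.
  have t1 : l1 * ((M + 1) * q1 - (1 - beta) * q1) = l1 * M by rewrite h1.
  have t2 : l2 * ((M + 1) * ((M + 1) * q2) - (1 - beta) * q2) = l2 * M by rewrite h2.
  by nra.
move=> [ba ab hk].
(* The barycentric weights of Q1 and Q2, proportional to the slack in the sides through O opposite
   to them. *)
exists (((M + 1) * b - a) * (M + beta) / M ^+ 2), ((a - b) * ((M + 1) ^+ 2 - 1 + beta) / M ^+ 2).
have M0 : 0 < M by lra.
have M20 : 0 < M ^+ 2 by rewrite exprn_gt0.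
split; first by rewrite divr_ge0 ?(ltW M20)// mulr_ge0 ?(ltW d1)//; lra.
split; first by rewrite divr_ge0 ?(ltW M20)// mulr_ge0 ?(ltW d2)//; lra.
split.
  have -> : ((M + 1) * b - a) * (M + beta) / M ^+ 2 + (a - b) * ((M + 1) ^+ 2 - 1 + beta) / M ^+ 2 =
      ((M + 1) * a - (1 - beta) * b) / M by field; rewrite gt_eqF.
  by rewrite ler_pdivrMr// mul1r; lra.
by congr (_, _); field; rewrite !gt_eqF.
Qed.

Lemma segment_eq n (beta a b : R) : 0 <= beta -> Delta n.+3 beta (a, b) ->
  segment (Q1 n.+3 beta) (Q2 n.+3 beta) (a, b) <-> n.+3%:R * a - n.+2%:R = (1 - beta) * b.
Proof.
move=> be0 /(Delta_ineq _ _ _ be0)[ba ab _]; rewrite /segment /Q1 /Q2 /=.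
pose M : R := n.+2%:R.
have NE : n.+3%:R = M + 1 by rewrite -natr1.
have M2 : 2 <= M by rewrite ler_nat.
have e1 : (n.+3 * n.+2)%:R = (M + 1) * M by rewrite natrM NE.
have e2 : ((n.+3 ^ 2).-1)%:R = (M + 1) ^+ 2 - 1.
  by rewrite -NE natr_pred_sq.
rewrite e1 e2; rewrite NE in ab *; rewrite -/M.
clearbody M.
have d1 : 0 < M + beta by lra.
have d2 : 0 < (M + 1) ^+ 2 - 1 + beta by nra.
have M0 : 0 < M by lra.
split.
  by move=> [s [_ [-> ->]]]; field; rewrite !gt_eqF.
move=> hk.
have sE : 1 - ((M + 1) * b - a) * (M + beta) / M ^+ 2 = (a - b) * ((M + 1) ^+ 2 - 1 + beta) / M ^+ 2.
  apply/eqP; rewrite subr_eq; apply/eqP.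
  have one : ((M + 1) * a - (1 - beta) * b) / M = 1.
    by rewrite -hk (_ : _ - _ = M) ?divff ?gt_eqF//; ring.
  by rewrite -[LHS]one; field; rewrite gt_eqF.
have M20 : 0 < M ^+ 2 by rewrite exprn_gt0.
exists (((M + 1) * b - a) * (M + beta) / M ^+ 2); split.
  rewrite -[X in _ && X]subr_ge0 sE; apply/andP; split; rewrite divr_ge0 ?(ltW M20)// mulr_ge0 ?(ltW d1) ?(ltW d2)//; lra.
by rewrite sE; congr (_, _); field; rewrite !gt_eqF.
Qed.

End dimension.

Section type_set.
Context {R : realType}.
Implicit Types (E : set R) (a b s : R).

(** The exponent e of [necessary_exponent] bounds the dimension from above, which is the third side
    of the triangle. On that side e equals the dimension, so the covering bound itself becomes the
    endpoint condition. *)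
Lemma Trad_ineq n E a b (beta := dimM E) : E `<=` `[1, 2] -> E !=set0 ->
  Trad n.+3 E (a, b) -> Delta n.+3 beta (a, b) /\
  (n.+3%:R * a - n.+2%:R = (1 - beta) * b ->
   exists C, forall s, 0 < s < 1 -> s `^ beta * Ncov E s <= C).
Proof.
move=> hE E0 [/= /andP[a0 a1] [/andP[b0 b1] hb]].
have be0 : 0 <= beta by exact: dimM_ge0.
have ba := necessary_le hE E0 a0 b0 hb.
have ab := necessary_dim hE E0 a0 b0 hb.
have [b_eq0|bN0] := eqVneq b 0.
  have a_eq0 : a = 0 by move: ba ab; rewrite b_eq0 mulr0 => h1 h2; apply/le_anti; rewrite h1 h2.
  split; last by rewrite a_eq0 b_eq0 !mulr0 sub0r => /eqP; rewrite oppr_eq0 pnatr_eq0.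
  by apply/(Delta_ineq _ _ _ be0); split => //; rewrite a_eq0 b_eq0 !mulr0 sub0r oppr_le0 ler0n.
have bp : 0 < b by rewrite lt_neqAle eq_sym bN0.
have [e0 [c hc]] := necessary_exponent hE E0 a0 bp hb.
have hbeta := dimM_le e0 hc.
split.
  apply/(Delta_ineq _ _ _ be0); split => //.
  by rewrite -ler_pdivrMr//; rewrite /beta; lra.
move=> heq; exists c => s s01; have /andP[s0 s1] := s01.
have := hc s s01; rewrite heq mulfK ?gt_eqF// (_ : 1 - (1 - beta) = beta); last by ring.
by rewrite powRN ler_pdivlMr ?powR_gt0// mulrC.
Qed.

Lemma Delta_bounds n beta a b : 0 <= beta -> Delta n.+3 beta (a, b) ->
  [/\ 0 <= a <= 1, 0 <= b <= 1 & b = 0 -> a = 0].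
Proof.
move=> be0 /(Delta_ineq _ _ _ be0); rewrite -(natr1 n.+2).
have : 2 <= n.+2%:R :> R by rewrite ler_nat.
move: n.+2%:R => M M2 [ba ab hk].
have b0 : 0 <= b by nra.
have bb : 0 <= beta * b by exact: mulr_ge0.
have a1 : a <= 1 by nra.
split; [apply/andP; split; lra|apply/andP; split; lra|].
by move=> b_eq0; apply/le_anti; move: ba ab; rewrite b_eq0 mulr0 => -> ->.
Qed.

(** [b'] is the dimension itself when the covering bound holds at the endpoint, and slightly larger
    otherwise. The vertex O is covered by the bound at p = q = oo. *)
Lemma Delta_sub_Trad n E a b b' C (beta := dimM E) : E `<=` `[1, 2] -> E !=set0 ->
  Delta n.+3 beta (a, b) -> 0 <= C -> 0 <= b' -> b' < 1 ->
  (0 < b -> n.+3%:R * a - n.+2%:R <= (1 - b') * b) ->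
  (forall s, 0 < s < 1 -> Ncov E s <= C * s `^ (- b')) ->
  Trad n.+3 E (a, b).
Proof.
move=> hE E0 hD C0 b'0 b'1 hk hN.
have be0 : 0 <= beta by exact: dimM_ge0.
have [a01 b01 hba] := Delta_bounds be0 hD.
split => //=; split => //.
have [b_eq0|bN0] := eqVneq b 0.
  by rewrite (hba b_eq0) b_eq0; exact: bounded_rad_infty.
have /andP[b0 _] := b01; have bp : 0 < b by rewrite lt_neqAle eq_sym bN0.
have [ba ab _] := (Delta_ineq _ _ _ be0).1 hD.
have /andP[_ a1] := a01.
by apply: (@bounded_rad_power _ n a b b' C) => //; exact: hk.
Qed.

End type_set.

Theorem theorem1p2 (R : realType) (d : nat) (hd : (3 <= d)%N)
  (E : set R) (hE : E `<=` `[1, 2]) (hE0 : E !=set0)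
  (beta : R) (hbeta : dimM E = beta) :
  (* (i) *)
  (beta < 1 ->
   (exists C : R, forall delta : R, 0 < delta < 1 ->
      powR delta beta * Ncov E delta <= C) ->
   Trad d E = Delta d beta)
  /\
  (* (ii) *)
  (~ (exists C : R, forall delta : R, 0 < delta < 1 ->
        powR delta beta * Ncov E delta <= C) ->
   Trad d E = Delta d beta `\` segment (Q1 d beta) (Q2 d beta))
  /\
  (* (iii) *)
  (forall q : R, d%:R / (d.-1)%:R <= q <= (d ^ 2)%:R / (d.-1)%:R ->
    (bounded_rad d E ((d.-1)%:R / d%:R) q^-1 <->
     exists C : R, forall delta : R, 0 < delta < 1 ->
       powR (ln delta^-1) (q / d%:R) * delta * Ncov E delta <= C)).
Proof.
subst beta; set beta := dimM E.
case: d hd => [|[|[|n]]]// _.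
have be0 : 0 <= beta by exact: dimM_ge0.
have be1 : beta <= 1 by exact: dimM_le1.
split; [|split].
- move=> be_lt1 [C hC]; apply/seteqP; split => -[a b].
    by move=> /(Trad_ineq hE hE0)[].
  move=> hD; have [_ _ hk] := (Delta_ineq _ _ _ be0).1 hD.
  apply: (@Delta_sub_Trad _ n E a b beta (Num.max C 0)) => //.
    by rewrite le_max lexx orbT.
  move=> s s01; have /andP[s0 s1] := s01.
  rewrite powRN ler_pdivlMr ?powR_gt0// mulrC (le_trans (hC s s01))//.
  by rewrite le_max lexx.
(* Dimension 1 is excluded here because s N(E,s) <= 2 always. *)
- move=> hC; have be_lt1 : beta < 1.
    rewrite lt_neqAle be1 andbT; apply/eqP => be_eq1; apply: hC.
    exists 2 => s /andP[s0 s1]; rewrite be_eq1 powRr1 ?(ltW s0)//.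
    have := ler_wpM2l (ltW s0) (Ncov_le2 hE s0 (ltW s1)).
    by rewrite powR_inv1 ?(ltW s0)// mulrCA mulfV ?gt_eqF// mulr1.
  apply/seteqP; split => -[a b].
    move=> /(Trad_ineq hE hE0)[hD heq]; split => //.
    by move=> /(segment_eq be0 hD)/heq.
  move=> [hD hseg]; have [ba ab hk] := (Delta_ineq _ _ _ be0).1 hD.
  have {}hk : n.+3%:R * a - n.+2%:R < (1 - beta) * b.
    rewrite lt_neqAle hk andbT; apply/eqP => /(segment_eq be0 hD).
    exact: hseg.
  have [_ /andP[b0 b1] _] := Delta_bounds be0 hD.
  (* Off the segment the third inequality is strict. Since b <= 1, raising the covering exponent by
     at most [gap] preserves it, and (1 - beta)/2 keeps the exponent below 1. *)
  pose gap := (1 - beta) * b - (n.+3%:R * a - n.+2%:R).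
  have gap0 : 0 < gap by rewrite subr_gt0.
  pose eps := Num.min ((1 - beta) / 2) gap.
  have eps0 : 0 < eps by rewrite lt_min gap0 andbT divr_gt0// subr_gt0.
  have eps1 : eps <= (1 - beta) / 2 by rewrite ge_min lexx.
  have eps2 : eps <= gap by rewrite ge_min lexx orbT.
  have [c c0 hc] := Ncov_dimM hE eps0.
  apply: (@Delta_sub_Trad _ n E a b (beta + eps) c) => //; [lra|lra|].
  move=> b_gt0; have : eps * b <= eps by rewrite ler_piMr// ltW.
  by move: eps2; rewrite /gap; lra.
- move=> q /andP[q1 q2].
  have N0 : 0 < n.+3%:R :> R by rewrite ltr0n.
  have M0 : 0 < n.+2%:R :> R by rewrite ltr0n.
  have q0 : 0 < q by rewrite (lt_le_trans _ q1)// divr_gt0.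
  split.
    move=> hb; have qi : 0 < q^-1 by rewrite invr_gt0.
    have [C hC] := necessary_log hE hE0 qi hb; exists C => s s01.
    by have := hC s s01; rewrite invrK.
  move=> [C hC]; apply: (@bounded_rad_log _ n q^-1 (Num.max C 0)) => //.
  + by rewrite invr_gt0.
  + by rewrite -invf_div lef_pV2// posrE divr_gt0.
  + move: q2; rewrite natrX expr2 ler_pdivlMr//= => q2.
    by rewrite ler_pdivrMr// mulrAC ler_pdivlMr// mulrC.
  + by rewrite le_max lexx orbT.
  + by move=> s s01; rewrite invrK (le_trans (hC s s01))// le_max lexx.
Qed.
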